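(* Let $\alpha,\beta>-1$, $0<p,q<\infty$, $\phi\in H(\mathbb D)$ and let $\varphi$ be an analytic self-map of $\mathbb D$. Then: (1) If $p<\alpha+2$, then $W_{\phi,\varphi}:D^p_\alpha\to D^q_\beta$ is order bounded if and only if $$\int_{\mathbb D}\frac{|\phi(z)\varphi'(z)|^q}{(1-|\varphi(z)|^2)^{q(\alpha+2)/p}}\,dA_\beta(z)+\int_{\mathbb D}\frac{|\phi'(z)|^q}{(1-|\varphi(z)|^2)^{q(\alpha+2-p)/p}}\,dA_\beta(z)<\infty.$$ (2) If $p=\alpha+2$, then $W_{\phi,\varphi}:D^p_\alpha\to D^q_\beta$ is order bounded if and only if $$\int_{\mathbb D}\frac{|\phi(z)\varphi'(z)|^q}{(1-|\varphi(z)|^2)^{q}}\,dA_\beta(z)+\int_{\mathbb D}\frac{|\phi'(z)|^q}{\left(\log\frac{2}{1-|\varphi(z)|^2}\right)^{q(1-p)/p}}\,dA_\beta(z)<\infty.$$ (3) If $p>\alpha+2$, then $W_{\phi,\varphi}:D^p_\alpha\to D^q_\beta$ is order bounded if and only if $\phi\in D^q_\beta$ and $$\int_{\mathbb D}\frac{|\phi(z)\varphi'(z)|^q}{(1-|\varphi(z)|^2)^{q(\alpha+2)/p}}\,dA_\beta(z)<\infty.$$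
   Context: $\mathbb D$ is the open unit disk, $H(\mathbb D)$ the space of analytic functions on $\mathbb D$, $dA=\frac1\pi dx\,dy$ the normalized area measure, and $dA_\beta(z)=(1-|z|^2)^\beta dA(z)$; $L^q(A_\beta)$ denotes the measurable functions $g$ on $\mathbb D$ with $\int_{\mathbb D}|g|^q dA_\beta<\infty$. For $0<p<\infty$, $\alpha>-1$, the weighted Dirichlet space $D^p_\alpha$ consists of $f\in H(\mathbb D)$ with $\|f\|_{D^p_\alpha}=\left(|f(0)|^p+\int_{\mathbb D}|f'(z)|^p(1-|z|^2)^\alpha\,dA(z)\right)^{1/p}<\infty$. For $\phi\in H(\mathbb D)$ and an analytic self-map $\varphi$ of $\mathbb D$, the weighted composition operator is $W_{\phi,\varphi}f(z)=\phi(z)f(\varphi(z))$. The operator $W_{\phi,\varphi}:D^p_\alpha\to D^q_\beta$ is called order bounded if there exists $g\in L^q(A_\beta)$ such that for every $f\in D^p_\alpha$ with $\|f\|_{D^p_\alpha}\le 1$, $|(W_{\phi,\varphi}f)'(z)|\le g(z)$ for $A_\beta$-almost every $z\in\mathbb D$. *)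

(* Defs.v *)
From HB Require Import structures.
From mathcomp Require Import all_boot all_order all_algebra.
From mathcomp Require Import all_classical all_reals all_analysis.
From mathcomp.real_closed Require Import complex.
Set Implicit Arguments. Unset Strict Implicit. Unset Printing Implicit Defensive.
Import Order.TTheory GRing.Theory Num.Theory.
Local Open Scope classical_set_scope.
Local Open Scope ring_scope.

Section WeightedDirichlet.
Variable R : realType.

Definition cabs (z : R[i]) : R := Num.sqrt (complex.Re z ^+ 2 + complex.Im z ^+ 2).

Definition toC (x : R * R) : R[i] := (x.1 +i* x.2)%C.

Definition inD (z : R[i]) : Prop := cabs z < 1.
Definition diskR2 : set (R * R) := [set x | inD (toC x)].

Definition is_cderiv (f : R[i] -> R[i]) (z l : R[i]) : Prop :=
  forall e : R, 0 < e -> exists2 d : R, 0 < d &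
    forall w : R[i], 0 < cabs (w - z) < d ->
      cabs ((f w - f z) / (w - z) - l) < e.

Definition analyticD (f : R[i] -> R[i]) : Prop :=
  forall z, inD z -> exists l, is_cderiv f z l.

(* the derivative f' (meaningful on D for f in H(D); limits are unique) *)
Definition cderiv (f : R[i] -> R[i]) (z : R[i]) : R[i] :=
  xget 0 [set l | is_cderiv f z l].

Definition selfmapD (vphi : R[i] -> R[i]) : Prop :=
  analyticD vphi /\ forall z, inD z -> inD (vphi z).

Definition leb2 := (@lebesgue_measure R \x @lebesgue_measure R)%E.

(* \int_D F dA_beta, with dA = (1/pi) dx dy and dA_beta = (1-|z|^2)^beta dA,
   for a nonnegative real function F on D *)
Definition intAb (beta : R) (F : R[i] -> R) : \bar R :=
  (\int[leb2]_(x in diskR2)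
     (F (toC x) * ((1 - cabs (toC x) ^+ 2) `^ beta) / pi)%:E)%E.

Definition normD (p alpha : R) (f : R[i] -> R[i]) : \bar R :=
  poweR ((powR (cabs (f 0)) p)%:E
     + intAb alpha (fun z => powR (cabs (cderiv f z)) p))%E p^-1.

Definition inDpa (p alpha : R) (f : R[i] -> R[i]) : Prop :=
  analyticD f /\ (normD p alpha f < +oo)%E.

Definition Wop (phi vphi f : R[i] -> R[i]) : R[i] -> R[i] :=
  fun z => phi z * f (vphi z).

Definition inLqAb (q beta : R) (g : R * R -> R) : Prop :=
  measurable_fun diskR2 g /\
  (intAb beta (fun z => powR `|g (complex.Re z, complex.Im z)| q) < +oo)%E.

Definition order_bounded (p alpha q beta : R) (phi vphi : R[i] -> R[i]) : Prop :=
  exists g : R * R -> R, inLqAb q beta g /\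
    forall f, inDpa p alpha f -> (normD p alpha f <= 1)%E ->
      {ae leb2, forall x, diskR2 x ->
         cabs (cderiv (Wop phi vphi f) (toC x)) <= g x}.

End WeightedDirichlet.

(* Main.v *)
(* Point evaluations on the unit ball of D^p_alpha are estimated from both
   sides.  Upper bounds: the submean inequality for |f'|^p on a square of size
   comparable to d = 1 - |z| gives |f'(z)| <= C d^(-(alpha+2)/p), and integrating
   along the radius bounds |f(z)|.  When p = alpha+2 this only gives a logarithm;
   its exponent (p-1)/p comes from applying the submean inequality on dyadic
   annuli, whose contributions to the norm sum to a constant, and Hoelder's
   inequality.  Lower bounds: powers of 1/(1 - conj(w) z) (partial sums of the
   logarithm of it when p = alpha+2), normalized through Forelli-Rudin
   estimates, attain these bounds at z = w.  Evaluating (W f)' = phi' f(vphi) +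
   phi vphi' f'(vphi) on test functions with w = vphi(z), one of which vanishes
   at w, separates the two terms, and order boundedness becomes the
   L^q(A_beta)-integrability of the two bounds. *)
Require Import Defs.
From HB Require Import structures.
From mathcomp Require Import all_boot all_order all_algebra.
From mathcomp Require Import all_classical all_reals all_analysis.
From mathcomp.real_closed Require Import complex.
From mathcomp Require Import measurable_realfun.
From mathcomp Require Import ring lra.
Set Implicit Arguments. Unset Strict Implicit. Unset Printing Implicit Defensive.
Import Order.TTheory GRing.Theory Num.Theory.
Import numFieldNormedType.Exports.
Local Open Scope classical_set_scope.
Local Open Scope ring_scope.

(* [lra] inspects all hypotheses and compares atoms up to unfolding; hiding what
   it does not need makes it much faster. *)
Ltac clear_nonorder := repeat match goal with
  | H : ?T |- _ => lazymatch type of T with Prop => lazymatch T with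
      | is_true (@Order.le _ _ ?x _) =>
          lazymatch type of x with \bar _ => clear H | _ => fail end
      | is_true (@Order.lt _ _ ?x _) =>
          lazymatch type of x with \bar _ => clear H | _ => fail end
      | @eq (Real.sort _) _ _ => fail
      | _ => clear H end end end;
  repeat match goal with x := _ |- _ => clearbody x end.
Tactic Notation "order_lra" := solve [clear_nonorder; lra | lra].
Tactic Notation "order_nra" := solve [clear_nonorder; nra | nra].

(** * Complex differentiation *)

Section Modulus.
Context {R : realType}.
Implicit Types z w : R[i].

(** The function theory is built on rectangles. Cauchy's formula keeps the integral of 1/(s - z) as
    an unevaluated factor, and a lower bound for that factor replaces the value 2 pi i.
    Differentiating the formula shows that f' is analytic, without which the submean inequality
    could not be applied to it. That inequality is obtained for |h| by choosing contours on which
    its line integral is small; |h|^p is then reached by elementary inequalities rather than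
    subharmonicity, with separate arguments for p >= 1 and p < 1. The Forelli-Rudin integrals are
    estimated along chords: |1 - conj(w) z| dominates, up to a constant, 1 - |w| plus the distance
    from z to the boundary point w/|w|, which leads to powers of one real variable. The test
    functions are integer powers of the kernel times real weights in w, so no branch of a complex
    power occurs. In the borderline case the length of the partial sum must grow as w nears the
    circle, whence a countable collection of test families. Constants are never sharp; only their
    independence of f, z and w matters. *)

Lemma cabsE z : cabs z = Normc.normc z.
Proof. by case: z. Qed.

Lemma cabs_ge0 z : 0 <= cabs z.
Proof. exact: sqrtr_ge0. Qed.

Lemma cabs0 : cabs (0 : R[i]) = 0.
Proof. by rewrite cabsE Normc.normc0. Qed.

Lemma cabs1 : cabs (1 : R[i]) = 1.
Proof. by rewrite cabsE Normc.normc1. Qed.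

Lemma cabsM z w : cabs (z * w) = cabs z * cabs w.
Proof. by rewrite !cabsE Normc.normcM. Qed.

Lemma cabsV z : cabs z^-1 = (cabs z)^-1.
Proof. by rewrite !cabsE Normc.normcV. Qed.

Lemma cabsN z : cabs (- z) = cabs z.
Proof. by rewrite !cabsE normcN. Qed.

Lemma cabsD z w : cabs (z + w) <= cabs z + cabs w.
Proof. by rewrite !cabsE le_normcD. Qed.

Lemma cabsX z n : cabs (z ^+ n) = cabs z ^+ n.
Proof. by elim: n => [|n IH]; rewrite ?expr0 ?cabs1// !exprS cabsM IH. Qed.

Lemma cabsBC z w : cabs (z - w) = cabs (w - z).
Proof. by rewrite -cabsN opprB. Qed.

Lemma cabsB z w : cabs (z - w) <= cabs z + cabs w.
Proof. by rewrite -[leRHS](congr1 (+%R _) (cabsN w)) cabsD. Qed.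

Lemma cabs_lerB z w : cabs z - cabs w <= cabs (z - w).
Proof. by rewrite lerBlDr -{1}(subrK w z) cabsD. Qed.

Lemma cabs_eq0 z : (cabs z == 0) = (z == 0).
Proof.
by apply/eqP/eqP => [|->]; rewrite ?cabs0// cabsE => /Normc.eq0_normc.
Qed.

Lemma cabs_gt0 z : (0 < cabs z) = (z != 0).
Proof. by rewrite lt_neqAle cabs_ge0 andbT eq_sym cabs_eq0. Qed.

Lemma cabs_sqr z : cabs z ^+ 2 = complex.Re z ^+ 2 + complex.Im z ^+ 2.
Proof. by rewrite sqr_sqrtr// addr_ge0// sqr_ge0. Qed.

Lemma cabs_Re z : `|complex.Re z| <= cabs z.
Proof. by rewrite -sqrtr_sqr ler_wsqrtr// lerDl sqr_ge0. Qed.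

Lemma cabs_Im z : `|complex.Im z| <= cabs z.
Proof. by rewrite -sqrtr_sqr ler_wsqrtr// lerDr sqr_ge0. Qed.

Lemma cabs_real (x : R) : cabs (x%:C)%C = `|x|.
Proof. by rewrite /cabs /= expr0n addr0 sqrtr_sqr. Qed.

Lemma cabs_imag (x : R) : cabs (0 +i* x)%C = `|x|.
Proof. by rewrite /cabs /= expr0n add0r sqrtr_sqr. Qed.

Lemma cabs_le_ReIm z : cabs z <= `|complex.Re z| + `|complex.Im z|.
Proof.
case: z => a b /=; have -> : (a +i* b)%C = (a%:C + (0 +i* b))%C by simpc.
by apply: le_trans (cabsD _ _) _; rewrite cabs_real cabs_imag.
Qed.

Lemma cabs_conj z : cabs (z^*)%C = cabs z.
Proof. by case: z => a b; rewrite /cabs /= sqrrN. Qed.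

Lemma mulc_conj z : (z * z^*)%C = ((cabs z ^+ 2)%:C)%C.
Proof.
by rewrite cabs_sqr; case: z => a b; simpc; rewrite /= -!expr2 (mulrC a) addNr.
Qed.

Lemma ReM_real (x : R) z : complex.Re ((x%:C)%C * z) = x * complex.Re z.
Proof. by case: z => a b /=; rewrite mul0r subr0. Qed.

Lemma polar z : exists2 zeta : R[i], cabs zeta = 1 & z = ((cabs z)%:C)%C * zeta.
Proof.
have [->|z0] := eqVneq z 0; first by exists 1; rewrite ?cabs1// cabs0 mul0r.
have r0 : cabs z != 0 by rewrite cabs_eq0.
exists (z / ((cabs z)%:C)%C).
  by rewrite cabsM cabsV cabs_real ger0_norm ?cabs_ge0// divff.
by rewrite mulrCA divff ?mulr1//; apply/eqP => /complexI /eqP; rewrite (negbTE r0).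
Qed.

End Modulus.

Section Derivative.
Context {R : realType}.
Implicit Types (z w l : R[i]) (f g : R[i] -> R[i]).

Definition ccont f z := forall e : R, 0 < e ->
  exists2 d : R, 0 < d & forall w, cabs (w - z) < d -> cabs (f w - f z) < e.

Lemma ccont_cst c z : ccont (fun=> c) z.
Proof. by move=> e e0; exists 1 => // w _; rewrite subrr cabs0. Qed.

Lemma ccont_id z : ccont id z.
Proof. by move=> e e0; exists e. Qed.

Lemma ccontJ z : ccont (fun w => w^*%C) z.
Proof. by move=> e e0; exists e => // w; rewrite -rmorphB cabs_conj. Qed.

Lemma ccontD f g z : ccont f z -> ccont g z -> ccont (fun w => f w + g w) z.
Proof.
move=> cf cg e e0; have e20 : 0 < e / 2 by order_lra.
have [d1 d10 h1] := cf _ e20; have [d2 d20 h2] := cg _ e20.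
exists (Num.min d1 d2); rewrite ?lt_min ?d10// => w; rewrite lt_min => /andP[wd1 wd2].
rewrite opprD addrACA; apply: le_lt_trans (cabsD _ _) _.
by have := h1 _ wd1; have := h2 _ wd2; order_lra.
Qed.

Lemma ccontN f z : ccont f z -> ccont (fun w => - f w) z.
Proof.
move=> cf e e0; have [d d0 h] := cf _ e0; exists d => // w /h.
by rewrite -opprD cabsN.
Qed.

Lemma ccontM f g z : ccont f z -> ccont g z -> ccont (fun w => f w * g w) z.
Proof.
move=> cf cg e e0.
have G0 := cabs_ge0 (g z); have F0 := cabs_ge0 (f z).
have k0 : 0 < e / (2 * (cabs (f z) + 1)) by apply: divr_gt0; order_lra.
have m0 : 0 < e / (2 * (cabs (g z) + 1)) by apply: divr_gt0; order_lra.
have [d1 d10 h1] := cf _ m0; have [d2 d20 h2] := cg _ k0.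
have [d3 d30 h3] := cg _ ltr01.
exists (Num.min d1 (Num.min d2 d3)).
  by rewrite !lt_min d10 d20.
move=> w; rewrite !lt_min => /and3P[/h1 H1 /h2 H2 /h3 H3].
have -> : f w * g w - f z * g z = (f w - f z) * g w + f z * (g w - g z) by ring.
have gw : cabs (g w) <= cabs (g z) + 1 by have := cabs_lerB (g w) (g z); order_lra.
apply: le_lt_trans (cabsD _ _) _; rewrite !cabsM.
have A : cabs (f w - f z) * cabs (g w) <= e / 2.
  apply: (@le_trans _ _ (e / (2 * (cabs (g z) + 1)) * (cabs (g z) + 1))).
    by apply: ler_pM; rewrite ?cabs_ge0//; exact: ltW.
  by rewrite le_eqVlt; apply/orP; left; apply/eqP; field; order_lra.
have B : cabs (f z) * cabs (g w - g z) < e / 2.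
  apply: (@le_lt_trans _ _ (cabs (f z) * (e / (2 * (cabs (f z) + 1))))).
    by apply: ler_wpM2l => //; exact: ltW.
  rewrite [ltRHS](_ : _ = (cabs (f z) + 1) * (e / (2 * (cabs (f z) + 1)))).
    by rewrite ltr_pM2r//; order_lra.
  by field; order_lra.
by order_lra.
Qed.

Lemma ccontV f z : ccont f z -> f z != 0 -> ccont (fun w => (f w)^-1) z.
Proof.
move=> cf fz0 e e0; set a := cabs (f z); have a0 : 0 < a by rewrite cabs_gt0.
have m0 : 0 < e * a ^+ 2 / 2 by rewrite !mulr_gt0 ?exprn_gt0//; order_lra.
have [d1 d10 h1] := cf _ m0; have [d2 d20 h2] := cf _ (divr_gt0 a0 (@ltr0n R 2)).
exists (Num.min d1 d2); first by rewrite lt_min d10.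
move=> w; rewrite !lt_min => /andP[/h1 H1 /h2 H2].
have fw : a / 2 < cabs (f w).
  by have := cabs_lerB (f z) (f w); rewrite cabsBC -/a; order_lra.
have fw0 : f w != 0 by rewrite -cabs_gt0; order_lra.
have -> : (f w)^-1 - (f z)^-1 = (f z - f w) / (f w * f z).
  by field; rewrite fw0 fz0.
rewrite cabsM cabsV cabsM -/a cabsBC ltr_pdivrMr; last by apply: mulr_gt0 => //; order_lra.
apply: lt_le_trans H1 _; rewrite expr2 -!mulrA ler_pM2l//; order_nra.
Qed.

Lemma ccont_comp f g z : ccont f z -> ccont g (f z) -> ccont (fun w => g (f w)) z.
Proof.
move=> cf cg e e0; have [d d0 h] := cg _ e0; have [d' d'0 h'] := cf _ d0.
by exists d' => // w /h' /h.
Qed.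

Lemma ccontX f n z : ccont f z -> ccont (fun w => f w ^+ n) z.
Proof.
move=> cf; elim: n => [|n IH]; first exact: ccont_cst.
have -> : (fun w => f w ^+ n.+1) = (fun w => f w * f w ^+ n).
  by apply/funext => w; rewrite exprS.
exact: ccontM.
Qed.

Lemma ccont_sum n (F : nat -> R[i] -> R[i]) z : (forall k, ccont (F k) z) ->
  ccont (fun w => \sum_(k < n) F k w) z.
Proof.
move=> cF; elim: n => [|n IH].
  rewrite (_ : (fun w => _) = fun=> 0); first exact: ccont_cst.
  by apply/funext => w; rewrite big_ord0.
rewrite (_ : (fun w => _) = fun w => \sum_(k < n) F k w + F n w).
  exact: ccontD.
by apply/funext => w; rewrite big_ord_recr.
Qed.

Lemma ccont_ext f g z (r : R) : 0 < r ->
  (forall w, cabs (w - z) < r -> f w = g w) -> ccont f z -> ccont g z.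
Proof.
move=> r0 fg cf e e0; have [d d0 h] := cf _ e0.
exists (Num.min r d); rewrite ?lt_min ?r0// => w; rewrite lt_min => /andP[wr /h].
by rewrite fg// fg// subrr cabs0.
Qed.

(** Caratheodory's form of differentiability: the difference quotient, completed by [l] at [z], is a
    continuous slope function. Limits and divisions disappear, so the product and chain rules become
    algebra on slopes; [cauchy_formula] uses the same slope to remove a pole. *)
Lemma is_cderivP f z l : is_cderiv f z l <->
  exists g, [/\ ccont g z, g z = l & forall w, f w - f z = g w * (w - z)].
Proof.
split=> [h|[g [cg gl fg]]].
  exists (fun w => if w == z then l else (f w - f z) / (w - z)); split.
  - move=> e e0; have [d d0 H] := h _ e0; exists d => // w wz; rewrite eqxx.
    case: eqVneq => [_|wz0]; first by rewrite subrr cabs0.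
    by apply: H; rewrite wz andbT cabs_gt0 subr_eq0.
  - by rewrite eqxx.
  - move=> w; case: eqVneq => [->|wz0]; first by rewrite !subrr mulr0.
    by rewrite divfK// subr_eq0.
move=> e e0; have [d d0 H] := cg _ e0; exists d => // w /andP[wz0 /H].
by rewrite gl fg mulfK// -cabs_gt0.
Qed.

Lemma is_cderiv_uniq f z l1 l2 : is_cderiv f z l1 -> is_cderiv f z l2 -> l1 = l2.
Proof.
move=> h1 h2; apply/eqP; rewrite -subr_eq0 -cabs_eq0; apply/negPn/negP.
rewrite cabs_eq0 -cabs_gt0 => e0; have e20 : 0 < cabs (l1 - l2) / 2 by order_lra.
have [d1 d10 H1] := h1 _ e20; have [d2 d20 H2] := h2 _ e20.
(* The two limits are compared at one point, at real distance d/2 from z, which lies in both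
   punctured neighbourhoods. *)
pose d := Num.min d1 d2; have d0 : 0 < d by rewrite lt_min d10.
have D : cabs (z + ((d / 2)%:C)%C - z) = d / 2.
  by rewrite addrC addKr cabs_real ger0_norm//; order_lra.
have dd1 : d <= d1 by rewrite ge_min lexx.
have dd2 : d <= d2 by rewrite ge_min lexx orbT.
clearbody d.
have := H1 (z + ((d / 2)%:C)%C); have := H2 (z + ((d / 2)%:C)%C).
rewrite D; set q := (f _ - f z) / _ => A B.
have {}A : cabs (q - l2) < cabs (l1 - l2) / 2 by apply: A; order_lra.
have {}B : cabs (q - l1) < cabs (l1 - l2) / 2 by apply: B; order_lra.
have := cabsB (q - l2) (q - l1).
by rewrite opprB addrC addrA subrK; order_lra.
Qed.

Lemma cderivE f z l : is_cderiv f z l -> cderiv f z = l.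
Proof.
move=> h; rewrite /cderiv; case: xgetP => [y _ hy|/(_ l)//].
exact: is_cderiv_uniq hy h.
Qed.

Lemma is_cderiv_cont f z l : is_cderiv f z l -> ccont f z.
Proof.
move=> /is_cderivP[g [cg _ fg]].
have -> : f = (fun w => g w * (w - z) + f z).
  by apply/funext => w; rewrite -fg subrK.
apply: ccontD; last exact: ccont_cst.
by apply: ccontM => //; apply: ccontD; [exact: ccont_id|exact: ccont_cst].
Qed.

Lemma is_cderiv_ext f g z l (r : R) : 0 < r ->
  (forall w, cabs (w - z) < r -> f w = g w) -> is_cderiv f z l -> is_cderiv g z l.
Proof.
move=> r0 fg df e e0; have [d d0 h] := df _ e0.
exists (Num.min r d); rewrite ?lt_min ?r0// => w.
rewrite lt_min => /and3P[wz wr wd]; rewrite -!fg//; last by rewrite subrr cabs0.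
by apply: h; rewrite wz.
Qed.

Lemma is_cderiv_cst c z : is_cderiv (fun=> c) z 0.
Proof.
by apply/is_cderivP; exists (fun=> 0); split; [exact: ccont_cst|by []|
  move=> w; rewrite mul0r subrr].
Qed.

Lemma is_cderiv_id z : is_cderiv id z 1.
Proof.
by apply/is_cderivP; exists (fun=> 1); split; [exact: ccont_cst|by []|
  move=> w; rewrite mul1r].
Qed.

Lemma is_cderivD f g z l m : is_cderiv f z l -> is_cderiv g z m ->
  is_cderiv (fun w => f w + g w) z (l + m).
Proof.
move=> /is_cderivP[F [cF <- Ff]] /is_cderivP[G [cG <- Gg]].
apply/is_cderivP; exists (fun w => F w + G w); split=> //; first exact: ccontD.
by move=> w; rewrite mulrDl -Ff -Gg; ring.
Qed.

Lemma is_cderivM f g z l m : is_cderiv f z l -> is_cderiv g z m ->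
  is_cderiv (fun w => f w * g w) z (l * g z + f z * m).
Proof.
move=> df dg; have cg := is_cderiv_cont dg.
move: df dg => /is_cderivP[F [cF <- Ff]] /is_cderivP[G [cG <- Gg]].
apply/is_cderivP; exists (fun w => F w * g w + f z * G w); split=> //.
  by apply: ccontD; apply: ccontM => //; exact: ccont_cst.
move=> w; rewrite mulrDl -mulrA (mulrC (g w)) mulrA -Ff -mulrA -Gg; ring.
Qed.

Lemma is_cderivZ c f z l : is_cderiv f z l -> is_cderiv (fun w => c * f w) z (c * l).
Proof.
move=> df; have := is_cderivM (is_cderiv_cst c z) df.
by rewrite mul0r add0r.
Qed.

Lemma is_cderivN f z l : is_cderiv f z l -> is_cderiv (fun w => - f w) z (- l).
Proof.
move=> df; rewrite (_ : (fun w => - f w) = fun w => -1 * f w); last first.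
  by apply/funext => w; rewrite mulN1r.
by have := is_cderivZ (-1) df; rewrite mulN1r.
Qed.

Lemma is_cderivB f g z l m : is_cderiv f z l -> is_cderiv g z m ->
  is_cderiv (fun w => f w - g w) z (l - m).
Proof. by move=> df /is_cderivN; exact: is_cderivD. Qed.

Lemma is_cderiv_comp f g z l m : is_cderiv f z l -> is_cderiv g (f z) m ->
  is_cderiv (fun w => g (f w)) z (m * l).
Proof.
move=> df dg; have cf := is_cderiv_cont df.
move: df dg => /is_cderivP[F [cF <- Ff]] /is_cderivP[G [cG <- Gg]].
apply/is_cderivP; exists (fun w => G (f w) * F w); split=> //.
  by apply: ccontM => //; exact: ccont_comp.
by move=> w; rewrite -mulrA -Ff Gg.
Qed.

Lemma is_cderivV f z l : is_cderiv f z l -> f z != 0 ->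
  is_cderiv (fun w => (f w)^-1) z (- l / f z ^+ 2).
Proof.
move=> df fz; have cf := is_cderiv_cont df.
have [d d0 fw0] : exists2 d : R, 0 < d & forall w, cabs (w - z) < d -> f w != 0.
  have [|d d0 h] := cf (cabs (f z)); first by rewrite cabs_gt0.
  exists d => // w /h; apply: contraTneq => ->.
  by rewrite sub0r cabsN ltxx.
move: df => /is_cderivP[F [cF <- Ff]].
(* Off the zeros of f the difference quotient is -F/(f f(z)); elsewhere its value is irrelevant. *)
pose G w := if f w == 0 then ((f w)^-1 - (f z)^-1) / (w - z) else - F w / (f w * f z).
apply/is_cderivP; exists G; split=> //.
- apply: (@ccont_ext (fun w => - F w / (f w * f z)) G z d d0) => [w /fw0 fw|].
    by rewrite /G (negbTE fw).
  apply: ccontM; first exact: ccontN.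
  apply: ccontV; last by rewrite mulf_neq0.
  by apply: ccontM => //; exact: ccont_cst.
- by rewrite /G (negbTE fz) expr2.
- move=> w; rewrite /G; case: ifPn => [fw|fw].
    rewrite divfK// subr_eq0; apply: contraTneq fw => ->.
    exact: fz.
  have -> : - F w / (f w * f z) * (w - z) = - (F w * (w - z)) / (f w * f z) by ring.
  by rewrite -Ff; field; rewrite fw fz.
Qed.

Lemma is_cderivX f n z l : is_cderiv f z l ->
  is_cderiv (fun w => f w ^+ n) z (n%:R * f z ^+ n.-1 * l).
Proof.
move=> df; elim: n => [|n IH]; first by rewrite !mul0r; exact: is_cderiv_cst.
rewrite (_ : (fun w => _) = (fun w => f w * f w ^+ n)); last first.
  by apply/funext => w; rewrite exprS.
rewrite (_ : _ * l = l * f z ^+ n + f z * (n%:R * f z ^+ n.-1 * l)).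
  exact: is_cderivM.
case: n {IH} => [|n]; first by rewrite !expr0; ring.
by rewrite /= !exprS -!natr1; ring.
Qed.

Lemma is_cderiv_sum n (F : nat -> R[i] -> R[i]) (l : nat -> R[i]) z :
  (forall k, is_cderiv (F k) z (l k)) ->
  is_cderiv (fun w => \sum_(k < n) F k w) z (\sum_(k < n) l k).
Proof.
move=> dF; elim: n => [|n IH].
  rewrite big_ord0 (_ : (fun w => _) = fun=> 0); first exact: is_cderiv_cst.
  by apply/funext => w; rewrite big_ord0.
rewrite big_ord_recr (_ : (fun w => _) = fun w => \sum_(k < n) F k w + F n w).
  exact: is_cderivD.
by apply/funext => w; rewrite big_ord_recr.
Qed.

Lemma is_cderivD_cderiv f z : analyticD f -> inD z -> is_cderiv f z (cderiv f z).
Proof. by move=> af /af[l h]; rewrite (cderivE h). Qed.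

Lemma analyticD_cont f z : analyticD f -> inD z -> ccont f z.
Proof. by move=> af /(is_cderivD_cderiv af)/is_cderiv_cont. Qed.

Lemma inD_ball z : inD z -> forall w, cabs (w - z) < 1 - cabs z -> inD w.
Proof. by move=> _ w; have := cabsD (w - z) z; rewrite subrK /inD; order_lra. Qed.

Lemma inD_ball_gt0 z : inD z -> 0 < 1 - cabs z.
Proof. by rewrite subr_gt0. Qed.

End Derivative.

(** * Integrals of complex functions over a real interval *)

Section LineIntegral.
Context {R : realType}.
Notation mu := (@lebesgue_measure R).
Implicit Types (F G : R -> R[i]) (a b m t : R).

Definition rcont F t := forall e : R, 0 < e ->
  exists2 d : R, 0 < d & forall s, `|s - t| < d -> cabs (F s - F t) < e.

Definition rcont_on a b F := forall t, a <= t <= b -> rcont F t.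

Definition cint a b F : R[i] :=
  (\int[mu]_(t in `[a, b]) complex.Re (F t) +i*
   \int[mu]_(t in `[a, b]) complex.Im (F t))%C.

(** Stated for any 1-Lipschitz [p], so that the real part, the imaginary part and the modulus are
    covered by one argument. *)
Lemma rcont_real (F : R -> R[i]) (p : R[i] -> R) t :
  (forall z w, `|p z - p w| <= cabs (z - w)) -> rcont F t ->
  {for t, continuous (fun s => p (F s))}.
Proof.
move=> pL cF; apply/cvgrPdist_lt => e e0; have [d d0 h] := cF _ e0.
near=> s; rewrite distrC; apply: le_lt_trans (pL _ _) _; apply: h.
by rewrite distrC; near: s; exact: cvgr_dist_lt.
Unshelve. all: by end_near. Qed.

Lemma Re_lip (z w : R[i]) : `|complex.Re z - complex.Re w| <= cabs (z - w).
Proof. by case: z w => [a b] [c d]; exact: (cabs_Re ((a +i* b) - (c +i* d))%C). Qed.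

Lemma Im_lip (z w : R[i]) : `|complex.Im z - complex.Im w| <= cabs (z - w).
Proof. by case: z w => [a b] [c d]; exact: (cabs_Im ((a +i* b) - (c +i* d))%C). Qed.

Lemma cabs_lip (z w : R[i]) : `|cabs z - cabs w| <= cabs (z - w).
Proof.
by rewrite ler_norml cabs_lerB andbT; have := cabs_lerB w z; rewrite cabsBC; order_lra.
Qed.

Lemma continuous_itv_integrable (f : R -> R) a b :
  (forall t, a <= t <= b -> {for t, continuous f}) ->
  mu.-integrable `[a, b] (EFin \o f).
Proof.
move=> cf; apply: continuous_compact_integrable; first exact: segment_compact.
by apply: continuous_in_subspaceT => t; rewrite inE /= in_itv /= => /cf.
Qed.

Lemma rcont_integrable (p : R[i] -> R) a b F :
  (forall z w, `|p z - p w| <= cabs (z - w)) -> rcont_on a b F ->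
  mu.-integrable `[a, b] (EFin \o (fun t => p (F t))).
Proof.
by move=> pL cF; apply: continuous_itv_integrable => t /cF; exact: rcont_real.
Qed.

Lemma rcont_comp a b (f : R[i] -> R[i]) (l : R -> R[i]) :
  (forall s t, cabs (l s - l t) = `|s - t|) ->
  (forall t, a <= t <= b -> ccont f (l t)) -> rcont_on a b (fun t => f (l t)).
Proof.
move=> hl cf t tab e e0; have [d d0 h] := cf _ tab _ e0.
by exists d => // s st; apply: h; rewrite hl.
Qed.

Lemma rcontD F G t : rcont F t -> rcont G t -> rcont (fun s => F s + G s) t.
Proof.
move=> cF cG e e0; have e20 : 0 < e / 2 by order_lra.
have [d1 d10 h1] := cF _ e20; have [d2 d20 h2] := cG _ e20.
exists (Num.min d1 d2); rewrite ?lt_min ?d10// => s; rewrite lt_min => /andP[/h1 H1 /h2 H2].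
by rewrite opprD addrACA; apply: le_lt_trans (cabsD _ _) _; order_lra.
Qed.

Lemma rcontZ c F t : rcont F t -> rcont (fun s => c * F s) t.
Proof.
move=> cF e e0; have c0 := cabs_ge0 c.
have [|d d0 h] := cF (e / (cabs c + 1)); first by apply: divr_gt0 => //; order_lra.
exists d => // s /h H; rewrite -mulrBr cabsM.
apply: (@le_lt_trans _ _ (cabs c * (e / (cabs c + 1)))).
  by apply: ler_wpM2l => //; exact: ltW.
by rewrite mulrA ltr_pdivrMr; order_nra.
Qed.

Lemma rcontN F t : rcont F t -> rcont (fun s => - F s) t.
Proof.
move=> cF; rewrite (_ : (fun _ => _) = fun s => -1 * F s); first exact: rcontZ.
by apply/funext => s; rewrite mulN1r.
Qed.

Lemma rcontB F G t : rcont F t -> rcont G t -> rcont (fun s => F s - G s) t.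
Proof. by move=> cF cG; apply: rcontD => //; exact: rcontN. Qed.

Lemma eq_cint a b F G : (forall t, a <= t <= b -> F t = G t) ->
  cint a b F = cint a b G.
Proof.
move=> FG; rewrite /cint; congr (_ +i* _)%C; apply: eq_Rintegral => t;
  by rewrite inE /= in_itv /= => /FG ->.
Qed.

Lemma cintD a b F G : rcont_on a b F -> rcont_on a b G ->
  cint a b (fun t => F t + G t) = cint a b F + cint a b G.
Proof.
move=> cF cG; rewrite /cint; simpc.
congr (_ +i* _)%C; rewrite -RintegralD//; try exact: rcont_integrable Re_lip _;
  try exact: rcont_integrable Im_lip _; apply: eq_Rintegral => t _.
- by case: (F t) (G t) => [? ?] [? ?].
- by case: (F t) (G t) => [? ?] [? ?].
Qed.

Lemma cintZ a b c F : rcont_on a b F ->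
  cint a b (fun t => c * F t) = c * cint a b F.
Proof.
move=> cF; have iR := rcont_integrable Re_lip cF; have iI := rcont_integrable Im_lip cF.
have iZ (f : R -> R) k : mu.-integrable `[a, b] (EFin \o f) ->
    mu.-integrable `[a, b] (EFin \o (fun t => k * f t)).
  move=> fi; rewrite (_ : _ \o _ = (fun t => k%:E * (EFin \o f) t)%E)//.
  exact: integrableZl.
case: c => u v; rewrite /cint; simpc.
congr (_ +i* _)%C; rewrite -!RintegralZl//.
  rewrite -RintegralB//; [|exact: iZ|exact: iZ].
  by apply: eq_Rintegral => t _; case: (F t).
rewrite -RintegralD//; [|exact: iZ|exact: iZ].
by apply: eq_Rintegral => t _; case: (F t).
Qed.

Lemma Rintegral_cst_itv a b (r : R) : a <= b ->
  \int[mu]_(t in `[a, b]) r = r * (b - a).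
Proof.
move=> ab; rewrite Rintegral_cst//; congr (_ * _).
have := lebesgue_measure_itv `[a, b]; rewrite /= lte_fin => ->.
case: ltP => //= ba; have -> : b = a by order_lra.
by rewrite subrr.
Qed.

Lemma cint_cst a b c : a <= b -> cint a b (fun=> c) = c * ((b - a)%:C)%C.
Proof.
by move=> ab; case: c => u v; rewrite /cint !Rintegral_cst_itv//=; simpc.
Qed.

Lemma Rintegral_itv_split a m b (f : R -> R) : a <= m <= b ->
  mu.-integrable `[a, b] (EFin \o f) ->
  \int[mu]_(t in `[a, b]) f t =
  \int[mu]_(t in `[a, m]) f t + \int[mu]_(t in `[m, b]) f t.
Proof.
move=> /andP[am mb] fi; rewrite -(@Rintegral_itv_obnd_cbnd _ m (BRight b)).
  by rewrite -(Rintegral_itvB (x := m) fi) ?bnd_simp// addrC subrK.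
apply: integrableS fi => //; apply: subset_itvr; by rewrite bnd_simp.
Qed.

Lemma cint_split a m b F : a <= m <= b -> rcont_on a b F ->
  cint a b F = cint a m F + cint m b F.
Proof.
move=> amb cF; rewrite /cint; simpc.
congr (_ +i* _)%C; apply: Rintegral_itv_split => //.
  exact: rcont_integrable Re_lip _.
exact: rcont_integrable Im_lip _.
Qed.

(** The real and imaginary parts are each bounded by the modulus, whence the factor 2. *)
Lemma cint_le_int a b F : rcont_on a b F ->
  cabs (cint a b F) <= 2 * \int[mu]_(t in `[a, b]) cabs (F t).
Proof.
move=> cF; have iR := rcont_integrable Re_lip cF; have iI := rcont_integrable Im_lip cF.
have iA := rcont_integrable cabs_lip cF.
apply: le_trans (cabs_le_ReIm _) _; rewrite mulr_natl mulr2n; apply: lerD.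
  apply: le_trans (le_normr_Rintegral _ iR) _ => //.
  by apply: le_Rintegral => //; [exact: integrable_norm iR|move=> t _; exact: cabs_Re].
apply: le_trans (le_normr_Rintegral _ iI) _ => //.
by apply: le_Rintegral => //; [exact: integrable_norm iI|move=> t _; exact: cabs_Im].
Qed.

Lemma cint_le a b F (M : R) : a <= b -> rcont_on a b F ->
  (forall t, a <= t <= b -> cabs (F t) <= M) ->
  cabs (cint a b F) <= 2 * M * (b - a).
Proof.
move=> ab cF FM; apply: le_trans (cint_le_int cF) _.
rewrite -mulrA ler_pM2l// -Rintegral_cst_itv//.
apply: le_Rintegral => //; first exact: rcont_integrable cabs_lip _.
  by apply: continuous_itv_integrable => t _; exact: cst_continuous.
Qed.

End LineIntegral.

(** * Bisection of a rectangle down to a point *)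

Section Bisection.
Context {R : realType}.
Variables (A B : R) (P : R -> R -> nat -> Prop).
Hypotheses (A0 : 0 <= A) (B0 : 0 <= B).
Notation hw C n := (C / 2 ^+ n).

Lemma dyadic_half (C : R) n : hw C n.+1 = hw C n / 2.
Proof. by rewrite exprSr invfM mulrA. Qed.

Lemma dyadic_small (C d : R) : 0 <= C -> 0 < d -> exists n, hw C n < d.
Proof.
move=> C0 d0; have := archi_boundP (divr_ge0 C0 (ltW d0)).
set n := Num.bound _ => h; exists n; rewrite ltr_pdivrMr ?exprn_gt0//.
rewrite mulrC -ltr_pdivrMr//; apply: lt_trans h _.
by rewrite -natrX ltr_nat ltn_expl.
Qed.

(** Each step keeps the left or the right half of the current interval, so left ends increase and
    right ends decrease; the supremum of the left ends lies in every interval. *)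
Lemma nested_point (u : nat -> R) (C : R) : 0 <= C ->
  (forall n, u n.+1 = u n \/ u n.+1 = u n + hw C n.+1) ->
  exists x, forall n, u n <= x <= u n + hw C n.
Proof.
move=> C0 hu.
have hC n : 0 <= hw C n by rewrite divr_ge0// exprn_ge0.
have step n : u n <= u n.+1 /\ u n.+1 + hw C n.+1 <= u n + hw C n.
  by have := hC n; have := hu n; rewrite dyadic_half; move=> [->|->]; order_lra.
have um n k : u n <= u (n + k)%N.
  elim: k => [|k IH]; first by rewrite addn0.
  by rewrite addnS; apply: le_trans IH _; case: (step (n + k)%N).
have vm n k : u (n + k)%N + hw C (n + k) <= u n + hw C n.
  elim: k => [|k IH]; first by rewrite addn0.
  by rewrite addnS; apply: le_trans _ IH; case: (step (n + k)%N).
have ub n k : u k <= u n + hw C n.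
  apply: le_trans (um k n) _; rewrite addnC; apply: le_trans _ (vm n k).
  by rewrite lerDl.
have hs : has_sup (range u).
  split; first by exists (u 0%N); exists 0%N.
  by exists (u 0%N + hw C 0) => _ [k _ <-].
exists (sup (range u)) => n; apply/andP; split.
  by apply: ub_le_sup; [case: hs|exists n].
by apply: ge_sup; [case: hs|move=> _ [k _ <-]].
Qed.

(* If [P] failed on the initial rectangle, it would fail on a nested sequence of quarters. *)
Lemma bisection :
  (forall x y n, P x y n.+1 -> P (x + hw A n.+1) y n.+1 ->
     P x (y + hw B n.+1) n.+1 -> P (x + hw A n.+1) (y + hw B n.+1) n.+1 -> P x y n) ->
  (forall x0 y0, exists2 d, 0 < d & forall x y n,
     x <= x0 <= x + hw A n -> y <= y0 <= y + hw B n -> hw (A + B) n < d -> P x y n) ->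
  forall x y, P x y 0.
Proof.
move=> quarter loc x y; apply: contrapT => nP.
(* Failure is only transmitted conditionally, from the current box to one of its quarters. This
   makes the step total in the corner [p], so that [cid] can iterate it. *)
have step (n : nat) (p : R * R) : exists q : R * R,
    (q.1 = p.1 \/ q.1 = p.1 + hw A n.+1) /\ (q.2 = p.2 \/ q.2 = p.2 + hw B n.+1) /\
    (~ P p.1 p.2 n -> ~ P q.1 q.2 n.+1).
  apply: contrapT => h; have {}h q : (q.1 = p.1 \/ q.1 = p.1 + hw A n.+1) ->
    (q.2 = p.2 \/ q.2 = p.2 + hw B n.+1) -> ~ P p.1 p.2 n /\ P q.1 q.2 n.+1.
    move=> h1 h2; split; apply: contrapT => h3; apply: h; exists q; split=> //; split=> //.
  have [np _] := h p (or_introl erefl) (or_introl erefl); apply: np.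
  apply: quarter.
  - by case: (h p); [left|left|].
  - by case: (h (p.1 + hw A n.+1, p.2)); [right|left|].
  - by case: (h (p.1, p.2 + hw B n.+1)); [left|right|].
  - by case: (h (p.1 + hw A n.+1, p.2 + hw B n.+1)); [right|right|].
pose nxt n p := projT1 (cid (step n p)).
pose s := fix s n := if n is m.+1 then nxt m (s m) else (x, y).
have sS n : s n.+1 = nxt n (s n) by [].
have sP n : ~ P (s n).1 (s n).2 n.
  elim: n => [//|n IH]; rewrite sS /nxt; case: cid => q /= [_ [_]]; exact.
have [x0 hx] : exists x0, forall n, (s n).1 <= x0 <= (s n).1 + hw A n.
  by apply: nested_point => // n; rewrite sS /nxt; case: cid => q /= [].
have [y0 hy] : exists y0, forall n, (s n).2 <= y0 <= (s n).2 + hw B n.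
  by apply: nested_point => // n; rewrite sS /nxt; case: cid => q /= [_ []].
have [d d0 hd] := loc x0 y0; have [n hn] := dyadic_small (addr_ge0 A0 B0) d0.
exact: (sP n (hd _ _ _ (hx n) (hy n) hn)).
Qed.

End Bisection.

(** * Cauchy theory on rectangles *)

Section Rectangle.
Context {R : realType}.
Implicit Types (f g : R[i] -> R[i]) (a b c d m : R) (z w l : R[i]).

(* The contour integral of f over the positively oriented boundary of [a,b] x [c,d]. *)
Definition rint f a b c d : R[i] :=
  cint a b (fun x => f (x +i* c)%C - f (x +i* d)%C) +
  'i%C * cint c d (fun y => f (b +i* y)%C - f (a +i* y)%C).

Definition inrect a b c d z := a <= complex.Re z <= b /\ c <= complex.Im z <= d.

Definition onrect a b c d z :=
  (a <= complex.Re z <= b /\ (complex.Im z = c \/ complex.Im z = d)) \/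
  (c <= complex.Im z <= d /\ (complex.Re z = a \/ complex.Re z = b)).

Definition bcont f a b c d := forall z, onrect a b c d z -> ccont f z.

Lemma onrect_inrect a b c d z : a <= b -> c <= d ->
  onrect a b c d z -> inrect a b c d z.
Proof. by move=> ab cd; rewrite /inrect; case=> -[h [->|->]]; rewrite h ?lexx ?ab ?cd. Qed.

Lemma cabs_hline (s t c : R) : cabs ((s +i* c)%C - (t +i* c)%C) = `|s - t|.
Proof. by rewrite /cabs /= subrr expr0n addr0 sqrtr_sqr. Qed.

Lemma cabs_vline (s t c : R) : cabs ((c +i* s)%C - (c +i* t)%C) = `|s - t|.
Proof. by rewrite /cabs /= subrr expr0n add0r sqrtr_sqr. Qed.

Section Sides.
Variables (f : R[i] -> R[i]) (a b c d : R).
Hypothesis cf : bcont f a b c d.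

Lemma rcont_bottom : rcont_on a b (fun x => f (x +i* c)%C).
Proof.
apply: rcont_comp (fun s t => cabs_hline s t c) _ => t tab.
by apply: cf; left; split=> //; left.
Qed.

Lemma rcont_top : rcont_on a b (fun x => f (x +i* d)%C).
Proof.
apply: rcont_comp (fun s t => cabs_hline s t d) _ => t tab.
by apply: cf; left; split=> //; right.
Qed.

Lemma rcont_left : rcont_on c d (fun y => f (a +i* y)%C).
Proof.
apply: rcont_comp (fun s t => cabs_vline s t a) _ => t tab.
by apply: cf; right; split=> //; left.
Qed.

Lemma rcont_right : rcont_on c d (fun y => f (b +i* y)%C).
Proof.
apply: rcont_comp (fun s t => cabs_vline s t b) _ => t tab.
by apply: cf; right; split=> //; right.
Qed.

Lemma rcont_bt : rcont_on a b (fun x => f (x +i* c)%C - f (x +i* d)%C).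
Proof. by move=> t h; apply: rcontB; [exact: rcont_bottom|exact: rcont_top]. Qed.

Lemma rcont_rl : rcont_on c d (fun y => f (b +i* y)%C - f (a +i* y)%C).
Proof. by move=> t h; apply: rcontB; [exact: rcont_right|exact: rcont_left]. Qed.

End Sides.

Lemma bcontD f g a b c d : bcont f a b c d -> bcont g a b c d ->
  bcont (fun z => f z + g z) a b c d.
Proof. by move=> cf cg z h; apply: ccontD; [exact: cf|exact: cg]. Qed.

Lemma bcontZ k f a b c d : bcont f a b c d -> bcont (fun z => k * f z) a b c d.
Proof. by move=> cf z h; apply: ccontM; [exact: ccont_cst|exact: cf]. Qed.

Lemma rintD f g a b c d : bcont f a b c d -> bcont g a b c d ->
  rint (fun z => f z + g z) a b c d = rint f a b c d + rint g a b c d.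
Proof.
move=> cf cg; rewrite /rint addrACA -mulrDr.
rewrite -cintD; [|exact: rcont_bt|exact: rcont_bt].
rewrite -cintD; [|exact: rcont_rl|exact: rcont_rl].
by congr (_ + 'i%C * _); apply: eq_cint => t _; ring.
Qed.

Lemma rintZ k f a b c d : bcont f a b c d ->
  rint (fun z => k * f z) a b c d = k * rint f a b c d.
Proof.
move=> cf; rewrite /rint mulrDr mulrCA.
rewrite -(@cintZ _ a b k); last exact: rcont_bt.
rewrite -(@cintZ _ c d k); last exact: rcont_rl.
by congr (_ + 'i%C * _); apply: eq_cint => t _; ring.
Qed.

Lemma rintB f g a b c d : bcont f a b c d -> bcont g a b c d ->
  rint (fun z => f z - g z) a b c d = rint f a b c d - rint g a b c d.
Proof.
move=> cf cg; rewrite (_ : (fun _ => _) = fun z => f z + -1 * g z); last first.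
  by apply/funext => s; rewrite mulN1r.
by rewrite rintD ?rintZ ?mulN1r//; exact: bcontZ.
Qed.

Lemma eq_rint f g a b c d : a <= b -> c <= d ->
  (forall z, onrect a b c d z -> f z = g z) -> rint f a b c d = rint g a b c d.
Proof.
move=> ab cd fg; rewrite /rint; congr (_ + 'i%C * _); apply: eq_cint => t h.
  by rewrite !fg//; left; split=> //; [right|left].
by rewrite !fg//; right; split=> //; [left|right].
Qed.

Lemma rint_id a b c d : a <= b -> c <= d -> rint id a b c d = 0.
Proof.
move=> ab cd; rewrite /rint.
rewrite (_ : (fun x : R => _) = fun=> (0 +i* (c - d))%C); last first.
  by apply/funext => x; apply/eqP; rewrite eq_complex /= subrr !eqxx.
rewrite (_ : (fun y : R => id (b +i* y)%C - _) = fun=> ((b - a)%:C)%C); last first.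
  by apply/funext => x; apply/eqP; rewrite eq_complex /= subrr !eqxx.
rewrite !cint_cst//; simpc; congr (_ +i* _)%C; ring.
Qed.

Lemma cabs_i : cabs ('i%C : R[i]) = 1.
Proof. by rewrite cabs_imag normr1. Qed.

(** Opposite sides enter as a difference, so constants cancel and the oscillation of [f] on the
    boundary replaces its size. This lets [rint_local] ignore the constant term of a linear
    approximation. *)
Lemma rint_le_osc f a b c d (M : R) : a <= b -> c <= d -> bcont f a b c d ->
  (forall z w, onrect a b c d z -> onrect a b c d w -> cabs (f z - f w) <= M) ->
  cabs (rint f a b c d) <= 2 * M * ((b - a) + (d - c)).
Proof.
move=> ab cd cf fM; rewrite mulrDr; apply: le_trans (cabsD _ _) _.
rewrite cabsM cabs_i mul1r; apply: lerD; apply: cint_le => //.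
- exact: rcont_bt.
- by move=> t h; apply: fM; left; split=> //; [left|right].
- exact: rcont_rl.
- by move=> t h; apply: fM; right; split=> //; [right|left].
Qed.

Lemma rint_le f a b c d (M : R) : a <= b -> c <= d -> bcont f a b c d ->
  (forall z, onrect a b c d z -> cabs (f z) <= M) ->
  cabs (rint f a b c d) <= 4 * M * ((b - a) + (d - c)).
Proof.
move=> ab cd cf fM; rewrite (_ : 4 * M = 2 * (M + M)); last by ring.
apply: rint_le_osc => // z w hz hw.
by apply: le_trans (cabsB _ _) _; apply: lerD; exact: fM.
Qed.

Definition rect_cont f a b c d := forall z, inrect a b c d z -> ccont f z.

Lemma rect_bcont f a b c d : a <= b -> c <= d -> rect_cont f a b c d -> bcont f a b c d.
Proof. by move=> ab cd cf z /(onrect_inrect ab cd)/cf. Qed.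

Lemma rect_contS f a b c d a' b' c' d' : rect_cont f a b c d ->
  a <= a' -> b' <= b -> c <= c' -> d' <= d -> rect_cont f a' b' c' d'.
Proof.
move=> cf h1 h2 h3 h4 z [/andP[? ?] /andP[? ?]].
by apply: cf; split; apply/andP; split; order_lra.
Qed.

Lemma rint_splitv f a m b c d : a <= m <= b -> c <= d -> rect_cont f a b c d ->
  rint f a b c d = rint f a m c d + rint f m b c d.
Proof.
move=> /andP[am mb] cd cf.
have cL : bcont f a m c d by apply: rect_bcont => //; apply: (rect_contS cf); order_lra.
have cR : bcont f m b c d by apply: rect_bcont => //; apply: (rect_contS cf); order_lra.
have ab : a <= b by order_lra.
rewrite /rint (@cint_split _ a m b) ?am ?mb//; last first.
  by apply: rcont_bt; exact: rect_bcont.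
rewrite addrACA -mulrDr -cintD; [|exact: rcont_rl|exact: rcont_rl].
by congr (_ + 'i%C * _); apply: eq_cint => t _; ring.
Qed.

Lemma rint_splith f a b c m d : a <= b -> c <= m <= d -> rect_cont f a b c d ->
  rint f a b c d = rint f a b c m + rint f a b m d.
Proof.
move=> ab /andP[cm md] cf.
have cL : bcont f a b c m by apply: rect_bcont => //; apply: (rect_contS cf); order_lra.
have cR : bcont f a b m d by apply: rect_bcont => //; apply: (rect_contS cf); order_lra.
have cd : c <= d by order_lra.
rewrite /rint (@cint_split _ c m d) ?cm ?md//; last first.
  by apply: rcont_rl; exact: rect_bcont.
rewrite addrACA -mulrDr -cintD; [|exact: rcont_bt|exact: rcont_bt].
by congr (_ + 'i%C * _); apply: eq_cint => t _; ring.
Qed.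

Lemma rint_quarter f x y (u v : R) : 0 <= u -> 0 <= v ->
  rect_cont f x (x + (u + u)) y (y + (v + v)) ->
  cabs (rint f x (x + (u + u)) y (y + (v + v))) <=
  (cabs (rint f x (x + u) y (y + v)) + cabs (rint f x (x + u) (y + v) (y + (v + v)))) +
  (cabs (rint f (x + u) (x + (u + u)) y (y + v)) +
   cabs (rint f (x + u) (x + (u + u)) (y + v) (y + (v + v)))).
Proof.
move=> u0 v0 cf.
rewrite (@rint_splitv f x (x + u)); [|order_lra|order_lra|by []].
rewrite (@rint_splith f x _ y (y + v)); [|order_lra|order_lra|by apply: (rect_contS cf); order_lra].
rewrite (@rint_splith f (x + u) _ y (y + v)); [|order_lra|order_lra|by apply: (rect_contS cf); order_lra].
apply: le_trans (cabsD _ _) _; apply: lerD; exact: cabsD.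
Qed.

Lemma inrect_dist a b c d z w : inrect a b c d z -> inrect a b c d w ->
  cabs (z - w) <= (b - a) + (d - c).
Proof.
case: z w => [x y] [u v] [/= /andP[? ?] /andP[? ?]] [/= /andP[? ?] /andP[? ?]].
apply: le_trans (cabs_le_ReIm _) _ => /=.
by apply: lerD; rewrite ler_norml; apply/andP; split; order_lra.
Qed.

(** Subtracting [l * w], whose contour integral vanishes, leaves a function whose oscillation near
    [z] is a small multiple of the size of the rectangle. The length of the contour supplies the
    second factor, and the square is the rate at which the bounds on four quarters add up to the
    bound on the whole. *)
Lemma rint_local f z l (e : R) : is_cderiv f z l -> 0 < e ->
  exists2 r, 0 < r & forall a b c d, a <= b -> c <= d -> inrect a b c d z ->
    bcont f a b c d -> (b - a) + (d - c) < r ->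
    cabs (rint f a b c d) <= e * ((b - a) + (d - c)) ^+ 2.
Proof.
move=> df e0; have e40 : 0 < e / 4 by order_lra.
have [r r0 hr] := df _ e40; exists r => // a b c d ab cd zr cf sr.
set s := _ + _ in sr *.
pose g w := f w - l * w.
have lin : bcont (fun w => l * w) a b c d by apply: bcontZ => w _; exact: ccont_id.
have -> : rint f a b c d = rint g a b c d.
  rewrite /g rintB// rintZ ?rint_id ?mulr0 ?subr0//.
  by move=> w _; exact: ccont_id.
have gz w : onrect a b c d w -> cabs (g w - g z) <= e / 4 * s.
  move=> /(onrect_inrect ab cd) hw; have wz := inrect_dist hw zr.
  have [->|wz0] := eqVneq w z.
    by rewrite subrr cabs0 mulr_ge0//; [order_lra|rewrite /s; order_lra].
  have wz1 : 0 < cabs (w - z) by rewrite cabs_gt0 subr_eq0.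
  have -> : g w - g z = ((f w - f z) / (w - z) - l) * (w - z).
    rewrite mulrBl divfK ?subr_eq0// /g; ring.
  rewrite cabsM; apply: ler_pM; rewrite ?cabs_ge0//.
  by apply/ltW/hr; rewrite wz1/=; apply: le_lt_trans wz _.
have -> : e * s ^+ 2 = 2 * (e / 4 * s + e / 4 * s) * s by field.
apply: rint_le_osc => //.
  rewrite /g (_ : (fun _ => _) = fun w => f w + -1 * (l * w)).
    by apply: bcontD => //; exact: bcontZ.
  by apply/funext => w; rewrite mulN1r.
move=> w1 w2 /gz h1 /gz h2; rewrite -(subrKA (g z)).
by apply: le_trans (cabsD _ _) _; rewrite (cabsBC (g z)); exact: lerD.
Qed.

Lemma goursat f a b c d : a <= b -> c <= d ->
  (forall z, inrect a b c d z -> exists l, is_cderiv f z l) ->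
  rint f a b c d = 0.
Proof.
move=> ab cd df.
have cf : rect_cont f a b c d by move=> z /df[l]; exact: is_cderiv_cont.
pose A := b - a; pose B := d - c.
have A0 : 0 <= A by rewrite subr_ge0.
have B0 : 0 <= B by rewrite subr_ge0.
have [//|nz] := eqVneq (rint f a b c d) 0; move: nz; rewrite -cabs_gt0 => nz.
(* Chosen so that [e * (A + B) ^+ 2] is strictly below the modulus of the integral: the bound on the
   whole rectangle is then absurd. The [+ 1] covers a degenerate rectangle. *)
pose e := cabs (rint f a b c d) / (2 * ((A + B) ^+ 2 + 1)).
have AB0 : 0 <= (A + B) ^+ 2 by rewrite sqr_ge0.
have e0 : 0 < e by apply: divr_gt0 => //; order_lra.
pose hw (C : R) n := C / 2 ^+ n.
(* Containment is part of the property because [bisection] ranges over all boxes of the plane; those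
   that stick out satisfy it vacuously. *)
pose P x y n := a <= x -> x + hw A n <= b -> c <= y -> y + hw B n <= d ->
  cabs (rint f x (x + hw A n) y (y + hw B n)) <= e * (hw A n + hw B n) ^+ 2.
have hA n : 0 <= hw A n by rewrite divr_ge0// exprn_ge0.
have hB n : 0 <= hw B n by rewrite divr_ge0// exprn_ge0.
have /(_ a c) : forall x y, P x y 0.
  apply: (bisection A0 B0).
  - move=> x y n P1 P2 P3 P4 h1 h2 h3 h4.
    rewrite -/(hw A n.+1) -/(hw B n.+1) in P1 P2 P3 P4.
    have EA : hw A n = hw A n.+1 + hw A n.+1.
      by rewrite /hw dyadic_half; field; rewrite expf_neq0.
    have EB : hw B n = hw B n.+1 + hw B n.+1.
      by rewrite /hw dyadic_half; field; rewrite expf_neq0.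
    have a1 := hA n.+1; have b1 := hB n.+1.
    rewrite /P -!addrA in P1 P2 P3 P4; rewrite EA EB in h2 h4 *.
    set u := hw A n.+1 in a1 h2 P1 P2 P3 P4 *; set v := hw B n.+1 in b1 h4 P1 P2 P3 P4 *.
    clearbody u v.
    have -> : e * (u + u + (v + v)) ^+ 2 = (e * (u + v) ^+ 2 + e * (u + v) ^+ 2)
       + (e * (u + v) ^+ 2 + e * (u + v) ^+ 2) by ring.
    apply: le_trans (rint_quarter a1 b1 _) _.
      by clear -cf h1 h2 h3 h4; apply: (rect_contS cf); order_lra.
    clear -P1 P2 P3 P4 h1 h2 h3 h4 a1 b1.
    apply: lerD; apply: lerD.
    + by apply: P1; clear -h1 h2 h3 h4 a1 b1; order_lra.
    + by apply: P3; clear -h1 h2 h3 h4 a1 b1; order_lra.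
    + by apply: P2; clear -h1 h2 h3 h4 a1 b1; order_lra.
    + by apply: P4; clear -h1 h2 h3 h4 a1 b1; order_lra.
  - move=> x0 y0.
    (* A box inside the rectangle cannot contain a point outside it, so any threshold serves at such
       a point. *)
    have [[hx hy]|out] := pselect (inrect a b c d (x0 +i* y0)%C); last first.
      exists 1 => // x y n /andP[hx1 hx2] /andP[hy1 hy2] _ h1 h2 h3 h4.
      rewrite -/(hw A n) in hx2; rewrite -/(hw B n) in hy2.
      by exfalso; apply: out; split; apply/andP; split=> /=; order_lra.
    have [l dl] := df (x0 +i* y0)%C (conj hx hy).
    have [r r0 hr] := rint_local dl e0; exists r => // x y n x0n y0n sn h1 h2 h3 h4.
    have a1 := hA n; have b1 := hB n.
    have := hr x (x + hw A n) y (y + hw B n).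
    rewrite [x + _ - x]addrAC subrr add0r [y + _ - y]addrAC subrr add0r; apply.
    + by rewrite lerDl.
    + by rewrite lerDl.
    + by split.
    + apply: rect_bcont; [by rewrite lerDl|by rewrite lerDl|].
      by apply: (rect_contS cf).
    + by rewrite /hw -mulrDl.
rewrite /P /hw expr0 !divr1 /A /B !subrKC => /(_ (lexx _) (lexx _) (lexx _) (lexx _)).
move=> H; exfalso; move: H; rewrite leNgt => /negP; apply; rewrite -/A -/B /e.
rewrite mulrAC ltr_pdivrMr; last by order_lra.
rewrite ltr_pM2l//; order_lra.
Qed.

Lemma subrect_inrect a b c d a' b' c' d' z : inrect a' b' c' d' z ->
  a <= a' -> b' <= b -> c <= c' -> d' <= d -> inrect a b c d z.
Proof.
by move=> [/andP[? ?] /andP[? ?]] *; split; apply/andP; split; order_lra.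
Qed.

(** Cutting off four pieces on which [goursat] applies leaves a square of half side e around the
    exceptional point. Continuity bounds f there by a fixed M, its contour integral is at most
    [16 * M * e], and e is arbitrarily small. *)
Lemma goursat_removable f a b c d x0 y0 : a < x0 < b -> c < y0 < d ->
  rect_cont f a b c d ->
  (forall z, inrect a b c d z -> z <> (x0 +i* y0)%C -> exists l, is_cderiv f z l) ->
  rint f a b c d = 0.
Proof.
move=> /andP[ax xb] /andP[cy yd] cf df.
set z0 := (x0 +i* y0)%C in df.
have z0in : inrect a b c d z0 by split; apply/andP; split=> /=; order_lra.
have [r1 r10 hr1] := cf _ z0in _ ltr01.
pose M := cabs (f z0) + 1.
pose r2 := Num.min (Num.min (x0 - a) (b - x0)) (Num.min (y0 - c) (d - y0)).
have M0 : 0 < M by rewrite /M; have := cabs_ge0 (f z0); order_lra.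
have r20 : 0 < r2 by rewrite !lt_min !subr_gt0 ax xb cy yd.
have small e : 0 < e -> e < r2 -> 2 * e < r1 -> cabs (rint f a b c d) <= 16 * M * e.
  move=> e0; rewrite !lt_min => /andP[/andP[e1 e2] /andP[e3 e4]] er1.
  have out a' b' c' d' : a' <= b' -> c' <= d' -> a <= a' -> b' <= b -> c <= c' -> d' <= d ->
      (b' < x0) || (x0 < a') || (d' < y0) || (y0 < c') -> rint f a' b' c' d' = 0.
    move=> h1 h2 h3 h4 h5 h6 h7; apply: goursat => // z hz; apply: df.
      exact: subrect_inrect hz _ _ _ _.
    move=> zE; move: hz; rewrite zE => -[/= /andP[? ?] /andP[? ?]].
    by case/orP: h7 => [/orP[/orP[]|]|]; order_lra.
  rewrite (@rint_splitv f a (x0 - e)); [|order_lra|order_lra|by []].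
  rewrite (out a); [|order_lra..|by apply/orP; left; apply/orP; left; apply/orP; left; order_lra].
  rewrite (@rint_splitv f (x0 - e) (x0 + e)); [|order_lra|order_lra|by apply: (rect_contS cf); order_lra].
  rewrite (out (x0 + e)); [|order_lra..|by apply/orP; left; apply/orP; left; apply/orP; right; order_lra].
  rewrite (@rint_splith f _ _ c (y0 - e)); [|order_lra|order_lra|by apply: (rect_contS cf); order_lra].
  rewrite (out _ _ c); [|order_lra..|by apply/orP; left; apply/orP; right; order_lra].
  rewrite (@rint_splith f _ _ _ (y0 + e)); [|order_lra|order_lra|by apply: (rect_contS cf); order_lra].
  rewrite (out _ _ (y0 + e)); [|order_lra..|by apply/orP; right; order_lra].
  rewrite !add0r !addr0.
  have -> : 16 * M * e = 4 * M * ((x0 + e - (x0 - e)) + (y0 + e - (y0 - e))) by ring.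
  apply: rint_le; [order_lra|order_lra|by apply: rect_bcont; [order_lra|order_lra|apply: (rect_contS cf); order_lra]|].
  move=> z hz; have {}hz : inrect (x0 - e) (x0 + e) (y0 - e) (y0 + e) z.
    by apply: onrect_inrect hz; order_lra.
  have : cabs (z - z0) < r1.
    apply: le_lt_trans er1; case: z hz => u v [/= /andP[? ?] /andP[? ?]].
    apply: le_trans (cabs_le_ReIm _) _ => /=; rewrite mulr_natl mulr2n.
    by apply: lerD; rewrite ler_norml; apply/andP; split; order_lra.
  by move/hr1; have := cabs_lerB (f z) (f z0); rewrite /M; order_lra.
apply/eqP; rewrite -cabs_eq0 eq_le cabs_ge0 andbT; apply/ler_addgt0Pr => e e0.
pose t := Num.min (e / (16 * M)) (Num.min r2 (r1 / 2) / 2).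
have t1 : t <= e / (16 * M) by rewrite ge_min lexx.
have m0 : 0 < Num.min r2 (r1 / 2) by rewrite lt_min r20; order_lra.
have m1 : Num.min r2 (r1 / 2) <= r2 by rewrite ge_min lexx.
have m2 : Num.min r2 (r1 / 2) <= r1 / 2 by rewrite ge_min lexx orbT.
have t2 : t <= Num.min r2 (r1 / 2) / 2 by rewrite ge_min lexx orbT.
have t0 : 0 < t by rewrite lt_min !divr_gt0//; order_lra.
clearbody t; rewrite add0r; apply: le_trans (small t _ _ _) _; [by []|order_lra|order_lra|].
by move: t1; rewrite ler_pdivlMr ?mulr_gt0// mulrC.
Qed.

Lemma onrect_neq a b c d x0 y0 z : a < x0 < b -> c < y0 < d ->
  onrect a b c d z -> z - (x0 +i* y0)%C != 0.
Proof.
move=> /andP[? ?] /andP[? ?] h; rewrite subr_eq0; apply/eqP => zE; move: h; rewrite zE.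
by case=> /= -[_ [|]]; order_lra.
Qed.

Lemma bcont_cauchy f a b c d x0 y0 n : a < x0 < b -> c < y0 < d ->
  bcont f a b c d -> bcont (fun z => f z * (z - (x0 +i* y0)%C)^-1 ^+ n) a b c d.
Proof.
move=> hx hy cf z hz; apply: ccontM; first exact: cf.
apply: ccontX; apply: ccontV.
  by apply: ccontD; [exact: ccont_id|exact: ccont_cst].
exact: onrect_neq hz.
Qed.

(** The slope function of [f] at the pole is continuous there and differentiable elsewhere, so its
    contour integral vanishes by [goursat_removable]; on the boundary it is (f z - f z0)/(z - z0).
    The exponent [1] keeps the integrand in the shape of [bcont_cauchy] and of the transforms
    differentiated later. *)
Lemma cauchy_formula f a b c d x0 y0 : a < x0 < b -> c < y0 < d ->
  (forall z, inrect a b c d z -> exists l, is_cderiv f z l) ->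
  rint (fun z => f z * (z - (x0 +i* y0)%C)^-1 ^+ 1) a b c d =
  f (x0 +i* y0)%C * rint (fun z => 1 * (z - (x0 +i* y0)%C)^-1 ^+ 1) a b c d.
Proof.
move=> hx hy df; set z0 := (x0 +i* y0)%C.
have [[ax xb] [cy yd]] := (andP hx, andP hy).
have ab : a <= b by order_lra.
have cd : c <= d by order_lra.
have z0in : inrect a b c d z0 by split; apply/andP; split=> /=; order_lra.
have [l dl] := df _ z0in; have /is_cderivP[F [cF _ fF]] := dl.
have Fout z : z != z0 -> F z = (f z - f z0) * (z - z0)^-1.
  by move=> zz0; rewrite fF mulfK// subr_eq0.
have cf : bcont f a b c d.
  by move=> z /(onrect_inrect ab cd)/df[k]; exact: is_cderiv_cont.
have dF z : inrect a b c d z -> z <> z0 -> exists k, is_cderiv F z k.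
  move=> /df[k dk] /eqP zz0.
  have d1 := is_cderivB dk (is_cderiv_cst (f z0) z).
  have d2 := is_cderivB (is_cderiv_id z) (is_cderiv_cst z0 z).
  have zz1 : z - z0 != 0 by rewrite subr_eq0.
  have := is_cderivM d1 (is_cderivV d2 zz1).
  set k' := (X in is_cderiv _ _ X) => dd; exists k'.
  apply: (is_cderiv_ext (r := cabs (z - z0))) dd; first by rewrite cabs_gt0.
  move=> w hw; rewrite Fout//; apply: contraTneq hw => ->.
  by rewrite cabsBC ltxx.
have : rint F a b c d = 0.
  apply: (@goursat_removable F a b c d x0 y0) => // z hz.
  have [->//|/eqP zz0] := eqVneq z z0.
  by have [k] := dF _ hz zz0; exact: is_cderiv_cont.
have -> : rint F a b c d = rint (fun z => f z * (z - z0)^-1 ^+ 1 -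
    f z0 * (1 * (z - z0)^-1 ^+ 1)) a b c d.
  apply: eq_rint => // z hz; rewrite Fout ?expr1 ?mul1r ?mulrBl//.
  by have := onrect_neq hx hy hz; rewrite subr_eq0.
rewrite rintB.
- rewrite rintZ; first by move/eqP; rewrite subr_eq0 => /eqP.
  by apply: bcont_cauchy => // z _; exact: ccont_cst.
- exact: bcont_cauchy.
- by apply: bcontZ; apply: bcont_cauchy => // z _; exact: ccont_cst.
Qed.

End Rectangle.

(** * Cauchy transforms, the winding factor, and analyticity of the derivative *)

Section CauchyTransform.
Context {R : realType}.
Notation mu := (@lebesgue_measure R).
Implicit Types (f g : R[i] -> R[i]) (a b c d m : R) (z w l : R[i]).

(** Differentiation under the integral sign: a quadratic remainder, uniform over the boundary, still
    leaves an error linear in |w - z| after division by w - z. *)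
Lemma is_cderiv_rint (k : R[i] -> R[i] -> R[i]) (k' : R[i] -> R[i]) a b c d z (C r : R) :
  a <= b -> c <= d -> 0 < r -> 0 <= C ->
  (forall w, cabs (w - z) < r -> bcont (k w) a b c d) -> bcont k' a b c d ->
  (forall w s, cabs (w - z) < r -> onrect a b c d s ->
     cabs (k w s - k z s - k' s * (w - z)) <= C * cabs (w - z) ^+ 2) ->
  is_cderiv (fun w => rint (k w) a b c d) z (rint k' a b c d).
Proof.
move=> ab cd r0 C0 ck ck' hk e e0; set S := (b - a) + (d - c).
have S0 : 0 <= S by rewrite /S; order_lra.
have D0 : 0 < 4 * C * S + 1 by have := mulr_ge0 C0 S0; order_lra.
exists (Num.min r (e / (4 * C * S + 1))); first by rewrite lt_min r0 divr_gt0.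
move=> w; rewrite lt_min => /and3P[wz0 wr we].
have wz : w - z != 0 by rewrite -cabs_gt0.
have cw := ck _ wr.
have cz : bcont (k z) a b c d by apply: ck; rewrite subrr cabs0.
have cB : bcont (fun s => k w s - k z s) a b c d.
  by move=> s hs; apply: ccontD; [exact: cw|apply: ccontN; exact: cz].
rewrite -rintB// mulrC -rintZ// -rintB//; last exact: bcontZ.
apply: (@le_lt_trans _ _ (4 * (C * cabs (w - z)) * S)).
  apply: rint_le => //.
    move=> s hs; apply: ccontD; last by apply: ccontN; exact: ck'.
    by apply: ccontM; [exact: ccont_cst|exact: cB].
  move=> s hs.
  have -> : (w - z)^-1 * (k w s - k z s) - k' s =
     (k w s - k z s - k' s * (w - z)) / (w - z) by field.
  rewrite cabsM cabsV ler_pdivrMr//.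
  by apply: le_trans (hk _ _ wr hs) _; rewrite expr2 mulrA.
move: we; rewrite ltr_pdivlMr//; order_nra.
Qed.

Lemma rcont_bounded a b (F : R -> R[i]) : a <= b -> rcont_on a b F ->
  exists2 M, 0 <= M & forall t, a <= t <= b -> cabs (F t) <= M.
Proof.
move=> ab cF.
have [|t _ ht] := @EVT_max R (fun t => cabs (F t)) a b ab.
  apply: continuous_in_subspaceT => t; rewrite inE /= in_itv /= => /cF.
  exact: rcont_real cabs_lip.
exists (cabs (F t)); first exact: cabs_ge0.
by move=> s hs; apply: ht; rewrite in_itv.
Qed.

Lemma bcont_bounded g a b c d : a <= b -> c <= d -> bcont g a b c d ->
  exists2 M, 0 <= M & forall s, onrect a b c d s -> cabs (g s) <= M.
Proof.
move=> ab cd cg.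
have [M1 p1 h1] := rcont_bounded ab (rcont_bottom cg).
have [M2 p2 h2] := rcont_bounded ab (rcont_top cg).
have [M3 p3 h3] := rcont_bounded cd (rcont_left cg).
have [M4 p4 h4] := rcont_bounded cd (rcont_right cg).
exists (M1 + M2 + M3 + M4); first order_lra.
by move=> [x y] [] /= [hs [E|E]]; move: hs; rewrite E;
  [move/h1|move/h2|move/h3|move/h4]; order_lra.
Qed.

Lemma onrect_dist a b c d x0 y0 (p : R) s : a + p <= x0 <= b - p ->
  c + p <= y0 <= d - p -> onrect a b c d s -> p <= cabs (s - (x0 +i* y0)%C).
Proof.
move=> /andP[h1 h2] /andP[h3 h4].
case: s => x y [] /= [_ [->|->]].
- by apply: le_trans (cabs_Im _) => /=; rewrite ler_normr; apply/orP; right; order_lra.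
- by apply: le_trans (cabs_Im _) => /=; rewrite ler_normr; apply/orP; left; order_lra.
- by apply: le_trans (cabs_Re _) => /=; rewrite ler_normr; apply/orP; right; order_lra.
- by apply: le_trans (cabs_Re _) => /=; rewrite ler_normr; apply/orP; left; order_lra.
Qed.

Lemma rect_margin a b c d x0 y0 : a < x0 < b -> c < y0 < d ->
  exists2 p, 0 < p & a + p <= x0 <= b - p /\ c + p <= y0 <= d - p.
Proof.
move=> /andP[ax xb] /andP[cy yd].
exists (Num.min (Num.min (x0 - a) (b - x0)) (Num.min (y0 - c) (d - y0))).
  by rewrite !lt_min !subr_gt0 ax xb cy yd.
set p := Num.min _ _.
have /andP[/andP[p1 p2] /andP[p3 p4]] : ((p <= x0 - a) && (p <= b - x0)) &&
  ((p <= y0 - c) && (p <= d - y0)) by rewrite -!le_min.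
by clearbody p; split; apply/andP; split; order_lra.
Qed.

Lemma inv_sub_remainder1 (s z w : R[i]) : s - z != 0 -> s - w != 0 ->
  (s - w)^-1 - (s - z)^-1 - (s - z)^-1 ^+ 2 * (w - z) =
  (w - z) ^+ 2 * ((s - w)^-1 * (s - z)^-1 ^+ 2).
Proof. by move=> h1 h2; field; rewrite h1 h2. Qed.

Lemma inv_sub_remainder2 (s z w : R[i]) : s - z != 0 -> s - w != 0 ->
  (s - w)^-1 ^+ 2 - (s - z)^-1 ^+ 2 - 2 * (s - z)^-1 ^+ 3 * (w - z) =
  (w - z) ^+ 2 * ((s - w)^-1 * (s - z)^-1 ^+ 2 * ((s - w)^-1 + 2 * (s - z)^-1)).
Proof. by move=> h1 h2; field; rewrite h1 h2. Qed.

Section Transform.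
Variables (g : R[i] -> R[i]) (a b c d x0 y0 : R).
Hypotheses (hx : a < x0 < b) (hy : c < y0 < d) (cg : bcont g a b c d).
Let z0 : R[i] := (x0 +i* y0)%C.
Let ab : a <= b. Proof. by case/andP: hx; lra. Qed.
Let cd : c <= d. Proof. by case/andP: hy; lra. Qed.

(** The radius [p] is half the margin of [z0]: any w within [p] of [z0] then keeps distance at least
    [p] from the boundary, so the kernels 1/(s - w) are bounded uniformly in w and s. *)
Lemma transform_setup : exists p M, [/\ 0 < p, 0 <= M,
  forall s, onrect a b c d s -> cabs (g s) <= M,
  forall w n, cabs (w - z0) < p -> bcont (fun s => g s * (s - w)^-1 ^+ n) a b c d &
  forall w s, cabs (w - z0) < p -> onrect a b c d s ->
    s - w != 0 /\ cabs (s - w)^-1 <= p^-1].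
Proof.
have [q q0 [hx' hy']] := rect_margin hx hy.
have [M M0 hM] := bcont_bounded ab cd cg.
have q20 : 0 < q / 2 by lra.
have far w s : cabs (w - z0) < q / 2 -> onrect a b c d s ->
    s - w != 0 /\ cabs (s - w)^-1 <= (q / 2)^-1.
  move=> wz hs; have h := onrect_dist hx' hy' hs; rewrite -/z0 in h.
  have {}h : q / 2 <= cabs (s - w).
    have := cabsD (s - w) (w - z0); rewrite subrKA; lra.
  split; first by rewrite -cabs_gt0; lra.
  by rewrite cabsV lef_pV2// posrE; lra.
exists (q / 2), M; split=> // w n wz s hs.
apply: ccontM; first exact: cg.
apply: ccontX; apply: ccontV; last by case: (far _ _ wz hs).
by apply: ccontD; [exact: ccont_id|exact: ccont_cst].
Qed.

Lemma cauchy_transform_deriv1 :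
  is_cderiv (fun w => rint (fun s => g s * (s - w)^-1 ^+ 1) a b c d) z0
    (rint (fun s => g s * (s - z0)^-1 ^+ 2) a b c d).
Proof.
have [p [M [p0 M0 hM cK far]]] := transform_setup.
have zz : cabs (z0 - z0) < p by rewrite subrr cabs0.
have pV : 0 < p^-1 by rewrite invr_gt0.
apply: (@is_cderiv_rint _ _ _ _ _ _ _ (M * (p^-1 * p^-1 ^+ 2)) p) => //.
- by rewrite !mulr_ge0// ?exprn_ge0// ltW.
- by move=> w wz; exact: cK.
- exact: cK.
- move=> w s wz hs; have [n1 b1] := far _ _ wz hs; have [n2 b2] := far _ _ zz hs.
  rewrite !expr1 -mulrBr -mulrA -mulrBr inv_sub_remainder1// !(cabsX, cabsM).
  rewrite mulrCA mulrC ler_wpM2r ?exprn_ge0 ?cabs_ge0//.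
  apply: ler_pM => //; rewrite ?mulr_ge0 ?exprn_ge0 ?cabs_ge0//; first exact: hM.
  apply: ler_pM => //; rewrite ?exprn_ge0 ?cabs_ge0//.
  by rewrite lerXn2r// nnegrE ?cabs_ge0// ltW.
Qed.

Lemma cauchy_transform_deriv2 :
  is_cderiv (fun w => rint (fun s => g s * (s - w)^-1 ^+ 2) a b c d) z0
    (rint (fun s => 2 * (g s * (s - z0)^-1 ^+ 3)) a b c d).
Proof.
have [p [M [p0 M0 hM cK far]]] := transform_setup.
have zz : cabs (z0 - z0) < p by rewrite subrr cabs0.
have pV : 0 < p^-1 by rewrite invr_gt0.
apply: (@is_cderiv_rint _ _ _ _ _ _ _ (M * (p^-1 * p^-1 ^+ 2 * (p^-1 + 2 * p^-1))) p) => //.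
- by rewrite !mulr_ge0// ?exprn_ge0// ?addr_ge0// ?mulr_ge0// ltW.
- by move=> w wz; exact: cK.
- by apply: bcontZ; exact: cK.
- move=> w s wz hs; have [n1 b1] := far _ _ wz hs; have [n2 b2] := far _ _ zz hs.
  have -> : g s * (s - w)^-1 ^+ 2 - g s * (s - z0)^-1 ^+ 2 -
      2 * (g s * (s - z0)^-1 ^+ 3) * (w - z0) =
      g s * ((s - w)^-1 ^+ 2 - (s - z0)^-1 ^+ 2 - 2 * (s - z0)^-1 ^+ 3 * (w - z0)).
    set u := (s - w)^-1; set v := (s - z0)^-1; ring.
  rewrite inv_sub_remainder2// cabsM (cabsM (_ ^+ 2)) cabsX.
  rewrite mulrCA mulrC ler_wpM2r ?exprn_ge0 ?cabs_ge0//.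
  apply: ler_pM => //; rewrite ?cabs_ge0//; first exact: hM.
  rewrite cabsM (cabsM _ (_ ^+ 2)) cabsX; apply: ler_pM; rewrite ?mulr_ge0 ?exprn_ge0 ?cabs_ge0//.
    apply: ler_pM => //; rewrite ?exprn_ge0 ?cabs_ge0//.
    by rewrite lerXn2r// nnegrE ?cabs_ge0// ltW.
  apply: le_trans (cabsD _ _) _; apply: lerD => //.
  have c2 : cabs (2 : R[i]) = 2.
    by have := cabs_real (2 : R); rewrite ger0_norm// rmorphMn.
  by rewrite cabsM c2 ler_pM2l.
Qed.

End Transform.

Definition winding a b c d w := rint (fun s => 1 * (s - w)^-1 ^+ 1) a b c d.

Lemma Im_inv_sub (x y u v : R) : complex.Im (((x +i* y)%C - (u +i* v)%C)^-1) =
  (v - y) / ((x - u) ^+ 2 + (y - v) ^+ 2).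
Proof. by rewrite /= -mulNr opprB. Qed.

Lemma Re_inv_sub (x y u v : R) : complex.Re (((x +i* y)%C - (u +i* v)%C)^-1) =
  (x - u) / ((x - u) ^+ 2 + (y - v) ^+ 2).
Proof. by []. Qed.

(** Only the imaginary part is examined. Every side contributes the distance from the point to that
    side over the squared distance to the variable, which is positive and at least p/(2 q^2). Four
    sides of length at least 2 p give the bound. *)
Lemma winding_ge a b c d x0 y0 (p q : R) : 0 < p ->
  p <= x0 - a <= q -> p <= b - x0 <= q -> p <= y0 - c <= q -> p <= d - y0 <= q ->
  4 * p ^+ 2 / q ^+ 2 <= cabs (winding a b c d (x0 +i* y0)%C).
Proof.
move=> p0 /andP[xa1 xa2] /andP[xb1 xb2] /andP[yc1 yc2] /andP[yd1 yd2].
have q0 : 0 < q by order_lra.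
have ab : a <= b by order_lra.
have cd : c <= d by order_lra.
set z0 := (x0 +i* y0)%C.
have cK : bcont (fun s => 1 * (s - z0)^-1 ^+ 1) a b c d.
  by apply: bcont_cauchy; [order_lra|order_lra|move=> z _; exact: ccont_cst].
have key (s t : R) : p <= s <= q -> `|t| <= q -> p / (2 * q ^+ 2) <= s / (s ^+ 2 + t ^+ 2).
  move=> /andP[s1 s2]; rewrite ler_norml => /andP[t1 t2].
  have s0 : 0 < s ^+ 2 by apply: exprn_gt0; order_lra.
  have D0 : 0 < s ^+ 2 + t ^+ 2 by have := sqr_ge0 t; order_lra.
  rewrite ler_pdivrMr ?mulr_gt0 ?exprn_gt0// mulrAC ler_pdivlMr//.
  by apply: ler_pM; [order_lra|order_lra|order_lra|order_nra].
apply: le_trans _ (cabs_Im _); apply: le_trans _ (ler_norm _).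
rewrite /winding /rint.
have ImD (u v : R[i]) : complex.Im (u + 'i%C * v) = complex.Im u + complex.Re v.
  by case: u v => [? ?] [? ?] /=; rewrite mul0r mul1r add0r.
have ImE s t F : complex.Im (cint s t F) = \int[mu]_(r in `[s, t]) complex.Im (F r) by [].
have ReE s t F : complex.Re (cint s t F) = \int[mu]_(r in `[s, t]) complex.Re (F r) by [].
rewrite ImD ImE ReE.
have half (s t : R) (F : R -> R) : 2 * p <= t - s ->
    mu.-integrable `[s, t] (EFin \o F) ->
    (forall r, s <= r <= t -> 2 * (p / (2 * q ^+ 2)) <= F r) ->
    2 * p ^+ 2 / q ^+ 2 <= \int[mu]_(r in `[s, t]) F r.
  move=> st iF FM; have st' : s <= t by order_lra.
  apply: (@le_trans _ _ (2 * (p / (2 * q ^+ 2)) * (t - s))).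
    rewrite (_ : 2 * p ^+ 2 / q ^+ 2 = 2 * (p / (2 * q ^+ 2)) * (2 * p)).
      by apply: ler_wpM2l => //; rewrite mulr_ge0// divr_ge0 ?mulr_ge0 ?sqr_ge0// ltW.
    by field; order_lra.
  rewrite -Rintegral_cst_itv//; apply: le_Rintegral => //.
  by apply: continuous_itv_integrable => u _; exact: cst_continuous.
rewrite (_ : 4 * p ^+ 2 / q ^+ 2 = 2 * p ^+ 2 / q ^+ 2 + 2 * p ^+ 2 / q ^+ 2); last first.
  by field; order_lra.
have ImB (u v : R[i]) : complex.Im (u - v) = complex.Im u - complex.Im v by case: u v => [? ?] [? ?].
have ReB (u v : R[i]) : complex.Re (u - v) = complex.Re u - complex.Re v by case: u v => [? ?] [? ?].
apply: lerD; apply: half.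
- order_lra.
- exact: rcont_integrable Im_lip (rcont_bt cK).
- move=> r /andP[r1 r2]; rewrite !mul1r !expr1 ImB !Im_inv_sub.
  have rq : `|r - x0| <= q by rewrite ler_norml; apply/andP; split; order_lra.
  have k1 := key (y0 - c) (r - x0); have k2 := key (d - y0) (r - x0).
  rewrite [X in X - _](_ : _ = (y0 - c) / ((y0 - c) ^+ 2 + (r - x0) ^+ 2)); last first.
    by congr (_ / _); ring.
  rewrite [X in _ - X](_ : _ = - ((d - y0) / ((d - y0) ^+ 2 + (r - x0) ^+ 2))); last first.
    by rewrite -mulNr opprB; congr (_ / _); ring.
  rewrite opprK mulr_natl mulr2n; apply: lerD; [apply: k1|apply: k2] => //; apply/andP; split; order_lra.
- order_lra.
- exact: rcont_integrable Re_lip (rcont_rl cK).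
- move=> r /andP[r1 r2]; rewrite !mul1r !expr1 ReB !Re_inv_sub.
  have rq : `|r - y0| <= q by rewrite ler_norml; apply/andP; split; order_lra.
  have k1 := key (b - x0) (r - y0); have k2 := key (x0 - a) (r - y0).
  rewrite [X in _ - X](_ : _ = - ((x0 - a) / ((x0 - a) ^+ 2 + (r - y0) ^+ 2))); last first.
    by rewrite -mulNr opprB; congr (_ / _); ring.
  rewrite opprK mulr_natl mulr2n; apply: lerD; [apply: k1|apply: k2] => //; apply/andP; split; order_lra.
Qed.

Lemma winding_neq0 a b c d x0 y0 : a < x0 < b -> c < y0 < d ->
  winding a b c d (x0 +i* y0)%C != 0.
Proof.
move=> hx hy; have [p p0 [/andP[h1 h2] /andP[h3 h4]]] := rect_margin hx hy.
have [/andP[h5 h6] /andP[h7 h8]] := (hx, hy).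
pose q := (b - a) + (d - c).
have q0 : 0 < q by rewrite /q; order_lra.
rewrite -cabs_gt0; apply: lt_le_trans (@winding_ge _ _ _ _ _ _ p q _ _ _ _ _) => //;
  rewrite /q; try (apply/andP; split; order_lra).
by rewrite divr_gt0// ?mulr_gt0 ?exprn_gt0.
Qed.

Lemma inD_square x0 y0 (r : R) : 2 * r < 1 - cabs (x0 +i* y0)%C ->
  forall z, inrect (x0 - r) (x0 + r) (y0 - r) (y0 + r) z -> inD z.
Proof.
move=> hr [x y] [/= /andP[? ?] /andP[? ?]]; rewrite /inD.
have : cabs ((x +i* y)%C - (x0 +i* y0)%C) <= r + r.
  apply: le_trans (cabs_le_ReIm _) _ => /=.
  by apply: lerD; rewrite ler_norml; apply/andP; split; order_lra.
have := cabsD ((x +i* y)%C - (x0 +i* y0)%C) (x0 +i* y0)%C; rewrite subrK; order_lra.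
Qed.

(** Near [z0], f is the quotient of its own Cauchy transform by that of 1. The denominator is not
    known to be constant, so it is differentiated as well: the quotient rule expresses f' by
    transforms of orders 1 and 2, all of which are differentiable at [z0]. *)
Theorem analyticD_cderiv f : analyticD f -> analyticD (cderiv f).
Proof.
move=> af [x0 y0] z0D; set z0 := (x0 +i* y0)%C in z0D *.
pose r := (1 - cabs z0) / 3.
have r0 : 0 < r by rewrite /r; have := inD_ball_gt0 z0D; order_lra.
pose a := x0 - r; pose b := x0 + r; pose c := y0 - r; pose d := y0 + r.
have sq z : inrect a b c d z -> inD z by apply: inD_square; rewrite -/z0 /r in r0 *; order_lra.
have ab : a <= b by rewrite /a /b; order_lra.
have cd : c <= d by rewrite /c /d; order_lra.
have cf : bcont f a b c d.
  by move=> z /(onrect_inrect ab cd)/sq; exact: analyticD_cont.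
have c1 : bcont (fun=> 1) a b c d by move=> z _; exact: ccont_cst.
have int w : cabs (w - z0) < r -> a < complex.Re w < b /\ c < complex.Im w < d.
  move=> h; have := cabs_Re (w - z0); have := cabs_Im (w - z0).
  case: w h => u v /= h; rewrite !ler_norml => /andP[? ?] /andP[? ?].
  by rewrite /a /b /c /d; split; apply/andP; split; order_lra.
pose G (g : R[i] -> R[i]) n w := rint (fun s => g s * (s - w)^-1 ^+ n) a b c d.
pose W := G (fun=> 1).
have dG1 g w : cabs (w - z0) < r -> bcont g a b c d -> is_cderiv (G g 1%N) w (G g 2%N w).
  by move=> /int; case: w => u v [hu hv] cg; exact: cauchy_transform_deriv1.
have dG2 g : bcont g a b c d -> exists l, is_cderiv (G g 2%N) z0 l.
  move=> cg; have [hu hv] : a < x0 < b /\ c < y0 < d.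
    by apply: (int z0); rewrite subrr cabs0.
  by eexists; exact: cauchy_transform_deriv2.
have W0 w : cabs (w - z0) < r -> W 1%N w != 0.
  by move=> /int; case: w => u v [hu hv]; exact: winding_neq0.
have fE w : cabs (w - z0) < r -> f w = G f 1%N w * (W 1%N w)^-1.
  move=> wr; rewrite -[LHS](mulfK (W0 _ wr)); congr (_ / _).
  move: (wr) => /int; case: w wr => u v wr [hu hv].
  by rewrite /G cauchy_formula// => s /sq/af.
pose H w := G f 2%N w * (W 1%N w)^-1 + G f 1%N w * (- W 2%N w * (W 1%N w)^-1 ^+ 2).
have dfE w : cabs (w - z0) < r -> cderiv f w = H w.
  move=> wr; apply: cderivE.
  have rw : 0 < r - cabs (w - z0) by rewrite subr_gt0.
  apply: (is_cderiv_ext (f := fun w => G f 1%N w * (W 1%N w)^-1) rw) => [v hv|].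
    rewrite fE//; have := cabsD (v - w) (w - z0); rewrite subrKA; order_lra.
  have := is_cderivM (dG1 f w wr cf) (is_cderivV (dG1 _ w wr c1) (W0 _ wr)).
  by rewrite /H -exprVn.
have zr : cabs (z0 - z0) < r by rewrite subrr cabs0.
have [l1 d1] := dG2 _ cf; have [l2 d2] := dG2 _ c1.
have dW := dG1 _ _ zr c1; have dV := is_cderivV dW (W0 _ zr).
have := is_cderivD (is_cderivM d1 dV) (is_cderivM (dG1 f _ zr cf)
  (is_cderivM (is_cderivN d2) (is_cderivX 2 dV))).
set l := (X in is_cderiv _ _ X) => dH; exists l.
by apply: is_cderiv_ext dH; [exact: r0|move=> w wr; rewrite dfE].
Qed.

End CauchyTransform.

(** * Submean inequality for powers of the modulus *)

Section PlaneMeasurability.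
Context {R : realType}.
Notation mu := (@lebesgue_measure R).
Implicit Types (O : set (R * R)) (F : R * R -> R).

Definition open2 O := forall x, O x ->
  exists2 d : R, 0 < d & forall y, cabs (toC y - toC x) < d -> O y.

Definition cont2 F x := forall e : R, 0 < e ->
  exists2 d : R, 0 < d & forall y, cabs (toC y - toC x) < d -> `|F y - F x| < e.

(** Boxes around rational points form a countable family, so an open set for the modulus is a
    countable union of measurable rectangles. This links epsilon-delta continuity on [R[i]] with the
    product sigma-algebra on [R * R]. *)
Lemma open2_measurable O : open2 O -> measurable O.
Proof.
move=> oO.
pose B (i : rat * rat * nat) : set (R * R) :=
  `](ratr i.1.1 - i.2.+1%:R^-1), (ratr i.1.1 + i.2.+1%:R^-1)[ `*`
  `](ratr i.1.2 - i.2.+1%:R^-1), (ratr i.1.2 + i.2.+1%:R^-1)[.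
pose F i := if pselect (B i `<=` O) then B i else set0.
have -> : O = \bigcup_i F i.
  apply/seteqP; split=> [[x y] xyO|x [i _]]; last first.
    by rewrite /F; case: pselect => // BO; exact: BO.
  have [d d0 hd] := oO _ xyO.
  (* The centre is within e of the point in each coordinate and the box adds another e; two
     coordinates give 4 e < d. *)
  have [n hn] : exists n, n.+1%:R^-1 < d / 4 :> R.
    have [n _ /(_ _ (leqnn n)) h] := @near_infty_natSinv_lt R (PosNum (divr_gt0 d0 (@ltr0n R 4))).
    by exists n.
  set e := n.+1%:R^-1 in hn; have e0 : 0 < e by rewrite invr_gt0.
  have [q1 /itvP h1] : exists q, ratr q \in `](x - e), (x + e)[ by apply: rat_in_itvoo; order_lra.
  have [q2 /itvP h2] : exists q, ratr q \in `](y - e), (y + e)[ by apply: rat_in_itvoo; order_lra.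
  have [a1 a2] : x - e < ratr q1 /\ ratr q1 < x + e by rewrite !h1.
  have [b1 b2] : y - e < ratr q2 /\ ratr q2 < y + e by rewrite !h2.
  have BO : B (q1, q2, n) `<=` O.
    move=> [u v] [/=]; rewrite !in_itv /= -/e => /andP[u1 u2] /andP[v1 v2]; apply: hd.
    apply: le_lt_trans (cabs_le_ReIm _) _ => /=.
    have A : `|u - x| <= 2 * e by rewrite ler_norml; apply/andP; split; order_lra.
    have A' : `|v - y| <= 2 * e by rewrite ler_norml; apply/andP; split; order_lra.
    order_lra.
  exists (q1, q2, n) => //; rewrite /F; case: pselect => [{}BO|//].
  by split => /=; rewrite in_itv /= -/e; apply/andP; split; order_lra.
apply: countable_bigcupT_measurable; first exact: countableP.
by move=> i; rewrite /F; case: pselect => [{}BO|BO]; [exact: measurableX|exact: measurable0].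
Qed.

Lemma cont2_measurable O F : open2 O -> (forall x, O x -> cont2 F x) ->
  measurable_fun O F.
Proof.
move=> oO cF; apply: (measurability _ (RGenOpens.measurableE R)).
move=> _ [_ [a [b ->] <-]]; apply: open2_measurable => x [Ox /=].
rewrite in_itv /= => /andP[aF Fb].
have [d1 d10 h1] := oO _ Ox.
have e0 : 0 < Num.min (F x - a) (b - F x) by rewrite lt_min !subr_gt0 aF.
have [d2 d20 h2] := cF _ Ox _ e0.
exists (Num.min d1 d2); first by rewrite lt_min d10.
move=> y; rewrite lt_min => /andP[/h1 Oy /h2]; rewrite lt_min => /andP[k1 k2].
split=> //=; rewrite in_itv /=; move: k1 k2; rewrite !ltr_norml => /andP[? ?] /andP[? ?].
by apply/andP; split; order_lra.
Qed.

Lemma diskR2_open2 : open2 (@diskR2 R).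
Proof.
move=> x xD; exists (1 - cabs (toC x)); first exact: inD_ball_gt0.
by move=> y; exact: inD_ball.
Qed.

Lemma measurable_diskR2 : measurable (@diskR2 R).
Proof. exact: open2_measurable diskR2_open2. Qed.

Lemma ccont_cont2 (p : R[i] -> R) (f : R[i] -> R[i]) x :
  (forall z w, `|p z - p w| <= cabs (z - w)) -> ccont f (toC x) ->
  cont2 (fun x => p (f (toC x))) x.
Proof.
move=> pL cf e e0; have [d d0 h] := cf _ e0; exists d => // y /h.
exact: le_lt_trans (pL _ _).
Qed.

Lemma measurable_cabs (f : R[i] -> R[i]) : (forall z, inD z -> ccont f z) ->
  measurable_fun (@diskR2 R) (fun x => cabs (f (toC x))).
Proof.
move=> cf; apply: cont2_measurable; first exact: diskR2_open2.
by move=> x xD; apply: ccont_cont2; [exact: cabs_lip|exact: cf].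
Qed.

(** Tonelli and Chebyshev: if every slice over [A] exceeded [k], the whole integral would be at
    least [k * s], hence more than [I]. *)
Lemma good_vline (f : R * R -> \bar R) (A : set R) (s k I : R) :
  measurable_fun [set: R * R] f -> (forall x, (0 <= f x)%E) ->
  (\int[@leb2 R]_x f x <= I%:E)%E -> measurable A -> mu A = s%:E -> I < k * s ->
  exists2 a, A a & (\int[mu]_y f (a, y) <= k%:E)%E.
Proof.
move=> mf f0 fI mA sA Iks; apply: contrapT => h.
have I0 : 0 <= I by rewrite -lee_fin; apply: le_trans fI; exact: integral_ge0.
have s0 : 0 <= s by rewrite -lee_fin -sA.
have k0 : 0 <= k.
  rewrite leNgt; apply/negP => kn; have ks : k * s <= 0 by order_nra.
  by move: Iks; rewrite ltNge (le_trans ks).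
have hA a : A a -> (k%:E <= \int[mu]_y f (a, y))%E.
  by move=> Aa; rewrite leNgt; apply/negP => /ltW H; apply: h; exists a.
move: fI; apply/negP; rewrite -ltNge /leb2 fubini_tonelli1//.
apply: (@lt_le_trans _ _ (\int[mu]_(x in A) fubini_F mu f x)%E); last first.
  apply: ge0_subset_integral => //; first exact: measurable_fun_fubini_tonelli_F.
  by move=> x _; exact: integral_ge0.
apply: (@lt_le_trans _ _ (\int[mu]_(x in A) (k%:E))%E).
  have -> : (\int[mu]_(x in A) k%:E = k%:E * mu A)%E by exact: integral_cst.
  by rewrite sA -EFinM lte_fin.
apply: ge0_le_integral => //.
- by apply: measurable_funTS; exact: measurable_fun_fubini_tonelli_F.
Qed.

Lemma good_hline (f : R * R -> \bar R) (A : set R) (s k I : R) :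
  measurable_fun [set: R * R] f -> (forall x, (0 <= f x)%E) ->
  (\int[@leb2 R]_x f x <= I%:E)%E -> measurable A -> mu A = s%:E -> I < k * s ->
  exists2 a, A a & (\int[mu]_x f (x, a) <= k%:E)%E.
Proof.
move=> mf f0 fI mA sA Iks; apply: contrapT => h.
have I0 : 0 <= I by rewrite -lee_fin; apply: le_trans fI; exact: integral_ge0.
have s0 : 0 <= s by rewrite -lee_fin -sA.
have k0 : 0 <= k.
  rewrite leNgt; apply/negP => kn; have ks : k * s <= 0 by order_nra.
  by move: Iks; rewrite ltNge (le_trans ks).
have hA a : A a -> (k%:E <= \int[mu]_y f (y, a))%E.
  by move=> Aa; rewrite leNgt; apply/negP => /ltW H; apply: h; exists a.
move: fI; apply/negP; rewrite -ltNge /leb2 fubini_tonelli2//.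
apply: (@lt_le_trans _ _ (\int[mu]_(x in A) fubini_G mu f x)%E); last first.
  apply: ge0_subset_integral => //; first exact: measurable_fun_fubini_tonelli_G.
  by move=> x _; exact: integral_ge0.
apply: (@lt_le_trans _ _ (\int[mu]_(x in A) (k%:E))%E).
  have -> : (\int[mu]_(x in A) k%:E = k%:E * mu A)%E by exact: integral_cst.
  by rewrite sA -EFinM lte_fin.
apply: ge0_le_integral => //.
- by apply: measurable_funTS; exact: measurable_fun_fubini_tonelli_G.
Qed.

End PlaneMeasurability.

(** * The submean inequality for the modulus itself *)

Section SubMean.
Context {R : realType}.
Notation mu := (@lebesgue_measure R).
Implicit Types (f h : R[i] -> R[i]).

Definition square (x0 y0 r : R) : set (R * R) :=
  `[x0 - r, x0 + r] `*` `[y0 - r, y0 + r].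

Lemma measurable_square (x0 y0 r : R) : measurable (square x0 y0 r).
Proof. exact: measurableX. Qed.

Lemma rcont_int_le (F : R -> R[i]) (a b a' b' K : R) :
  a' <= a -> b <= b' -> rcont_on a' b' F ->
  (\int[mu]_(t in `[a', b']) (cabs (F t))%:E <= K%:E)%E ->
  \int[mu]_(t in `[a, b]) cabs (F t) <= K.
Proof.
move=> aa bb cF FK.
have iF := rcont_integrable cabs_lip cF.
have sub : `[a, b]%classic `<=` (`[a', b']%classic : set R).
  by move=> t /=; rewrite !in_itv /= => /andP[? ?]; apply/andP; split; order_lra.
have iF' : mu.-integrable `[a, b] (EFin \o (fun t => cabs (F t))).
  exact: integrableS iF.
rewrite -lee_fin /Rintegral fineK; last exact: integrable_fin_num.
apply: le_trans FK; apply: ge0_subset_integral => //.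
  by case/integrableP: iF.
by move=> x _; rewrite lee_fin cabs_ge0.
Qed.

Lemma rint_le_sides f a b c d (C K : R) (h : R[i] -> R[i]) :
  0 <= C -> a <= b -> c <= d ->
  bcont f a b c d -> bcont h a b c d ->
  (forall s, onrect a b c d s -> cabs (f s) <= C * cabs (h s)) ->
  \int[mu]_(x in `[a, b]) cabs (h (x +i* c)%C) <= K ->
  \int[mu]_(x in `[a, b]) cabs (h (x +i* d)%C) <= K ->
  \int[mu]_(y in `[c, d]) cabs (h (a +i* y)%C) <= K ->
  \int[mu]_(y in `[c, d]) cabs (h (b +i* y)%C) <= K ->
  cabs (rint f a b c d) <= 8 * C * K.
Proof.
move=> C0 ab cd cf ch fh K1 K2 K3 K4.
have two s t (F G H1 H2 : R -> R[i]) : rcont_on s t F -> rcont_on s t G ->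
    rcont_on s t H1 -> rcont_on s t H2 ->
    (forall u, s <= u <= t -> cabs (F u) <= C * cabs (H1 u)) ->
    (forall u, s <= u <= t -> cabs (G u) <= C * cabs (H2 u)) ->
    \int[mu]_(x in `[s, t]) cabs (H1 x) <= K ->
    \int[mu]_(x in `[s, t]) cabs (H2 x) <= K ->
    cabs (cint s t (fun u => F u - G u)) <= 4 * C * K.
  move=> cF cG c1 c2 FH GH k1 k2.
  have iH1 := rcont_integrable cabs_lip c1; have iH2 := rcont_integrable cabs_lip c2.
  have cFG : rcont_on s t (fun u => F u - G u) by move=> u hu; apply: rcontB; [exact: cF|exact: cG].
  apply: le_trans (cint_le_int cFG) _.
  rewrite (_ : 4 * C * K = 2 * (C * K + C * K)); last by ring.
  rewrite ler_pM2l//.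
  have iZ (g : R -> R) : mu.-integrable `[s, t] (EFin \o g) ->
      mu.-integrable `[s, t] (EFin \o (fun u => C * g u)).
    move=> gi; rewrite (_ : _ \o _ = (fun u => C%:E * (EFin \o g) u)%E)//.
    exact: integrableZl.
  have iD : mu.-integrable `[s, t] (EFin \o (fun u => C * cabs (H1 u) + C * cabs (H2 u))).
    rewrite (_ : _ \o _ = ((EFin \o (fun u => C * cabs (H1 u)))%R \+ (EFin \o (fun u => C * cabs (H2 u)))%R)%E)//.
    by apply: integrableD => //; exact: iZ.
  apply: (@le_trans _ _ (\int[mu]_(u in `[s, t]) (C * cabs (H1 u) + C * cabs (H2 u)))).
    apply: le_Rintegral => //; first exact: rcont_integrable cabs_lip cFG.
    move=> u; rewrite /= in_itv /= => hu; apply: le_trans (cabsB _ _) _.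
    by apply: lerD; [exact: FH|exact: GH].
  rewrite RintegralD//; [|exact: iZ|exact: iZ].
  by rewrite !RintegralZl//; apply: lerD; apply: ler_wpM2l.
rewrite (_ : 8 * C * K = 4 * C * K + 4 * C * K); last by ring.
apply: le_trans (cabsD _ _) _; rewrite cabsM cabs_i mul1r; apply: lerD.
  apply: (two _ _ _ _ (fun x => h (x +i* c)%C) (fun x => h (x +i* d)%C)) => //.
  - exact: (rcont_bottom cf).
  - exact: (rcont_top cf).
  - exact: (rcont_bottom ch).
  - exact: (rcont_top ch).
  - by move=> u hu; apply: fh; left; split=> //; left.
  - by move=> u hu; apply: fh; left; split=> //; right.
apply: (two _ _ _ _ (fun x => h (b +i* x)%C) (fun x => h (a +i* x)%C)) => //.
- exact: (rcont_right cf).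
- exact: (rcont_left cf).
- exact: (rcont_right ch).
- exact: (rcont_left ch).
- by move=> u hu; apply: fh; right; split=> //; right.
- by move=> u hu; apply: fh; right; split=> //; left.
Qed.

(** With margins between r/2 and r, [winding_ge] gives a factor of modulus at least 1, so that
    factor can be inserted at no cost. Cauchy's formula then leaves the kernel, at most 2/r, times
    the integrals over the four sides. *)
Lemma cauchy_estimate h a b c d x0 y0 (r K : R) : 0 < r ->
  r / 2 <= x0 - a <= r -> r / 2 <= b - x0 <= r ->
  r / 2 <= y0 - c <= r -> r / 2 <= d - y0 <= r ->
  (forall z, inrect a b c d z -> exists l, is_cderiv h z l) ->
  \int[mu]_(x in `[a, b]) cabs (h (x +i* c)%C) <= K ->
  \int[mu]_(x in `[a, b]) cabs (h (x +i* d)%C) <= K ->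
  \int[mu]_(y in `[c, d]) cabs (h (a +i* y)%C) <= K ->
  \int[mu]_(y in `[c, d]) cabs (h (b +i* y)%C) <= K ->
  cabs (h (x0 +i* y0)%C) <= 16 / r * K.
Proof.
move=> r0 ha hb hc hd dh.
have [/andP[a1 a2] /andP[b1 b2]] := (ha, hb).
have [/andP[c1 c2] /andP[d1 d2]] := (hc, hd).
have ab : a <= b by order_lra.
have cd : c <= d by order_lra.
have ax : a < x0 < b by apply/andP; split; order_lra.
have cy : c < y0 < d by apply/andP; split; order_lra.
have ch : bcont h a b c d by move=> z /(onrect_inrect ab cd)/dh[l]; exact: is_cderiv_cont.
have W1 : 1 <= cabs (winding a b c d (x0 +i* y0)%C).
  have r20 : 0 < r / 2 by order_lra.
  apply: le_trans _ (winding_ge r20 ha hb hc hd).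
  by rewrite le_eqVlt; apply/orP; left; apply/eqP; field; order_lra.
have far s : onrect a b c d s -> cabs (s - (x0 +i* y0)%C)^-1 <= 2 / r.
  move=> hs; have hs' : r / 2 <= cabs (s - (x0 +i* y0)%C).
    by apply: onrect_dist hs; apply/andP; split; order_lra.
  rewrite cabsV -[2 / r]invf_div lef_pV2// posrE; last by rewrite divr_gt0.
  by apply: lt_le_trans hs'; rewrite divr_gt0.
move=> K1 K2 K3 K4.
apply: (@le_trans _ _ (cabs (h (x0 +i* y0)%C * winding a b c d (x0 +i* y0)%C))).
  by rewrite cabsM ler_peMr ?cabs_ge0.
rewrite /winding -cauchy_formula//.
rewrite (_ : 16 / r * K = 8 * (2 / r) * K); last by field; rewrite gt_eqF.
apply: (rint_le_sides (h := h)) => //.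
- by rewrite divr_ge0// ltW.
- exact: bcont_cauchy.
move=> s hs; rewrite expr1 cabsM mulrC ler_wpM2r ?cabs_ge0//; exact: far.
Qed.

(** Each side of the contour may be moved within a band of width r/2, and on some line of the band
    the integral of |h| is at most about 2 I / r. Four such lines bound a rectangle to which
    [cauchy_estimate] applies. *)
Lemma submean1 h x0 y0 (r I : R) : 0 < r -> 2 * r < 1 - cabs (x0 +i* y0)%C ->
  analyticD h ->
  (\int[@leb2 R]_(x in square x0 y0 r) (cabs (h (toC x)))%:E <= I%:E)%E ->
  cabs (h (x0 +i* y0)%C) <= 32 / r ^+ 2 * I.
Proof.
move=> r0 hr ah hI.
have sqD := inD_square hr.
have subD : square x0 y0 r `<=` @diskR2 R.
  by move=> [x y] [/=]; rewrite !in_itv /= => hx hy; exact: (sqD (x +i* y)%C).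
have mh : measurable_fun (square x0 y0 r) (fun x => (cabs (h (toC x)))%:E).
  apply/measurable_EFinP; apply: measurable_funS subD _; first exact: measurable_diskR2.
  by apply: measurable_cabs => z /(analyticD_cont ah).
pose f := (fun x => (cabs (h (toC x)))%:E) \_ (square x0 y0 r).
have mf : measurable_fun [set: R * R] f.
  exact: ((measurable_restrictT _ (measurable_square x0 y0 r)).1 mh).
have f0 x : (0 <= f x)%E.
  by rewrite /f patchE; case: ifP => // _; rewrite lee_fin cabs_ge0.
have fI : (\int[@leb2 R]_x f x <= I%:E)%E by rewrite /f -integral_mkcond.
have I0 : 0 <= I by rewrite -lee_fin; apply: le_trans fI; exact: integral_ge0.
apply/ler_addgt0Pr => e e0.
(* With this value [16 / r * k] equals [32 / r ^+ 2 * I + e]; the excess makes the inequality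
   required by [good_vline] strict. *)
pose k := 2 * I / r + e * r / 16.
have k0 : 0 <= k.
  by apply: addr_ge0; apply: divr_ge0 => //; [order_lra|exact: ltW|exact/ltW/mulr_gt0].
have Ik : I < k * (r / 2).
  rewrite /k mulrDl (_ : 2 * I / r * (r / 2) = I); last by field; order_lra.
  by rewrite ltrDl !mulr_gt0//; order_lra.
have len (s t : R) : s < t -> mu `[s, t] = (t - s)%:E.
  by move=> st; have := lebesgue_measure_itv `[s, t]; rewrite /= lte_fin st.
have cv x : x0 - r <= x <= x0 + r -> rcont_on (y0 - r) (y0 + r) (fun y => h (x +i* y)%C).
  move=> hx; apply: rcont_comp (fun s t => cabs_vline s t x) _ => t ht.
  by apply: analyticD_cont => //; apply: sqD.
have cw y : y0 - r <= y <= y0 + r -> rcont_on (x0 - r) (x0 + r) (fun x => h (x +i* y)%C).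
  move=> hx; apply: rcont_comp (fun s t => cabs_hline s t y) _ => t ht.
  by apply: analyticD_cont => //; apply: sqD.
have fv x : x0 - r <= x <= x0 + r ->
    (\int[mu]_y f (x, y))%E = (\int[mu]_(y in `[(y0 - r)%R, (y0 + r)%R]) (cabs (h (x +i* y)%C))%:E)%E.
  move=> hx; rewrite [RHS]integral_mkcond; apply: eq_integral => y _.
  rewrite /f !patchE; congr (if _ then _ else _).
  by apply/idP/idP; rewrite !inE; [case|move=> hy; split=> //=; rewrite in_itv].
have fw y : y0 - r <= y <= y0 + r ->
    (\int[mu]_x f (x, y))%E = (\int[mu]_(x in `[(x0 - r)%R, (x0 + r)%R]) (cabs (h (x +i* y)%C))%:E)%E.
  move=> hx; rewrite [RHS]integral_mkcond; apply: eq_integral => x _.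
  rewrite /f !patchE; congr (if _ then _ else _).
  by apply/idP/idP; rewrite !inE; [case|move=> hy; split=> //=; rewrite in_itv].
have vl (s t : R) : x0 - r <= s -> t <= x0 + r -> t - s = r / 2 -> exists a, s <= a <= t /\
    forall c d, y0 - r <= c -> d <= y0 + r -> \int[mu]_(y in `[c, d]) cabs (h (a +i* y)%C) <= k.
  move=> hs ht st; have st' : s < t by order_lra.
  have [//||a] := good_vline (A := `[s, t]%classic) (s := r / 2) (k := k) mf f0 fI _ _ Ik.
    by rewrite len// st.
  rewrite /= in_itv /= => ha; have ha' : x0 - r <= a <= x0 + r.
    by case/andP: ha => ? ?; apply/andP; split; order_lra.
  rewrite fv// => H; exists a; split=> // c d hc hd.
  exact: rcont_int_le hc hd (cv _ ha') H.
have hl (s t : R) : y0 - r <= s -> t <= y0 + r -> t - s = r / 2 -> exists a, s <= a <= t /\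
    forall c d, x0 - r <= c -> d <= x0 + r -> \int[mu]_(x in `[c, d]) cabs (h (x +i* a)%C) <= k.
  move=> hs ht st; have st' : s < t by order_lra.
  have [//||a] := good_hline (A := `[s, t]%classic) (s := r / 2) (k := k) mf f0 fI _ _ Ik.
    by rewrite len// st.
  rewrite /= in_itv /= => ha; have ha' : y0 - r <= a <= y0 + r.
    by case/andP: ha => ? ?; apply/andP; split; order_lra.
  rewrite fw// => H; exists a; split=> // c d hc hd.
  exact: rcont_int_le hc hd (cw _ ha') H.
have [a [/andP[a1 a2] hA]] := vl (x0 - r) (x0 - r / 2) ltac:(order_lra) ltac:(order_lra) ltac:(order_lra).
have [b [/andP[b1 b2] hB]] := vl (x0 + r / 2) (x0 + r) ltac:(order_lra) ltac:(order_lra) ltac:(order_lra).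
have [c [/andP[c1 c2] hC]] := hl (y0 - r) (y0 - r / 2) ltac:(order_lra) ltac:(order_lra) ltac:(order_lra).
have [d [/andP[d1 d2] hD]] := hl (y0 + r / 2) (y0 + r) ltac:(order_lra) ltac:(order_lra) ltac:(order_lra).
apply: (@le_trans _ _ (16 / r * k)); last first.
  by rewrite /k le_eqVlt; apply/orP; left; apply/eqP; field; order_lra.
apply: (@cauchy_estimate h a b c d) => //; try (apply/andP; split; order_lra).
- move=> z hz; apply: ah; apply: sqD; case: hz => /andP[? ?] /andP[? ?].
  by split; apply/andP; split; order_lra.
- by apply: hC; order_lra.
- by apply: hD; order_lra.
- by apply: hA; order_lra.
- by apply: hB; order_lra.
Qed.

End SubMean.

(** * Inequalities between real powers *)

Section RealPowers.
Context {R : realType}.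
Implicit Types x y s t a r p : R.

Lemma powR_le x y r : 0 <= r -> 0 <= x -> x <= y -> x `^ r <= y `^ r.
Proof.
by move=> r0 x0 xy; apply: ge0_ler_powR; rewrite ?nnegrE//; exact: le_trans xy.
Qed.

Lemma powR_geN x y r : r <= 0 -> 0 < x -> x <= y -> y `^ r <= x `^ r.
Proof.
move=> r0 x0 xy; have y0 : 0 < y by exact: lt_le_trans xy.
rewrite -[r]opprK !(powRN _ (- r)) lef_pV2 ?posrE ?powR_gt0//.
by apply: powR_le; rewrite ?oppr_ge0// ltW.
Qed.

(** Two-sided comparability by the factor [K] passes to powers of either sign at the cost of the
    exponent |a|; weight exponents may be negative. *)
Lemma powR_compare (K s t a : R) : 1 <= K -> 0 < s -> s <= K * t -> t <= K * s ->
  t `^ a <= K `^ `|a| * s `^ a.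
Proof.
move=> K1 s0 sKt tKs; have K0 : 0 < K by order_lra.
have t0 : 0 < t by rewrite -(pmulr_rgt0 _ K0); order_lra.
have [a0|a0] := leP 0 a.
  rewrite ger0_norm// -powRM; [|exact: ltW|exact: ltW].
  by apply: powR_le => //; exact: ltW.
rewrite ltr0_norm// powRN mulrC ler_pdivlMr ?powR_gt0// -powRM; [|exact: ltW|exact: ltW].
by apply: powR_geN => //; [exact: ltW|rewrite mulrC].
Qed.

Lemma powR_leV x y p : 0 < p -> 0 <= x -> 0 <= y -> x `^ p <= y `^ p -> x <= y.
Proof.
move=> p0 x0 y0; rewrite leNgt => /negP h; rewrite leNgt; apply/negP => yx; apply: h.
by apply: gt0_ltr_powR; rewrite ?nnegrE.
Qed.

(* Young-type inequality: a substitute for Jensen's inequality in [submean_ge1]. *)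
Lemma le_powR_split (t l p : R) : 1 <= p -> 0 <= t -> 0 < l ->
  t <= l + l `^ (1 - p) * t `^ p.
Proof.
move=> p1 t0 l0; have [tl|lt] := leP t l.
  by apply: le_trans tl _; rewrite lerDl mulr_ge0 ?powR_ge0.
have t0' : 0 < t by order_lra.
apply: (@le_trans _ _ (l `^ (1 - p) * t `^ p)); last by rewrite lerDr ltW.
rewrite -{1}(powRr1 t0) (_ : 1 = (1 - p) + p); last by ring.
rewrite powRD; last by apply/implyP => _; rewrite gt_eqF.
rewrite (_ : 1 - p + p = 1); last by ring.
by rewrite ler_wpM2r ?powR_ge0//; apply: powR_geN; order_lra.
Qed.

End RealPowers.

(** * The submean inequality for exponents p >= 1 *)

Section SubMeanPower.
Context {R : realType}.
Notation mu := (@lebesgue_measure R).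
Notation leb2 := (@leb2 R).
Implicit Types (h : R[i] -> R[i]).

Lemma measurable_cabs_powR h p : analyticD h ->
  measurable_fun (@diskR2 R) (fun x => cabs (h (toC x)) `^ p).
Proof.
move=> ah; apply: (measurableT_comp (measurable_powR p)).
by apply: measurable_cabs => z /(analyticD_cont ah).
Qed.

Lemma square_sub_disk (x0 y0 r : R) : 2 * r < 1 - cabs (x0 +i* y0)%C ->
  square x0 y0 r `<=` @diskR2 R.
Proof.
move=> hr [x y] [/=]; rewrite !in_itv /= => hx hy.
exact: (inD_square hr (z := (x +i* y)%C)).
Qed.

Lemma leb2_square (x0 y0 r : R) : 0 < r -> leb2 (square x0 y0 r) = (4 * r ^+ 2)%:E.
Proof.
move=> r0; have len (s t : R) : s < t -> mu `[s, t] = (t - s)%:E.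
  by move=> st; have := lebesgue_measure_itv `[s, t]; rewrite /= lte_fin st.
have -> : leb2 (square x0 y0 r) = (mu `[(x0 - r)%R, (x0 + r)%R] * mu `[(y0 - r)%R, (y0 + r)%R])%E.
  exact: product_measure1E.
rewrite !len; [|order_lra|order_lra]; rewrite -EFinM; congr EFin; ring.
Qed.

(** Compactness of the closed square through [bisection]: continuity bounds |h| on small boxes, and
    the sum of the bounds on four quarters serves for their union. *)
Lemma analytic_square_bounded h (x0 y0 r : R) : 0 < r ->
  2 * r < 1 - cabs (x0 +i* y0)%C -> analyticD h ->
  exists2 B, 0 <= B &
    forall z, inrect (x0 - r) (x0 + r) (y0 - r) (y0 + r) z -> cabs (h z) <= B.
Proof.
move=> r0 hr ah; have sqD := inD_square hr.
pose hw (C : R) n := C / 2 ^+ n.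
pose P x y n := exists2 B, 0 <= B & forall z,
  inrect (x0 - r) (x0 + r) (y0 - r) (y0 + r) z ->
  inrect x (x + hw (2 * r) n) y (y + hw (2 * r) n) z -> cabs (h z) <= B.
have rr : 0 <= 2 * r by order_lra.
have /(_ (x0 - r) (y0 - r)) [B B0 hB] : forall x y, P x y 0.
  apply: (bisection rr rr).
  - move=> x y n [B1 p1 h1] [B2 p2 h2] [B3 p3 h3] [B4 p4 h4].
    exists (B1 + B2 + B3 + B4); first order_lra.
    move=> [u v] zQ [/= /andP[u1 u2] /andP[v1 v2]].
    rewrite -/(hw _ n.+1) in h1 h2 h3 h4.
    have E : hw (2 * r) n = hw (2 * r) n.+1 + hw (2 * r) n.+1.
      by rewrite /hw dyadic_half; field; rewrite expf_neq0.
    move: (hw (2 * r) n.+1) (hw (2 * r) n) E h1 h2 h3 h4 u2 v2 => H H' -> h1 h2 h3 h4 u2 v2.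
    have {}h1 := h1 _ zQ; have {}h2 := h2 _ zQ.
    have {}h3 := h3 _ zQ; have {}h4 := h4 _ zQ.
    clear -p1 p2 p3 p4 h1 h2 h3 h4 u1 u2 v1 v2.
    have [uH|uH] := leP u (x + H); have [vH|vH] := leP v (y + H).
    + have : cabs (h (u +i* v)%C) <= B1 by apply: h1; split; apply/andP; split=> /=; order_lra.
      by order_lra.
    + have : cabs (h (u +i* v)%C) <= B3 by apply: h3; split; apply/andP; split=> /=; order_lra.
      by order_lra.
    + have : cabs (h (u +i* v)%C) <= B2 by apply: h2; split; apply/andP; split=> /=; order_lra.
      by order_lra.
    + have : cabs (h (u +i* v)%C) <= B4 by apply: h4; split; apply/andP; split=> /=; order_lra.
      by order_lra.
  - move=> u0 v0.
    have [w0Q|w0Q] := pselect (inrect (x0 - r) (x0 + r) (y0 - r) (y0 + r) (u0 +i* v0)%C).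
      have [d d0 hd] := analyticD_cont ah (sqD _ w0Q) ltr01.
      exists d => // x y n hu hv hn; exists (cabs (h (u0 +i* v0)%C) + 1).
        by have := cabs_ge0 (h (u0 +i* v0)%C); order_lra.
      move=> z _ zn; have := hd z.
      have w0n : inrect x (x + hw (2 * r) n) y (y + hw (2 * r) n) (u0 +i* v0)%C by split.
      have -> : cabs (z - (u0 +i* v0)%C) < d.
        apply: le_lt_trans (inrect_dist zn w0n) _.
        by rewrite !(addrAC _ _ (- _)) !subrr !add0r /hw -mulrDl.
      move/(_ isT); have := cabs_lerB (h z) (h (u0 +i* v0)%C); order_lra.
    (* A box through a point outside the closed square may still meet the square, but not a small one. *)
    have out : exists2 d, 0 < d & forall z, inrect (x0 - r) (x0 + r) (y0 - r) (y0 + r) z ->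
        d <= cabs (z - (u0 +i* v0)%C).
      have [h1|h1] := ltP u0 (x0 - r).
        exists (x0 - r - u0); first order_lra.
        move=> [u v] [/= /andP[? ?] _]; apply: le_trans (cabs_Re _) => /=.
        by rewrite ler_normr; apply/orP; left; order_lra.
      have [h2|h2] := ltP (x0 + r) u0.
        exists (u0 - (x0 + r)); first order_lra.
        move=> [u v] [/= /andP[? ?] _]; apply: le_trans (cabs_Re _) => /=.
        by rewrite ler_normr; apply/orP; right; order_lra.
      have [h3|h3] := ltP v0 (y0 - r).
        exists (y0 - r - v0); first order_lra.
        move=> [u v] [/= _ /andP[? ?]]; apply: le_trans (cabs_Im _) => /=.
        by rewrite ler_normr; apply/orP; left; order_lra.
      have [h4|h4] := ltP (y0 + r) v0.
        exists (v0 - (y0 + r)); first order_lra.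
        move=> [u v] [/= _ /andP[? ?]]; apply: le_trans (cabs_Im _) => /=.
        by rewrite ler_normr; apply/orP; right; order_lra.
      by exfalso; apply: w0Q; split; apply/andP; split=> /=; order_lra.
    have [d d0 hd] := out; exists d => // x y n hu hv hn; exists 0 => // z zQ zn.
    have w0n : inrect x (x + hw (2 * r) n) y (y + hw (2 * r) n) (u0 +i* v0)%C by split.
    exfalso; have := hd _ zQ; rewrite leNgt => /negP; apply.
    apply: le_lt_trans (inrect_dist zn w0n) _.
    by rewrite !(addrAC _ _ (- _)) !subrr !add0r /hw -mulrDl.
exists B => // z zQ; apply: hB => //.
rewrite /hw expr0 divr1; case: zQ => h1 h2.
by split; [move: h1|move: h2] => /andP[? ?]; apply/andP; split; order_lra.
Qed.

(** With l = |h(z0)|/256, integrating t <= l + l^(1-p) t^p and applying [submean1] gives 256 l <=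
    128 l + 32 l^(1-p) I / r^2. The number 256 is twice 32 * 4, so the first term is absorbed on the
    left and the rest bounds l^p. *)
Lemma submean_ge1 p h (x0 y0 r I : R) : 1 <= p -> 0 < r ->
  2 * r < 1 - cabs (x0 +i* y0)%C -> analyticD h -> 0 <= I ->
  (\int[leb2]_(x in square x0 y0 r) (cabs (h (toC x)) `^ p)%:E <= I%:E)%E ->
  cabs (h (x0 +i* y0)%C) `^ p <= 256 `^ p / r ^+ 2 * I.
Proof.
move=> p1 r0 hr ah I0 hI; set z0 := (x0 +i* y0)%C.
have r20 : 0 < r ^+ 2 by rewrite exprn_gt0.
have p0 : 0 < p by order_lra.
have [hz|hz] := eqVneq (cabs (h z0)) 0.
  by rewrite hz powR0; [apply: (mulr_ge0 _ I0); apply: divr_ge0; [exact: powR_ge0|exact: ltW]|rewrite gt_eqF].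
have hz0 : 0 < cabs (h z0) by rewrite lt_neqAle eq_sym hz cabs_ge0.
have c0 : 0 < 256 :> R by rewrite ltr0n.
pose l := cabs (h z0) / 256; have l0 : 0 < l by exact: divr_gt0.
have sub := square_sub_disk hr.
have mS := measurable_square x0 y0 r.
have mp : measurable_fun (square x0 y0 r) (fun x => cabs (h (toC x)) `^ p).
  exact: measurable_funS (measurable_diskR2) sub (measurable_cabs_powR p ah).
have bound : (\int[leb2]_(x in square x0 y0 r) (cabs (h (toC x)))%:E <=
    (l * (4 * r ^+ 2) + l `^ (1 - p) * I)%:E)%E.
  apply: (@le_trans _ _ (\int[leb2]_(x in square x0 y0 r)
     (l%:E + (l `^ (1 - p))%:E * (cabs (h (toC x)) `^ p)%:E))%E).
    apply: ge0_le_integral => //.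
    - by move=> x _; rewrite lee_fin cabs_ge0.
    - apply/measurable_EFinP; apply: measurable_funS (measurable_diskR2) sub _.
      by apply: measurable_cabs => z /(analyticD_cont ah).
    - apply: emeasurable_funD => //.
      by apply: measurable_funeM; apply/measurable_EFinP.
    - move=> x _; rewrite -EFinM -EFinD lee_fin.
      by apply: le_powR_split; rewrite ?cabs_ge0.
  rewrite ge0_integralD//; first last.
  - by apply: measurable_funeM; apply/measurable_EFinP.
  - by move=> x _; rewrite -EFinM lee_fin mulr_ge0 ?powR_ge0.
  - by move=> x _; rewrite lee_fin ltW.
  rewrite EFinD; apply: leeD.
    have -> : (\int[leb2]_(x in square x0 y0 r) l%:E = l%:E * leb2 (square x0 y0 r))%E.
      exact: integral_cst.
    by rewrite leb2_square// EFinM.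
  rewrite ge0_integralZl_EFin ?powR_ge0//; first last.
  - by apply/measurable_EFinP.
  - by move=> x _; rewrite lee_fin powR_ge0.
  by rewrite EFinM; apply: lee_wpmul2l => //; rewrite lee_fin powR_ge0.
have := submean1 r0 hr ah bound; rewrite -/z0.
have -> : 32 / r ^+ 2 * (l * (4 * r ^+ 2) + l `^ (1 - p) * I) =
  128 * l + 32 * (l `^ (1 - p) * I / r ^+ 2) by field; order_lra.
have hl : cabs (h z0) = 256 * l by rewrite /l; field.
rewrite hl => H.
have lI : l <= l `^ (1 - p) * I / r ^+ 2 by order_lra.
rewrite (powRM _ (ltW c0) (ltW l0)) -!mulrA (ler_pM2l (powR_gt0 _ c0)) mulrC.
have -> : l `^ p = l `^ (p - 1) * l.
  by rewrite mulrC mulr_powRB1// ltW.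
apply: (@le_trans _ _ (l `^ (p - 1) * (l `^ (1 - p) * I / r ^+ 2))).
  by rewrite ler_wpM2l ?powR_ge0.
rewrite -mulrA; have -> : l `^ (1 - p) = (l `^ (p - 1))^-1 by rewrite -powRN opprB.
by rewrite !mulrA divff ?mul1r 1?mulrC// gt_eqF ?powR_gt0.
Qed.

End SubMeanPower.

(** * Exponents below 1, and the weighted local estimate *)

Section SubMeanSmallPower.
Context {R : realType}.
Notation mu := (@lebesgue_measure R).
Notation leb2 := (@leb2 R).
Implicit Types (h : R[i] -> R[i]).

Lemma subsquare (x0 y0 r x y s : R) : `|x - x0| + s <= r -> `|y - y0| + s <= r ->
  square x y s `<=` square x0 y0 r.
Proof.
move=> hx hy [u v] [/=]; rewrite !in_itv /= => /andP[? ?] /andP[? ?].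
have {}hx : `|x - x0| <= r - s by order_lra.
have {}hy : `|y - y0| <= r - s by order_lra.
move: hx hy; rewrite !ler_norml => /andP[? ?] /andP[? ?].
by split; rewrite /= in_itv /=; apply/andP; split; order_lra.
Qed.

(* For p < 1, maximise |h|^p times the squared distance to the boundary of the square, and
   apply the L^1 estimate on a square around the point. *)
Lemma submean_lt1_step p h (x0 y0 r I M : R) (rho := fun x : R * R =>
    r - Num.max `|x.1 - x0| `|x.2 - y0|) : 0 < p -> p < 1 ->
  2 * r < 1 - cabs (x0 +i* y0)%C -> analyticD h -> 0 <= I -> 0 < M ->
  (\int[leb2]_(x in square x0 y0 r) (cabs (h (toC x)) `^ p)%:E <= I%:E)%E ->
  (forall x, square x0 y0 r x -> rho x ^+ 2 * cabs (h (toC x)) `^ p <= M) ->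
  forall x, square x0 y0 r x ->
    rho x ^+ 2 * cabs (h (toC x)) `^ p <= 4 * 32 `^ p * I `^ p * M `^ (1 - p).
Proof.
move=> p0 p1 hr ah I0 M0 hI hM [x y] xQ.
have sub := square_sub_disk hr.
have [hx hy] : `|x - x0| <= Num.max `|x - x0| `|y - y0| /\
    `|y - y0| <= Num.max `|x - x0| `|y - y0| by rewrite !le_max !lexx orbT.
have RHS0 : 0 <= 4 * 32 `^ p * I `^ p * M `^ (1 - p).
  by rewrite !mulr_ge0 ?powR_ge0.
have rho0 : 0 <= rho (x, y).
  rewrite /rho /= subr_ge0 ge_max !ler_norml.
  by case: xQ => /=; rewrite !in_itv /= => /andP[? ?] /andP[? ?];
    apply/andP; split; apply/andP; split; order_lra.
move: rho0; rewrite le_eqVlt => /predU1P[<-|rho0]; first by rewrite expr0n mul0r.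
(* Half the distance to the boundary: the square of half side s around the point stays inside, and
   [rho] is still at least s on it. *)
pose s := rho (x, y) / 2; have s0 : 0 < s by rewrite divr_gt0.
have rs : Num.max `|x - x0| `|y - y0| = r - 2 * s by rewrite /s /rho /=; field.
rewrite rs in hx hy.
have s20 : 0 < s ^+ 2 by rewrite exprn_gt0.
have subs : square x y s `<=` square x0 y0 r by apply: subsquare; order_lra.
have sD : 2 * s < 1 - cabs (x +i* y)%C.
  have : cabs ((x +i* y)%C - (x0 +i* y0)%C) <= (r - 2 * s) + (r - 2 * s).
    by apply: le_trans (cabs_le_ReIm _) _; apply: lerD.
  have := cabsD ((x +i* y)%C - (x0 +i* y0)%C) (x0 +i* y0)%C; rewrite subrK; order_lra.
(* On that square |h|^p <= M / s^2, hence |h| = |h|^(1-p) |h|^p <= N |h|^p. This turns the integral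
   of |h| needed by [submean1] into the given integral of |h|^p. *)
pose N := (M / s ^+ 2) `^ ((1 - p) / p).
have N0 : 0 <= N by exact: powR_ge0.
have Np : N `^ p = M `^ (1 - p) * (s ^+ 2)^-1 `^ (1 - p).
  rewrite /N -powRrM divfK ?gt_eqF// powRM ?invr_ge0//; exact: ltW.
have hN u : square x y s u -> cabs (h (toC u)) <= N * cabs (h (toC u)) `^ p.
  move=> us; set t := cabs _; have t0 : 0 <= t by exact: cabs_ge0.
  have tp : t `^ p <= M / s ^+ 2.
    rewrite ler_pdivlMr// mulrC; apply: le_trans (hM _ (subs _ us)).
    rewrite ler_wpM2r ?powR_ge0// lerXn2r ?nnegrE//; first exact: ltW.
      have : Num.max `|u.1 - x0| `|u.2 - y0| <= r - s; last by rewrite /rho; order_lra.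
      case: us => /=; rewrite !in_itv /= => /andP[? ?] /andP[? ?].
      move: hx hy; rewrite !ler_norml => /andP[? ?] /andP[? ?].
      by rewrite ge_max !ler_norml; apply/andP; split; apply/andP; split; order_lra.
    have : Num.max `|u.1 - x0| `|u.2 - y0| <= r - s; last by rewrite /rho; order_lra.
    case: us => /=; rewrite !in_itv /= => /andP[? ?] /andP[? ?].
    move: hx hy; rewrite !ler_norml => /andP[? ?] /andP[? ?].
    by rewrite ge_max !ler_norml; apply/andP; split; apply/andP; split; order_lra.
  have tE : t = (t `^ p) `^ ((1 - p) / p) * t `^ p.
    rewrite -powRrM mulrCA divff ?gt_eqF// mulr1.
    by rewrite -powRD subrK ?powRr1// oner_eq0.
  rewrite [leLHS]tE ler_wpM2r ?powR_ge0//; apply: powR_le; rewrite ?powR_ge0//.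
  by rewrite divr_ge0//; order_lra.
have mp : measurable_fun (square x y s) (fun x => cabs (h (toC x)) `^ p).
  apply: measurable_funS (measurable_diskR2) _ (measurable_cabs_powR p ah).
  exact: subset_trans subs sub.
have bound : (\int[leb2]_(u in square x y s) (cabs (h (toC u)))%:E <= (N * I)%:E)%E.
  apply: (@le_trans _ _ (\int[leb2]_(u in square x y s)
      (N%:E * (cabs (h (toC u)) `^ p)%:E))%E).
    apply: ge0_le_integral => //.
    - exact: measurable_square.
    - by move=> u _; rewrite lee_fin cabs_ge0.
    - apply/measurable_EFinP; apply: measurable_funS (measurable_diskR2) (subset_trans subs sub) _.
      by apply: measurable_cabs => z /(analyticD_cont ah).
    - by apply: measurable_funeM; apply/measurable_EFinP.
  rewrite ge0_integralZl_EFin//; first last.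
  - by apply/measurable_EFinP.
  - by move=> u _; rewrite lee_fin powR_ge0.
  - exact: measurable_square.
  rewrite EFinM; apply: lee_wpmul2l; first by rewrite lee_fin.
  apply: le_trans hI; apply: ge0_subset_integral => //.
  - exact: measurable_square.
  - exact: measurable_square.
  - apply/measurable_EFinP.
    exact: measurable_funS (measurable_diskR2) sub (measurable_cabs_powR p ah).
  - by move=> u _; rewrite lee_fin powR_ge0.
have := submean1 s0 sD ah bound; rewrite -/(toC (x, y)) => /(powR_le (ltW p0) (cabs_ge0 _)).
have V0 : 0 <= (s ^+ 2)^-1 by rewrite invr_ge0 ltW.
rewrite powRM ?mulr_ge0// (powRM _ _ V0)// (powRM _ N0)// Np => H.
have -> : rho (x, y) ^+ 2 = 4 * s ^+ 2 by rewrite /s; field.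
apply: (@le_trans _ _ (4 * s ^+ 2 * (32 `^ p * (s ^+ 2)^-1 `^ p *
   (M `^ (1 - p) * (s ^+ 2)^-1 `^ (1 - p) * I `^ p)))).
  by rewrite ler_wpM2l// mulr_ge0// ltW.
have E : (s ^+ 2)^-1 `^ p * (s ^+ 2)^-1 `^ (1 - p) = (s ^+ 2)^-1.
  by rewrite -powRD subrKC ?powRr1// oner_eq0.
rewrite [leLHS](_ : _ = 4 * 32 `^ p * I `^ p * M `^ (1 - p) *
  (s ^+ 2 * ((s ^+ 2)^-1 `^ p * (s ^+ 2)^-1 `^ (1 - p)))); last by ring.
by rewrite E divff ?mulr1// gt_eqF.
Qed.

(** The supremum M of rho^2 |h|^p satisfies M <= K I^p M^(1-p), and M^(1-p) may be cancelled: M is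
    finite by [analytic_square_bounded], and M = 0 is treated apart. At the centre rho = r, which
    gives the bound. *)
Lemma submean_lt1 p h (x0 y0 r I : R) : 0 < p -> p < 1 -> 0 < r ->
  2 * r < 1 - cabs (x0 +i* y0)%C -> analyticD h -> 0 <= I ->
  (\int[leb2]_(x in square x0 y0 r) (cabs (h (toC x)) `^ p)%:E <= I%:E)%E ->
  cabs (h (x0 +i* y0)%C) `^ p <= (4 * 32 `^ p) `^ p^-1 / r ^+ 2 * I.
Proof.
move=> p0 p1 r0 hr ah I0 hI.
have r20 : 0 < r ^+ 2 by rewrite exprn_gt0.
pose rho (x : R * R) := r - Num.max `|x.1 - x0| `|x.2 - y0|.
pose G x := rho x ^+ 2 * cabs (h (toC x)) `^ p.
have z0Q : square x0 y0 r (x0, y0).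
  by split; rewrite /= in_itv /=; apply/andP; split; order_lra.
have Gz0 : G (x0, y0) = r ^+ 2 * cabs (h (x0 +i* y0)%C) `^ p.
  by rewrite /G /rho /= !subrr normr0 maxxx subr0.
have [B B0 hB] := analytic_square_bounded r0 hr ah.
have GB x : square x0 y0 r x -> G x <= r ^+ 2 * B `^ p.
  move=> xQ; have [x1 x2] := xQ.
  have rx : 0 <= rho x <= r.
    have : 0 <= Num.max `|x.1 - x0| `|x.2 - y0| <= r.
      rewrite le_max normr_ge0/= ge_max !ler_norml.
      move: x1 x2; rewrite /= !in_itv /= => /andP[? ?] /andP[? ?].
      by apply/andP; split; apply/andP; split; order_lra.
    by move=> /andP[? ?]; rewrite /rho; apply/andP; split; order_lra.
  move: rx => /andP[rx0 rxr].
  apply: ler_pM; rewrite ?sqr_ge0 ?powR_ge0//; first by rewrite lerXn2r ?nnegrE// ltW.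
  apply: powR_le; rewrite ?cabs_ge0//; first exact: ltW.
  apply: hB; case: x xQ {x1 x2 rx0 rxr} => u v [/=]; rewrite !in_itv /= => hu hv.
  by split.
have hs : has_sup [set G x | x in square x0 y0 r].
  split; first by exists (G (x0, y0)), (x0, y0).
  by exists (r ^+ 2 * B `^ p) => _ [x xQ <-]; exact: GB.
pose M := sup [set G x | x in square x0 y0 r].
have GM x : square x0 y0 r x -> G x <= M.
  by move=> xQ; apply: ub_le_sup; [case: hs|exists x].
have M0 : 0 <= M by apply: le_trans (GM _ z0Q); rewrite Gz0 mulr_ge0 ?powR_ge0// ltW.
suff MI : M <= (4 * 32 `^ p) `^ p^-1 * I.
  rewrite mulrAC ler_pdivlMr// mulrC -Gz0.
  exact: le_trans (GM _ z0Q) MI.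
have [->|Mn0] := eqVneq M 0; first by rewrite mulr_ge0 ?powR_ge0.
have {}M0 : 0 < M by rewrite lt_neqAle eq_sym Mn0.
have MK : M <= 4 * 32 `^ p * I `^ p * M `^ (1 - p).
  apply: ge_sup; first by case: hs.
  by move=> _ [x xQ <-]; exact: (submean_lt1_step p0 p1 hr ah I0 M0 hI GM).
apply: (powR_leV p0 (ltW M0)); first by rewrite mulr_ge0 ?powR_ge0.
rewrite powRM ?powR_ge0// -powRrM mulVf ?gt_eqF// powRr1; last by rewrite mulr_ge0 ?powR_ge0.
rewrite -(ler_pM2r (powR_gt0 (1 - p) M0)) -powRD; last by rewrite (gt_eqF M0) implybT.
by rewrite subrKC powRr1// ltW.
Qed.

Lemma submean_powR p : 0 < p -> exists2 C, 0 < C &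
  forall h (x0 y0 r I : R), 0 < r -> 2 * r < 1 - cabs (x0 +i* y0)%C ->
  analyticD h -> 0 <= I ->
  (\int[leb2]_(x in square x0 y0 r) (cabs (h (toC x)) `^ p)%:E <= I%:E)%E ->
  cabs (h (x0 +i* y0)%C) `^ p <= C / r ^+ 2 * I.
Proof.
move=> p0; have [p1|p1] := leP 1 p.
  exists (256 `^ p); first by apply: powR_gt0; rewrite ltr0n.
  by move=> *; exact: submean_ge1.
exists ((4 * 32 `^ p) `^ p^-1); first by rewrite !powR_gt0// mulr_gt0// powR_gt0.
by move=> *; exact: submean_lt1.
Qed.

Lemma measurable_weight (a : R) :
  measurable_fun (@diskR2 R) (fun x => (1 - cabs (toC x) ^+ 2) `^ a).
Proof.
apply: (measurableT_comp (measurable_powR a)); apply: measurable_funB => //.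
apply: measurable_funX; exact: (measurable_cabs (f := id) (fun z _ => ccont_id z)).
Qed.

Lemma measurable_weighted (a : R) (F : R * R -> R) : measurable_fun (@diskR2 R) F ->
  measurable_fun (@diskR2 R)
    (fun x => (F x * (1 - cabs (toC x) ^+ 2) `^ a / pi)%:E).
Proof.
move=> mF; apply/measurable_EFinP; apply: measurable_funM => //.
by apply: measurable_funM => //; exact: measurable_weight.
Qed.

Lemma square_weight (x0 y0 u v : R) (d := 1 - cabs (x0 +i* y0)%C) : 0 < d ->
  square x0 y0 (d / 4) (u, v) -> d / 2 <= 1 - cabs (u +i* v)%C <= 3 / 2 * d.
Proof.
move=> d0 [/=]; rewrite !in_itv /= => /andP[u1 u2] /andP[v1 v2].
have H : cabs ((u +i* v)%C - (x0 +i* y0)%C) <= d / 4 + d / 4.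
  apply: le_trans (cabs_le_ReIm _) _ => /=.
  by apply: lerD; rewrite ler_norml; apply/andP; split; order_lra.
have := cabs_lerB (u +i* v)%C (x0 +i* y0)%C.
have := cabs_lerB (x0 +i* y0)%C (u +i* v)%C; rewrite cabsBC.
by move: H; rewrite /d => *; apply/andP; split; order_lra.
Qed.

(** On the square the weight is comparable to d^a and the area to d^2, whence the exponent -(a + 2).
    The mass [J] is that of the square alone, not of the disc; the dyadic argument of the borderline
    case relies on this. *)
Lemma growth_local p a : 0 < p -> exists2 C, 0 < C &
  forall h (x0 y0 J : R) (d := 1 - cabs (x0 +i* y0)%C), analyticD h -> 0 < d -> 0 <= J ->
  (\int[leb2]_(x in square x0 y0 (d / 4))
    (cabs (h (toC x)) `^ p * (1 - cabs (toC x) ^+ 2) `^ a / pi)%:E <= J%:E)%E ->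
  cabs (h (x0 +i* y0)%C) `^ p <= C * d `^ (- (a + 2)) * J.
Proof.
move=> p0; have [C C0 hC] := submean_powR p0.
have pi0 : 0 < pi :> R by exact: pi_gt0.
exists (C * 16 * pi * 3 `^ `|a|); first by rewrite !mulr_gt0 ?powR_gt0.
move=> h x0 y0 J d ah d0 J0 hJ.
have r0 : 0 < d / 4 by order_lra.
have hr : 2 * (d / 4) < 1 - cabs (x0 +i* y0)%C by rewrite -/d; order_lra.
have sub := square_sub_disk hr.
have mS := measurable_square x0 y0 (d / 4).
pose K := pi * (3 `^ `|a| * d `^ (- a)).
have K0 : 0 <= K by rewrite !mulr_ge0 ?powR_ge0// ltW.
have mW : measurable_fun (square x0 y0 (d / 4)) (fun x =>
    (cabs (h (toC x)) `^ p * (1 - cabs (toC x) ^+ 2) `^ a / pi)%:E).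
  apply: measurable_funS (measurable_diskR2) sub _.
  by apply: measurable_weighted; exact: measurable_cabs_powR.
have w0 x : (0 <= (cabs (h (toC x)) `^ p * (1 - cabs (toC x) ^+ 2) `^ a / pi)%:E)%E.
  by rewrite lee_fin divr_ge0 ?mulr_ge0 ?powR_ge0// ltW.
have bound : (\int[leb2]_(x in square x0 y0 (d / 4)) (cabs (h (toC x)) `^ p)%:E <=
    (K * J)%:E)%E.
  apply: (@le_trans _ _ (\int[leb2]_(x in square x0 y0 (d / 4)) (K%:E *
      (cabs (h (toC x)) `^ p * (1 - cabs (toC x) ^+ 2) `^ a / pi)%:E))%E).
    apply: ge0_le_integral => //.
    - by move=> x _; rewrite lee_fin powR_ge0.
    - apply/measurable_EFinP.
      exact: measurable_funS (measurable_diskR2) sub (measurable_cabs_powR p ah).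
    - by apply: measurable_funeM.
    - move=> [u v] uS; rewrite -EFinM lee_fin.
      have /andP[t1 t2] := square_weight d0 uS.
      set t := 1 - _ ^+ 2.
      have tE : t = (1 - cabs (u +i* v)%C) * (1 + cabs (u +i* v)%C).
        by rewrite /t /toC /=; ring.
      have c0 := cabs_ge0 (u +i* v)%C.
      have t3 : d / 2 <= t by rewrite tE; rewrite -/d in t1 t2; order_nra.
      have t4 : t <= 3 * d by rewrite tE; rewrite -/d in t1 t2; order_nra.
      have t0 : 0 < t by order_lra.
      have cmp : d `^ a <= 3 `^ `|a| * t `^ a by apply: powR_compare; order_lra.
      rewrite /K (_ : pi * _ * _ = cabs (h (toC (u, v))) `^ p *
        (3 `^ `|a| * t `^ a * d `^ (- a))); last by field; order_lra.
      rewrite ler_peMr ?powR_ge0// powRN ler_pdivlMr ?powR_gt0// mul1r; exact: cmp.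
  rewrite ge0_integralZl_EFin//.
  by rewrite [leRHS]EFinM; apply: lee_wpmul2l.
have := hC h x0 y0 (d / 4) (K * J) r0 hr ah (mulr_ge0 K0 J0) bound.
rewrite opprD powRD; last by rewrite (gt_eqF d0) implybT.
rewrite (_ : d `^ (- 2) = (d ^+ 2)^-1); last by rewrite powRN -powR_mulrn// ltW.
rewrite /K; set X := 3 `^ _; set Y := d `^ _.
congr (_ <= _); field; order_lra.
Qed.

End SubMeanSmallPower.

(** * Pointwise growth in weighted Dirichlet spaces *)

Section Growth.
Context {R : realType}.
Notation mu := (@lebesgue_measure R).
Notation leb2 := (@leb2 R).
Implicit Types (f : R[i] -> R[i]) (z v : R[i]).

Lemma is_derive_eps (u : R -> R) (t m : R) :
  (forall e : R, 0 < e -> exists2 d : R, 0 < d & forall h : R, h != 0 -> `|h| < d ->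
     `|(u (t + h) - u t) / h - m| < e) -> is_derive t 1 u m.
Proof.
move=> H.
have cv : (h^-1 *: ((u \o shift t) (h *: 1) - u t)) @[h --> 0^'] --> m.
  apply/cvgrPdist_lt => e e0; have [d d0 hd] := H _ e0.
  near=> h; rewrite distrC /= /GRing.scale /= mulr1 mulrC addrC -(addrC t).
  rewrite [X in `|X|]addrC; apply: hd.
    by near: h; exact: nbhs_dnbhs_neq.
  by near: h; exact: dnbhs0_lt.
apply: DeriveDef; first by apply/cvg_ex; exists m.
exact: cvg_lim cv.
Unshelve. all: by end_near. Qed.

Lemma is_derive_affine (c k t : R) : is_derive t 1 (fun s : R => c + k * s) k.
Proof.
apply: is_derive_eps => e e0; exists 1 => // h h0 _.
rewrite (_ : _ - _ = 0) ?normr0//; field; exact: h0.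
Qed.

Lemma is_derive_affine_powR (c k e t : R) : 0 < c + k * t ->
  is_derive t 1 (fun s : R => (c + k * s) `^ e) (e * (c + k * t) `^ (e - 1) * k).
Proof.
move=> h; exact: (is_derive1_comp (f := @powR R ^~ e) (g := fun s => c + k * s)
  (is_derive1_powR e h) (is_derive_affine c k t)).
Qed.

Lemma is_derive_affine_ln (c k t : R) : 0 < c + k * t ->
  is_derive t 1 (fun s : R => ln (c + k * s)) ((c + k * t)^-1 * k).
Proof.
move=> h; exact: (is_derive1_comp (f := @ln R) (g := fun s => c + k * s)
  (is_derive1_ln h) (is_derive_affine c k t)).
Qed.

Lemma is_derive_Re_line f z v l c (t : R) : is_cderiv f (z + (t%:C)%C * v) l ->
  is_derive t 1 (fun s : R => complex.Re (c * f (z + (s%:C)%C * v))) (complex.Re (c * (l * v))).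
Proof.
move=> df; pose g w := c * f (z + w * v).
have dg : is_cderiv g (t%:C)%C (c * (l * v)).
  apply: is_cderivZ; apply: (is_cderiv_comp (f := fun w => z + w * v)) => //.
  have := is_cderivD (is_cderiv_cst z (t%:C)%C)
    (is_cderivM (is_cderiv_id (t%:C)%C) (is_cderiv_cst v (t%:C)%C)).
  by rewrite mulr0 addr0 mul1r add0r.
apply: is_derive_eps => e e0; have [d d0 hd] := dg _ e0.
exists d => // h h0 hh.
have hE : ((t + h)%:C)%C - (t%:C)%C = (h%:C)%C by rewrite rmorphD addrAC subrr add0r.
have := hd ((t + h)%:C)%C; rewrite hE cabs_real normr_gt0 h0 hh => /(_ isT).
apply: le_lt_trans; apply: le_trans (cabs_Re _); rewrite le_eqVlt; apply/orP; left.
apply/eqP; congr `|_|; rewrite -/(g _) -/(g _).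
have ReB (a b : R[i]) : complex.Re (a - b) = complex.Re a - complex.Re b.
  by case: a b => [? ?] [? ?].
rewrite ReB; congr (_ - _).
have -> : ((h%:C)%C : R[i])^-1 = ((h^-1)%:C)%C by rewrite fmorphV.
by rewrite [in RHS]mulrC ReM_real ReB mulrC.
Qed.

(** The mean value theorem fails for complex values, so the increment D is first rotated to the real
    axis by [c] and the theorem is applied to [G - u], where u is the real part of c f along the
    segment. A majorant given with its primitive [G] spares integrating the bound. *)
Lemma path_bound f z v (G dG : R -> R) : analyticD f ->
  (forall t : R, 0 <= t <= 1 -> inD (z + (t%:C)%C * v)) ->
  (forall t : R, 0 <= t <= 1 -> is_derive t 1 G (dG t)) ->
  (forall t : R, 0 <= t <= 1 -> cabs (cderiv f (z + (t%:C)%C * v) * v) <= dG t) ->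
  cabs (f (z + v) - f z) <= G 1 - G 0.
Proof.
move=> af inl dG' hG; set D := f (z + v) - f z.
(* For D = 0 the inverse of 0 is 0, so c = 0; this is why only |c| <= 1 is claimed. *)
pose c := (D^*)%C / ((cabs D)%:C)%C.
have c1 : cabs c <= 1.
  rewrite /c cabsM cabsV cabs_conj cabs_real ger0_norm ?cabs_ge0//.
  by have [->|D0] := eqVneq (cabs D) 0; [rewrite mul0r|rewrite divff].
have cD : complex.Re (c * D) = cabs D.
  have [D0|D0] := eqVneq (cabs D) 0.
    by move/eqP: (D0); rewrite cabs_eq0 => /eqP DE; rewrite DE mulr0 cabs0.
  rewrite /c mulrAC (mulrC _ D) mulc_conj -fmorphV -rmorphM /=.
  by rewrite expr2 mulfK.
pose u (s : R) := complex.Re (c * f (z + (s%:C)%C * v)).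
pose du (s : R) := complex.Re (c * (cderiv f (z + (s%:C)%C * v) * v)).
have dU (t : R) : 0 <= t <= 1 -> is_derive t 1 (G - u) (dG t - du t).
  move=> ht; apply: is_deriveB; first exact: dG'.
  by apply: is_derive_Re_line; apply: is_cderivD_cderiv => //; exact: inl.
have [|||t] := @MVT R (G - u) (fun t => dG t - du t) 0 1.
- exact: ltr01.
- by move=> t; rewrite in_itv /= => /andP[? ?]; apply: dU; rewrite !ltW.
- apply: derivable_within_continuous => t; rewrite in_itv /= => /dU dt.
  exact: ex_derive.
rewrite in_itv /= => /andP[t0 t1]; rewrite subr0 mulr1 !fctE => E.
have Re_le (w : R[i]) : complex.Re w <= cabs w by apply: le_trans (ler_norm _) (cabs_Re _).
have : du t <= dG t.
  apply: le_trans (Re_le _) _; rewrite cabsM.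
  apply: le_trans (hG t _); last by rewrite !ltW.
  by rewrite ler_piMl ?cabs_ge0.
have u1 : u 1 - u 0 = cabs D.
  rewrite -cD /D /u rmorph1 mul1r rmorph0 mul0r addr0 mulrBr.
  by case: (c * f (z + v)) (c * f z) => [? ?] [? ?].
order_lra.
Qed.

Lemma normD_le1 (p a : R) f : 0 < p -> (normD p a f <= 1)%E ->
  cabs (f 0) <= 1 /\ (intAb a (fun z => (cabs (cderiv f z) `^ p)%R) <= 1)%E.
Proof.
move=> p0; rewrite /normD; set I := intAb _ _ => H.
have I0 : (0 <= I)%E.
  apply: integral_ge0 => x _; rewrite lee_fin divr_ge0 ?mulr_ge0 ?powR_ge0//.
  exact: pi_ge0.
have X0 : (0 <= (cabs (f 0) `^ p)%:E + I)%E by rewrite adde_ge0// lee_fin powR_ge0.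
have X1 : ((cabs (f 0) `^ p)%:E + I <= 1)%E.
  set X := (_ + _)%E in X0 H *.
  have -> : X = ((X `^ p^-1) `^ p)%E by rewrite -poweRrM mulVf ?gt_eqF// poweRe1.
  rewrite -(poweR1r p).
  by apply: (gt0_ler_poweR (ltW p0)) => //; rewrite in_itv /= ?leey ?andbT// poweR_ge0.
split.
  apply: (powR_leV p0 (cabs_ge0 _) ler01); rewrite powR1 -lee_fin.
  by apply: le_trans X1; rewrite leeDl.
by apply: le_trans X1; rewrite leeDr// lee_fin powR_ge0.
Qed.

Lemma measurable_deriv_weighted (p a : R) f : analyticD f ->
  measurable_fun (@diskR2 R) (fun x =>
    (cabs (cderiv f (toC x)) `^ p * (1 - cabs (toC x) ^+ 2) `^ a / pi)%:E).
Proof.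
move=> af; apply: measurable_weighted; apply: measurable_cabs_powR.
exact: analyticD_cderiv.
Qed.

Lemma growth_deriv (p a : R) : 0 < p -> exists2 C, 0 < C &
  forall f z, analyticD f -> (normD p a f <= 1)%E -> inD z ->
  cabs (cderiv f z) <= C * (1 - cabs z) `^ (- ((a + 2) / p)).
Proof.
move=> p0; have [C C0 hC] := growth_local a p0.
exists (C `^ p^-1) => [|f [x y] af nf zD]; first exact: powR_gt0.
have [_ If] := normD_le1 p0 nf; have d0 := inD_ball_gt0 zD.
set d := 1 - _ in d0 *.
have hr : 2 * (d / 4) < 1 - cabs (x +i* y)%C by rewrite -/d; order_lra.
have sub := square_sub_disk hr.
have := hC (cderiv f) x y 1 (analyticD_cderiv af) d0 ler01.
rewrite mulr1 => H.
have {}H : cabs (cderiv f (x +i* y)%C) `^ p <= C * d `^ (- (a + 2)).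
  apply: H; apply: le_trans If; apply: ge0_subset_integral => //.
  - exact: measurable_square.
  - exact: measurable_diskR2.
  - exact: measurable_deriv_weighted.
  - by move=> u _; rewrite lee_fin divr_ge0 ?mulr_ge0 ?powR_ge0// pi_ge0.
apply: (powR_leV p0 (cabs_ge0 _)); first by rewrite mulr_ge0 ?powR_ge0.
rewrite powRM ?powR_ge0// -!powRrM mulVf ?gt_eqF// powRr1; last exact: ltW.
by rewrite mulNr divfK ?gt_eqF.
Qed.

(** With g = (a + 2)/p different from 1, the radial bound C (1 - t r)^(-g) r has the primitive C/(g
    - 1) (1 - t r)^(1-g). One formula serves both sides of the threshold: the power blows up for g >
    1 and stays bounded for g < 1. *)
Lemma growth_path (p a : R) : 0 < p -> (a + 2) / p != 1 -> exists2 C, 0 < C &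
  forall f z, analyticD f -> (normD p a f <= 1)%E -> inD z ->
  cabs (f z) <= 1 + C * ((1 - cabs z) `^ (1 - (a + 2) / p) - 1) / ((a + 2) / p - 1).
Proof.
move=> p0; set g := _ / p => g1; have [C C0 hC] := growth_deriv a p0.
exists C => // f z af nf zD; have [f0 _] := normD_le1 p0 nf.
set r := cabs z; have r0 : 0 <= r by exact: cabs_ge0.
have r1 : r < 1 by exact: zD.
have tr (t : R) : 0 <= t <= 1 -> 0 < 1 - t * r by move=> /andP[? ?]; order_nra.
have czt (t : R) : 0 <= t <= 1 -> cabs (0 + (t%:C)%C * z) = t * r.
  by move=> /andP[t0 _]; rewrite add0r cabsM cabs_real ger0_norm.
have inl (t : R) : 0 <= t <= 1 -> inD (0 + (t%:C)%C * z).
  by move=> ht; rewrite /inD czt//; have := tr _ ht; order_lra.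
pose G (t : R) := C / (g - 1) * (1 - t * r) `^ (1 - g).
pose dG (t : R) := C * (1 - t * r) `^ (- g) * r.
have := @path_bound f 0 z G dG af inl; rewrite add0r => H.
have {}H : cabs (f z - f 0) <= G 1 - G 0.
  apply: H => t ht.
    have t1 : 0 < 1 + - r * t by rewrite mulNr mulrC; exact: tr.
    have := is_deriveZ (C / (g - 1)) (is_derive_affine_powR (1 - g) t1).
    rewrite (_ : _ *: _ = dG t); last first.
      rewrite /dG /GRing.scale /= (_ : 1 - g - 1 = - g); last by ring.
      rewrite mulNr (mulrC r); field; by rewrite subr_eq0.
    congr (is_derive _ _ _ _); apply/funext => s.
    by rewrite /G /= mulNr (mulrC r).
  rewrite cabsM ler_wpM2r ?cabs_ge0//.
  by apply: le_trans (hC _ _ af nf (inl _ ht)) _; rewrite czt.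
move: H; rewrite /G mul1r mul0r subr0 powR1 -mulrBr.
rewrite (_ : C / (g - 1) * _ = C * ((1 - r) `^ (1 - g) - 1) / (g - 1)); last by ring.
by have := cabs_lerB (f z) (f 0); order_lra.
Qed.

Lemma growth_gt1 (p a : R) : 0 < p -> p < a + 2 -> exists2 C, 0 < C &
  forall f z, analyticD f -> (normD p a f <= 1)%E -> inD z ->
  cabs (f z) <= C * (1 - cabs z) `^ (1 - (a + 2) / p).
Proof.
move=> p0 pa; have g1 : 1 < (a + 2) / p by rewrite ltr_pdivlMr// mul1r.
have [|C C0 hC] := @growth_path p a p0; first by rewrite gt_eqF.
exists (1 + C / ((a + 2) / p - 1)).
  by rewrite addr_gt0// divr_gt0// subr_gt0.
move=> f z af nf zD; apply: le_trans (hC _ _ af nf zD) _.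
set g := _ / p in g1 *; set X := _ `^ _.
have X1 : 1 <= X.
  rewrite -[1](powRr0 (1 - cabs z)); apply: ger_powR; last by order_lra.
  by have := inD_ball_gt0 zD; have := cabs_ge0 z => *; apply/andP; split; order_lra.
rewrite mulrDl mul1r lerD// mulrAC ler_wpM2l//; last by order_lra.
by rewrite divr_ge0 ?ltW// subr_gt0.
Qed.

Lemma growth_lt1 (p a : R) : 0 < p -> a + 2 < p -> exists2 C, 0 < C &
  forall f z, analyticD f -> (normD p a f <= 1)%E -> inD z -> cabs (f z) <= C.
Proof.
move=> p0 pa; have g1 : (a + 2) / p < 1 by rewrite ltr_pdivrMr// mul1r.
have [|C C0 hC] := @growth_path p a p0; first by rewrite lt_eqF.
exists (1 + C / (1 - (a + 2) / p)).
  by rewrite addr_gt0// divr_gt0// subr_gt0.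
move=> f z af nf zD; apply: le_trans (hC _ _ af nf zD) _.
set g := _ / p in g1 *; set X := _ `^ _.
have X0 : 0 <= X by exact: powR_ge0.
rewrite lerD2l -mulrNN -invrN opprB ler_wpM2r ?invr_ge0//; order_nra.
Qed.

End Growth.

(** * The borderline case: logarithmic growth through dyadic annuli *)

Section LogGrowth.
Context {R : realType}.
Notation leb2 := (@leb2 R).
Implicit Types (f : R[i] -> R[i]) (z v : R[i]).

(** The radius is adapted to squares of half side d/4: around a point at distance d from the circle,
    with d between 2^-(k+1) and 2^-k, such a square lies in level k + 3 and misses level k. *)
Definition inner_disk (k : nat) : set (R * R) :=
  @diskR2 R `&` (fun x => cabs (toC x)) @^-1` `]-oo, 1 - 2 / 2 ^+ k].

Lemma measurable_inner_disk k : measurable (inner_disk k).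
Proof.
apply: (measurable_cabs (f := id)) => //; first by move=> z _; exact: ccont_id.
exact: measurable_diskR2.
Qed.

Lemma inner_diskS k : inner_disk k `<=` inner_disk (k + 3)%N.
Proof.
move=> x [xD]; rewrite /inner_disk /= in_itv /= => h; split=> //=; rewrite in_itv /=.
apply: le_trans h _; rewrite lerD2l lerN2 exprD.
have h2 : 0 < 2 ^+ k :> R by rewrite exprn_gt0.
rewrite ler_pdivrMr ?mulr_gt0 ?exprn_gt0// mulrA mulfVK ?gt_eqF//.
by rewrite ler_peMr// exprn_ege1// ler1n.
Qed.

(** The annuli between levels k and k + 3 overlap threefold, so their masses telescope to three
    terms at each end, bounded independently of [m]. *)
Lemma sum_shift3 (S : nat -> R) m : \sum_(k < m) (S (k + 3)%N - S k) =
  S m + S m.+1 + S m.+2 - (S 0%N + S 1%N + S 2).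
Proof.
elim: m => [|m IH]; first by rewrite big_ord0 subrr.
by rewrite big_ord_recr /= IH addn3; ring.
Qed.

Section Chain.
Variables (p a : R) (f : R[i] -> R[i]) (C : R).
Hypotheses (p1 : 1 < p) (pa : p = a + 2) (af : analyticD f) (C0 : 0 < C).
Hypothesis If : (intAb a (fun z => (cabs (cderiv f z) `^ p)%R) <= 1)%E.
Hypothesis hC : forall h (x0 y0 J : R) (d := 1 - cabs (x0 +i* y0)%C), analyticD h -> 0 < d -> 0 <= J ->
  (\int[leb2]_(x in square x0 y0 (d / 4))
    (cabs (h (toC x)) `^ p * (1 - cabs (toC x) ^+ 2) `^ a / pi)%:E <= J%:E)%E ->
  cabs (h (x0 +i* y0)%C) `^ p <= C * d `^ (- (a + 2)) * J.

Let W (x : R * R) := (cabs (cderiv f (toC x)) `^ p * (1 - cabs (toC x) ^+ 2) `^ a / pi)%:E.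

Let W0 x : (0 <= W x)%E.
Proof. by rewrite lee_fin divr_ge0 ?mulr_ge0 ?powR_ge0// pi_ge0. Qed.

Let mW D : D `<=` @diskR2 R -> measurable_fun D W.
Proof.
move=> sD; apply: measurable_funS (measurable_diskR2) sD _.
exact: measurable_deriv_weighted.
Qed.

Let S k := fine (\int[leb2]_(x in inner_disk k) W x).

Let SE k : (\int[leb2]_(x in inner_disk k) W x)%E = (S k)%:E /\ 0 <= S k <= 1.
Proof.
have I1 : (\int[leb2]_(x in inner_disk k) W x <= 1)%E.
  apply: le_trans If; apply: ge0_subset_integral => //.
  - exact: measurable_inner_disk.
  - exact: measurable_diskR2.
  - exact: mW.
  - by move=> x [].
have I0 : (0 <= \int[leb2]_(x in inner_disk k) W x)%E by exact: integral_ge0.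
have fin : (\int[leb2]_(x in inner_disk k) W x)%E \is a fin_num.
  by rewrite ge0_fin_numE//; apply: le_lt_trans I1 _; rewrite ltry.
rewrite /S fineK//; split=> //.
by rewrite -!lee_fin fineK// I0 I1.
Qed.

Let annulus k : (\int[leb2]_(x in inner_disk (k + 3)%N `\` inner_disk k) W x <= (S (k + 3)%N - S k)%:E)%E.
Proof.
have [E1 _] := SE k; have [E2 _] := SE (k + 3)%N.
have m1 := measurable_inner_disk k; have m2 := measurable_inner_disk (k + 3)%N.
have : (\int[leb2]_(x in inner_disk (k + 3)%N) W x = \int[leb2]_(x in inner_disk k) W x +
    \int[leb2]_(x in inner_disk (k + 3)%N `\` inner_disk k) W x)%E.
  rewrite -{1}(setDUK (inner_diskS (k := k))) ge0_integral_setU//.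
  - exact: measurableD.
  - by apply: mW; rewrite setDUK//; [move=> x []|exact: inner_diskS].
  - by rewrite disj_set2E setDIK.
rewrite E1 E2 EFinB => ->.
by rewrite addeAC subee// add0e.
Qed.

(** Because p = a + 2, the local estimate bounds |f'|^p on the segment by C J / h'^p, with J the
    mass of the annulus. The segment has length at most h', so the scale cancels and the mass alone
    controls the increment. *)
Let step zeta k s : cabs zeta = 1 -> 1 - 2 ^- k <= s <= 1 - 2 ^- k.+1 ->
  cabs (f ((s%:C)%C * zeta) - f (((1 - 2 ^- k)%:C)%C * zeta)) `^ p <= C * (S (k + 3)%N - S k).
Proof.
move=> z1; set h := 2 ^- k; set h' := 2 ^- k.+1 => /andP[s1 s2].
have p0 : 0 < p := lt_trans ltr01 p1.
have h0 : 0 < h' by rewrite invr_gt0 exprn_gt0.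
have hh : h = 2 * h' by rewrite /h /h' exprS invfM mulrA divff ?mul1r.
have hle1 : h <= 1 by rewrite /h invf_le1 ?exprn_gt0// exprn_ege1// ler1n.
set J := S (k + 3)%N - S k.
have J0 : 0 <= J.
  rewrite -lee_fin; apply: le_trans (annulus k); exact: integral_ge0.
set t0 := 1 - h; set v := ((s - t0)%:C)%C * zeta.
have vE : ((s%:C)%C * zeta) = ((t0%:C)%C * zeta) + v by rewrite /v -mulrDl -rmorphD subrKC.
have cv : cabs v <= h'.
  rewrite /v cabsM z1 mulr1 cabs_real ger0_norm /t0; lra.
have dE t : 0 <= t <= 1 -> exists2 u : R, t0 <= u <= s & ((t0%:C)%C * zeta) + (t%:C)%C * v = (u%:C)%C * zeta.
  move=> /andP[t1 t2]; exists (t0 + t * (s - t0)); last by rewrite /v mulrA -rmorphM -mulrDl -rmorphD.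
  by rewrite /t0 in s1 *; apply/andP; split; nra.
have cu u : t0 <= u <= s -> 1 - cabs ((u%:C)%C * zeta) = 1 - u.
  move=> /andP[u1 _]; have u0 : 0 <= u by apply: le_trans u1; rewrite subr_ge0.
  by rewrite cabsM z1 mulr1 cabs_real ger0_norm.
pose M := (C * J) `^ p^-1 / h'.
have M0 : 0 <= M by rewrite divr_ge0 ?powR_ge0// ltW.
have dM u : t0 <= u <= s -> cabs (cderiv f ((u%:C)%C * zeta)) <= M.
  move=> hu; have du := cu _ hu; case: ((u%:C)%C * zeta) du => x y du.
  have /andP[u1 u2] := hu; rewrite /t0 in u1.
  have d0 : 0 < 1 - cabs (x +i* y)%C by rewrite du; lra.
  have hr : 2 * ((1 - cabs (x +i* y)%C) / 4) < 1 - cabs (x +i* y)%C by lra.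
  have := hC (analyticD_cderiv af) d0 J0.
  rewrite /= => H.
  have {}H : cabs (cderiv f (x +i* y)%C) `^ p <= C * (1 - cabs (x +i* y)%C) `^ (- (a + 2)) * J.
    apply: H; apply: le_trans (annulus k); apply: ge0_subset_integral => //.
    - exact: measurable_square.
    - by apply: measurableD; exact: measurable_inner_disk.
    - by apply: mW => w [[]].
    - by move=> w _; exact: W0.
    move=> [x' y'] xS; have xD := square_sub_disk hr xS.
    have /andP[w1 w2] := square_weight d0 xS; rewrite du in w1 w2.
    have E3 : 2 / 2 ^+ (k + 3) = h' / 2.
      rewrite /h' exprD (exprS _ k) (_ : (2 : R) ^+ 3 = 8); last by ring.
      by field; rewrite expf_neq0.
    split; first by split=> //=; rewrite in_itv /= E3 /toC /=; lra.
    by move=> [_] /=; rewrite in_itv /= /toC /= -/h; lra.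
  apply: (powR_leV p0 (cabs_ge0 _) M0); apply: le_trans H _.
  rewrite /M powRM ?powR_ge0 ?invr_ge0 ?(ltW h0)// -powRrM mulVf ?gt_eqF// powRr1; last first.
    by rewrite mulr_ge0// ltW.
  rewrite mulrAC ler_wpM2l ?mulr_ge0 ?(ltW C0)//.
  have -> : h'^-1 `^ p = (h' `^ p)^-1.
    by rewrite -{1}(powR_inv1 (ltW h0)) -powRrM mulN1r powRN.
  rewrite -pa powRN lef_pV2 ?posrE ?powR_gt0//.
  by apply: powR_le; rewrite ?(ltW p0) ?(ltW h0)// du; lra.
have H : cabs (f ((s%:C)%C * zeta) - f ((t0%:C)%C * zeta)) <= (C * J) `^ p^-1.
  have -> : (C * J) `^ p^-1 = (0 + M * h' * 1) - (0 + M * h' * 0).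
    by rewrite /M; field; rewrite gt_eqF.
  rewrite vE; apply: (@path_bound R f ((t0%:C)%C * zeta) v
    (fun t => 0 + M * h' * t) (fun=> M * h') af) => t ht.
  - have [u hu ->] := dE _ ht; rewrite /inD.
    by have := cu _ hu; case/andP: hu; lra.
  - exact: is_derive_affine.
  - have [u hu ->] := dE _ ht; rewrite cabsM.
    by apply: ler_pM; rewrite ?cabs_ge0//; exact: dM.
have := powR_le (ltW p0) (cabs_ge0 _) H.
by rewrite -powRrM mulVf ?gt_eqF// powRr1// mulr_ge0// ltW.
Qed.

(** Each dyadic increment is bounded by [le_powR_split] with a common parameter [l]; optimizing [l]
    afterwards has the effect of Hoelder's inequality for the sum of increments. *)
Let chain_sum zeta (l : R) n s : 0 < l -> cabs zeta = 1 ->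
  1 - 2 ^- n <= s <= 1 - 2 ^- n.+1 ->
  cabs (f ((s%:C)%C * zeta) - f 0) <=
  \sum_(k < n.+1) (l + l `^ (1 - p) * (C * (S (k + 3)%N - S k))).
Proof.
move=> l0 z1; elim: n s => [|n IH] s hs.
  have := step z1 hs; rewrite expr0 invr1 subrr ?rmorph0 mul0r big_ord1 /= => H.
  apply: le_trans (le_powR_split (ltW p1) (cabs_ge0 _) l0) _.
  by rewrite lerD2l ler_wpM2l ?powR_ge0.
rewrite big_ord_recr /=; set B := f (((1 - 2 ^- n.+1)%:C)%C * zeta).
rewrite -[X in cabs X](subrKA B) [X in cabs X]addrC; apply: le_trans (cabsD _ _) _; apply: lerD.
  apply: IH; rewrite lexx andbT lerD2l lerN2.
  by rewrite lef_pV2 ?posrE ?exprn_gt0// ler_weXn2l// ler1n.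
apply: le_trans (le_powR_split (ltW p1) (cabs_ge0 _) l0) _.
by rewrite lerD2l ler_wpM2l ?powR_ge0//; exact: step.
Qed.

Lemma chain_bound zeta n s : cabs zeta = 1 -> 1 - 2 ^- n <= s <= 1 - 2 ^- n.+1 ->
  cabs (f ((s%:C)%C * zeta) - f 0) <= (1 + 3 * C) * n.+1%:R `^ (1 - p^-1).
Proof.
move=> z1 hs; pose N : R := n.+1%:R; have N0 : 0 < N by rewrite ltr0n.
have p0 : 0 < p := lt_trans ltr01 p1.
(* This value balances the two sums: N l and l^(1-p) both equal N^(1 - 1/p), and the telescoped
   masses add up to at most 3. *)
pose l := N `^ (- p^-1); have l0 : 0 < l by rewrite powR_gt0.
apply: le_trans (chain_sum l0 z1 hs) _; rewrite -/N.
rewrite big_split /= sumr_const card_ord -mulr_sumr -mulr_sumr sum_shift3.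
have S1 k : 0 <= S k <= 1 by case: (SE k).
have -> : l *+ n.+1 = N `^ (1 - p^-1).
  rewrite -mulr_natl -/N /l -{1}(powRr1 (ltW N0)) -powRD//.
  by rewrite (gt_eqF N0) implybT.
have -> : l `^ (1 - p) = N `^ (1 - p^-1).
  by rewrite /l -powRrM; congr (_ `^ _); field; rewrite gt_eqF.
rewrite mulrDl mul1r lerD2l mulrC ler_wpM2r ?powR_ge0//.
rewrite mulrC; apply: ler_wpM2r; first exact: ltW.
move: (S1 0%N) (S1 1%N) (S1 2) (S1 n.+1) (S1 n.+2) (S1 n.+3).
move: (S 0%N) (S 1%N) (S 2) (S n.+1) (S n.+2) (S n.+3) => s0 s1 s2 s3 s4 s5.
by move=> /andP[? ?] /andP[? ?] /andP[? ?] /andP[? ?] /andP[? ?] /andP[? ?]; lra.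
Qed.

End Chain.

Lemma dyadic_level (r : R) : 0 <= r < 1 -> exists n, 1 - 2 ^- n <= r <= 1 - 2 ^- n.+1.
Proof.
move=> /andP[r0 r1].
have ex : exists n, 2 ^- n < 1 - r.
  have [n] := @dyadic_small R 1 (1 - r) ler01 ltac:(order_lra).
  by rewrite div1r; exists n.
(* The least index with 2^-m < 1 - r is positive because r >= 0; its predecessor is the level
   sought. *)
have [m hm hmin] := ex_minnP ex.
case: m hm hmin => [|m] hm hmin; first by move: hm; rewrite expr0 invr1; order_lra.
exists m; apply/andP; split; last by order_lra.
have := hmin m; rewrite ltnn => h; have {}h : ~~ (2 ^- m < 1 - r) by apply/negP => /h.
by move: h; rewrite -leNgt; order_lra.
Qed.

Lemma growth_log (p a : R) : 1 < p -> p = a + 2 -> exists2 C, 0 < C &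
  forall f z, analyticD f -> (normD p a f <= 1)%E -> inD z ->
  cabs (f z) <= C * ln (2 / (1 - cabs z ^+ 2)) `^ ((p - 1) / p).
Proof.
move=> p1 pa; have p0 : 0 < p by order_lra.
have [C C0 hC] := growth_local a p0.
have l2 : 0 < ln (2 : R) by rewrite ln_gt0// ltr1n.
exists ((2 + 3 * C) * (2 / ln 2) `^ ((p - 1) / p)).
  by rewrite mulr_gt0 ?powR_gt0 ?divr_gt0//; order_lra.
move=> f z af nf zD; have [f0 If] := normD_le1 p0 nf.
set r := cabs z; have r0 : 0 <= r by exact: cabs_ge0.
have r1 : r < 1 by exact: zD.
have [n hn] : exists n, 1 - 2 ^- n <= r <= 1 - 2 ^- n.+1 by apply: dyadic_level; rewrite r0.
have [zeta z1 zE] := polar z.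
have e0 : 0 <= (p - 1) / p by rewrite divr_ge0; order_lra.
have := chain_bound p1 pa af C0 If (fun h x0 y0 J => hC h x0 y0 J) z1 hn.
rewrite -{1}/r -zE => H.
pose N : R := n.+1%:R; have N1 : 1 <= N by rewrite ler1n.
have pe : 1 - p^-1 = (p - 1) / p by field; rewrite gt_eqF.
set L := ln (2 / _).
(* From 2^n <= 1/(1 - r) and 1 + r <= 2 comes 2^(n+1) <= 2 * 2/(1 - r^2). Hence N ln 2 <= ln 2 + L,
   and ln 2 <= L. *)
have NL : N <= 2 / ln 2 * L.
  have D0 : 0 < 1 - r ^+ 2 by order_nra.
  rewrite mulrAC ler_pdivlMr//.
  have -> : N * ln 2 = ln (2 ^+ n.+1) by rewrite lnXn// -[RHS]mulr_natl.
  have A : 2 ^+ n.+1 <= 2 * (2 / (1 - r ^+ 2)).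
    have /andP[h1 _] := hn.
    have q0 : 0 < (2 : R) ^+ n by rewrite exprn_gt0.
    have q1 : 1 - r <= 2 ^- n by order_lra.
    rewrite exprS ler_pM2l// ler_pdivlMr// (mulrC _ (_ - _)).
    have : (1 - r) * 2 ^+ n <= 1 by rewrite -ler_pdivlMr// div1r.
    order_nra.
  have B : 2 <= 2 / (1 - r ^+ 2) by rewrite ler_pdivlMr//; order_nra.
  have B0 : 0 < 2 / (1 - r ^+ 2) by order_lra.
  apply: (@le_trans _ _ (ln (2 * (2 / (1 - r ^+ 2))))).
    by rewrite ler_ln// posrE ?exprn_gt0// mulr_gt0.
  have LE : ln (2 * (2 / (1 - r ^+ 2))) = ln 2 + L by rewrite lnM ?posrE.
  have l2L : ln 2 <= L by rewrite ler_ln ?posrE.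
  by rewrite LE; order_lra.
have N0 : 0 <= N by order_lra.
apply: (@le_trans _ _ ((2 + 3 * C) * N `^ ((p - 1) / p))); last first.
  rewrite -mulrA ler_wpM2l//; first order_lra.
  rewrite -powRM; [|by rewrite divr_ge0// ltW|]; first exact: powR_le.
  by rewrite -(pmulr_rge0 _ (divr_gt0 (@ltr0n R 2) l2)); apply: le_trans NL.
have X1 : 1 <= N `^ ((p - 1) / p).
  by rewrite -[leLHS](powRr0 N) ler_powR.
move: H; rewrite pe -/N; have := cabs_lerB (f z) (f 0).
have -> : (2 + 3 * C) * N `^ ((p - 1) / p) = (1 + 3 * C) * N `^ ((p - 1) / p) + N `^ ((p - 1) / p) by ring.
by order_lra.
Qed.

End LogGrowth.

(** * Forelli-Rudin estimates *)

Section LineKernels.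
Context {R : realType}.
Notation mu := (@lebesgue_measure R).
Implicit Types (a b c e k l r s u x B V xi : R).

(** The integrand may blow up at an end, so the open interval is exhausted by closed ones. On each
    of them the fundamental theorem gives a difference of two values of [Phi], at most M - m. *)
Lemma integral_le_antideriv (phi Phi : R -> R) l r m M : l < r ->
  (forall x, l < x < r -> 0 <= phi x) ->
  (forall x, l < x < r -> is_derive x 1 Phi (phi x)) ->
  (forall x, l < x < r -> {for x, continuous phi}) ->
  (forall x, l < x < r -> m <= Phi x <= M) ->
  (\int[mu]_(x in `]l, r[) (phi x)%:E <= (M - m)%:E)%E.
Proof.
move=> lr phi0 dPhi cphi bPhi.
have mM : m <= M.
  have /bPhi/andP[] : l < (l + r) / 2 < r by apply/andP; split; order_lra.
  exact: le_trans.
have mphi : measurable_fun (`]l, r[ : set R) (EFin \o phi).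
  apply/measurable_EFinP; apply: open_continuous_measurable_fun; first exact: interval_open.
  by move=> x; rewrite inE /= in_itv /= => /cphi.
pose F n : set R := `[l + n.+1%:R^-1, r - n.+1%:R^-1]%classic.
have inv_gt0 n : 0 < n.+1%:R^-1 :> R by rewrite invr_gt0.
have FE : `]l, r[%classic = \bigcup_n F n.
  apply/seteqP; split=> x /=; rewrite in_itv /=.
    move=> /andP[lx xr].
    have e0 : 0 < Num.min (x - l) (r - x) by rewrite lt_min !subr_gt0 lx.
    have [n _ /(_ _ (leqnn n)) h] := @near_infty_natSinv_lt R (PosNum e0).
    exists n => //; rewrite /F /= in_itv /=; move: h; rewrite /= lt_min.
    by move: (n.+1%:R^-1) => e /andP[h1 h2]; apply/andP; split; order_lra.
  move=> [n _]; rewrite /F /= in_itv /=; have := inv_gt0 n.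
  by move: (n.+1%:R^-1) => e h3 /andP[h1 h2]; apply/andP; split; order_lra.
have Fsub n : F n `<=` `]l, r[%classic by rewrite FE; exact: bigcup_sup.
rewrite FE; apply: (@cvge_le _ _ eventually_filter _ (fun n => \int[mu]_(x in F n) (phi x)%:E)%E); last first.
  apply: ge0_nondecreasing_set_cvg_integral.
  - move=> i j ij; apply/subsetPset => x; rewrite /F /= !in_itv /= => /andP[h1 h2].
    have : j.+1%:R^-1 <= i.+1%:R^-1 :> R by rewrite lef_pV2 ?posrE// ler_nat.
    move: (j.+1%:R^-1) (i.+1%:R^-1) h1 h2 => e e' h1 h2 h.
    by apply/andP; split; order_lra.
  - by move=> i; exact: measurable_itv.
  - by move=> i; apply: measurable_funS mphi => //; exact: measurable_itv.
  - move=> i x /Fsub /=; rewrite in_itv /= => h; rewrite lee_fin; exact: phi0.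
apply: nearW => n; rewrite /F.
set p := l + _; set q := r - _.
have hpq x : p <= x <= q -> l < x < r.
  rewrite /p /q; have := inv_gt0 n; move: (n.+1%:R^-1) => e h /andP[h1 h2].
  by apply/andP; split; order_lra.
have [pq|pq|pq] := ltgtP p q.
- have cPhi x : p <= x <= q -> {for x, continuous Phi}.
    move=> /hpq/dPhi dx; apply: differentiable_continuous.
    by apply/derivable1_diffP; exact: ex_derive.
  have -> : (\int[mu]_(x in `[p, q]) (phi x)%:E = (Phi q)%:E - (Phi p)%:E)%E.
    apply: continuous_FTC2 => //.
    + apply: continuous_in_subspaceT => x; rewrite inE /= in_itv /= => /hpq; exact: cphi.
    + split.
      * move=> x; rewrite in_itv /= => /andP[h1 h2].
        have /dPhi dx : l < x < r by apply: hpq; rewrite !ltW.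
        exact: ex_derive.
      * by apply: cvg_at_right_filter; apply: cPhi; rewrite lexx ltW.
      * by apply: cvg_at_left_filter; apply: cPhi; rewrite lexx ltW.
    + move=> x; rewrite in_itv /= => /andP[h1 h2].
      have /dPhi dx : l < x < r by apply: hpq; rewrite !ltW.
      by rewrite derive1E derive_val.
  rewrite -EFinB lee_fin.
  have /bPhi/andP[? ?] : l < p < r by apply: hpq; rewrite lexx ltW.
  have /bPhi/andP[? ?] : l < q < r by apply: hpq; rewrite lexx ltW.
  order_lra.
- by rewrite set_itv_ge ?integral_set0 ?lee_fin ?subr_ge0// bnd_simp -ltNge.
- by rewrite pq set_itv1 integral_set1 lee_fin subr_ge0.
Qed.

Lemma continuous_affine_powR c k e x : 0 < c + k * x ->
  {for x, continuous (fun x => (c + k * x) `^ e)}.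
Proof.
move=> h; apply: differentiable_continuous; apply/derivable1_diffP.
by have dh := is_derive_affine_powR e h; exact: ex_derive.
Qed.

(** The condition [k ^+ 2 = 1] encodes k = 1 or k = -1, covering a singularity at either end. The
    primitive is a constant times a nonnegative power, so it lies between 0 and that constant times
    V; the sign of the constant gives the two cases. *)
Lemma int_affine_powR c k e l r V : k ^+ 2 = 1 -> e + 1 != 0 -> l < r ->
  (forall x, l < x < r -> 0 < c + k * x) ->
  (forall x, l < x < r -> (c + k * x) `^ (e + 1) <= V) ->
  (\int[mu]_(x in `]l, r[) ((c + k * x) `^ e)%:E <= (V / `|e + 1|)%:E)%E.
Proof.
move=> k2 e0 lr pos hV.
have k0 : k != 0 by apply/eqP => k0; move: k2; rewrite k0 expr0n /= => /eqP; rewrite eq_sym oner_eq0.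
have V0 : 0 <= V.
  have /hV : l < (l + r) / 2 < r by apply/andP; split; order_lra.
  by apply: le_trans; exact: powR_ge0.
pose C := (k * (e + 1))^-1; pose Phi x := C * (c + k * x) `^ (e + 1).
have aC : `|C| = `|e + 1|^-1.
  rewrite normfV normrM (_ : `|k| = 1) ?mul1r//; apply/eqP.
  by rewrite -sqr_norm_eq1 k2.
have dPhi x : l < x < r -> is_derive x 1 Phi ((c + k * x) `^ e).
  move=> /pos hx; have := is_deriveZ C (is_derive_affine_powR (e + 1) hx).
  rewrite (_ : _ *: _ = (c + k * x) `^ e)//.
  rewrite /GRing.scale /= /C addrK; field; by rewrite k0 e0.
have phi0 x : l < x < r -> 0 <= (c + k * x) `^ e by move=> _; exact: powR_ge0.
have cphi x : l < x < r -> {for x, continuous (fun x => (c + k * x) `^ e)}.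
  by move=> /pos; exact: continuous_affine_powR.
have [C0|C0] := leP 0 C.
  rewrite -aC ger0_norm// (_ : V * C = C * V - 0); last by ring.
  apply: (integral_le_antideriv lr phi0 dPhi cphi) => x hx.
  by rewrite /Phi mulr_ge0 ?powR_ge0//= ler_wpM2l//; exact: hV.
rewrite -aC ltr0_norm// (_ : V * - C = 0 - C * V); last by ring.
apply: (integral_le_antideriv lr phi0 dPhi cphi) => x hx.
rewrite /Phi; have := hV _ hx; have := powR_ge0 (c + k * x) (e + 1) => h1 h2.
by apply/andP; split; order_nra.
Qed.

Lemma int_affine_inv c k l r V1 V2 : k ^+ 2 = 1 -> l < r -> 0 < V1 ->
  (forall x, l < x < r -> V1 <= c + k * x <= V2) ->
  (\int[mu]_(x in `]l, r[) ((c + k * x) `^ (-1))%:E <= (ln V2 - ln V1)%:E)%E.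
Proof.
move=> k2 lr V10 hV.
have pos x : l < x < r -> 0 < c + k * x by move=> /hV/andP[h _]; order_lra.
have V20 : 0 < V2.
  have /hV/andP[] : l < (l + r) / 2 < r by apply/andP; split; order_lra.
  order_lra.
pose Phi x := k * ln (c + k * x).
have dPhi x : l < x < r -> is_derive x 1 Phi ((c + k * x) `^ (-1)).
  move=> /pos hx; have := is_deriveZ k (is_derive_affine_ln hx).
  rewrite (_ : _ *: _ = (c + k * x) `^ (-1))//.
  by rewrite /GRing.scale /= mulrCA -expr2 k2 mulr1 powR_inv1// ltW.
have phi0 x : l < x < r -> 0 <= (c + k * x) `^ (-1) by move=> _; exact: powR_ge0.
have cphi x : l < x < r -> {for x, continuous (fun x => (c + k * x) `^ (-1))}.
  by move=> /pos; exact: continuous_affine_powR.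
have lnV x : l < x < r -> ln V1 <= ln (c + k * x) <= ln V2.
  move=> hx; have /andP[h1 h2] := hV _ hx; have h3 := pos _ hx.
  by rewrite !ler_ln ?posrE// h1.
have [k0|k0] := leP 0 k.
  have k1 : k = 1 by apply/eqP; rewrite -(@eqrXn2 _ 2)// k2 expr1n.
  apply: (integral_le_antideriv lr phi0 dPhi cphi) => x hx.
  by have := lnV _ hx; rewrite /Phi k1 !mul1r.
have k1 : k = -1.
  by apply/eqP; rewrite -eqr_oppLR -(@eqrXn2 _ 2)// ?sqrrN ?k2 ?expr1n// oppr_ge0 ltW.
rewrite (_ : ln V2 - ln V1 = - ln V1 - - ln V2); last by ring.
apply: (integral_le_antideriv lr phi0 dPhi cphi) => x hx.
have /andP[h1 h2] := lnV _ hx; rewrite /Phi k1 in h1 h2 *.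
by apply/andP; split; order_lra.
Qed.

Definition line_kernel s B xi x : R := (B + `|x - xi|) `^ (- s).

Lemma measurable_line_kernel s B xi : measurable_fun setT (line_kernel s B xi).
Proof.
apply: (measurableT_comp (measurable_powR (- s))); apply: measurable_funD => //.
by apply: measurableT_comp => //; exact: measurable_funB.
Qed.

(** Cutting at the peak [xi] removes the absolute value. Since [-1, 1] lies in (xi - 3, xi + 3),
    both halves become affine powers on intervals of fixed length. *)
Lemma kernel_split s B xi V : 0 < B -> -1 <= xi <= 1 ->
  (\int[mu]_(x in `]xi, (xi + 3)%R[) (((B - xi) + 1 * x) `^ (- s))%:E <= V%:E)%E ->
  (\int[mu]_(x in `](xi - 3)%R, xi[) (((B + xi) + -1 * x) `^ (- s))%:E <= V%:E)%E ->
  (\int[mu]_(x in `[(-1)%R, 1%R]) (line_kernel s B xi x)%:E <= (2 * V)%:E)%E.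
Proof.
move=> B0 /andP[x1 x2] I1 I2.
have mk D : measurable_fun D (EFin \o line_kernel s B xi).
  by apply/measurable_EFinP; apply: measurable_funTS; exact: measurable_line_kernel.
have k0 x : (0 <= (line_kernel s B xi x)%:E)%E by rewrite lee_fin powR_ge0.
apply: (@le_trans _ _ (\int[mu]_(x in `](xi - 3)%R, xi[ `|` `[xi, (xi + 3)%R[) (line_kernel s B xi x)%:E)%E).
  apply: ge0_subset_integral => //; first exact: measurableU.
    exact: mk.
  move=> x; rewrite /= ?in_itv /= => /andP[h1 h2].
  by have [h|h] := ltP x xi; [left|right]; rewrite /= ?andbT; order_lra.
rewrite ge0_integral_setU//; first last.
- by apply/disj_setPS => x [] /=; rewrite !in_itv /= => /andP[_ h1] /andP[h2 _]; order_lra.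
- exact: mk.
rewrite mulr_natl mulr2n EFinD; apply: leeD.
  apply: le_trans I2; rewrite le_eqVlt; apply/orP; left; apply/eqP.
  apply: eq_integral => x; rewrite inE /= in_itv /= => /andP[_ h].
  by congr EFin; rewrite /line_kernel ltr0_norm ?subr_lt0//; congr (_ `^ _); ring.
rewrite -(@integral_itv_obnd_cbnd R xi (BLeft (xi + 3)) (fun x => (line_kernel s B xi x)%:E)).
2: exact: mk.
apply: le_trans I1; rewrite le_eqVlt; apply/orP; left; apply/eqP.
apply: eq_integral => x; rewrite inE /= in_itv /= => /andP[h _].
by congr EFin; rewrite /line_kernel gtr0_norm ?subr_gt0//; congr (_ `^ _); ring.
Qed.

Lemma kernel_int s B xi : 1 < s -> 0 < B -> -1 <= xi <= 1 ->
  (\int[mu]_(x in `[(-1)%R, 1%R]) (line_kernel s B xi x)%:E <= (2 * (B `^ (1 - s) / (s - 1)))%:E)%E.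
Proof.
move=> s1 B0 hxi.
have sE : s - 1 = `|- s + 1| by rewrite ltr0_norm; order_lra.
have s0 : - s + 1 != 0 by rewrite lt_eqF//; order_lra.
have s2 : - s + 1 <= 0 by order_lra.
rewrite sE (addrC 1); apply: kernel_split => //; apply: int_affine_powR => //.
- by rewrite expr1n.
- order_lra.
- by move=> x /andP[? ?]; order_lra.
- by move=> x /andP[? ?]; apply: powR_geN; order_lra.
- by rewrite sqrrN expr1n.
- order_lra.
- by move=> x /andP[? ?]; order_lra.
- by move=> x /andP[? ?]; apply: powR_geN; order_lra.
Qed.

Lemma kernel_int1 B xi : 0 < B -> -1 <= xi <= 1 ->
  (\int[mu]_(x in `[(-1)%R, 1%R]) (line_kernel 1 B xi x)%:E <= (2 * (ln (B + 3) - ln B))%:E)%E.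
Proof.
move=> B0 hxi; apply: kernel_split => //; apply: int_affine_inv => //.
- by rewrite expr1n.
- order_lra.
- by move=> x /andP[? ?]; apply/andP; split; order_lra.
- by rewrite sqrrN expr1n.
- order_lra.
- by move=> x /andP[? ?]; apply/andP; split; order_lra.
Qed.

End LineKernels.

(** * Weighted kernel integrals along a chord *)

Section ForelliRudin.
Context {R : realType}.
Notation mu := (@lebesgue_measure R).
Notation leb2 := (@leb2 R).
Implicit Types (a c d s u x y B X xi eta : R).

Lemma measurable_affine_powR c k e D :
  measurable_fun D (fun x : R => (c + k * x) `^ e).
Proof.
apply: measurable_funTS; apply: (measurableT_comp (measurable_powR e)).
by apply: measurable_funD => //; exact: measurable_funM.
Qed.

(** The peak of the kernel may lie near an end of the chord, where the weight is singular, so the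
    chord is split by the distance t to its ends. Where t >= B the weight is at most B^a and the
    kernel integrates to order B^(1-s); where t < B the kernel is at most B^(-s) and the weight
    integrates to order B^(a+1). Both products have order B^(a+1-s). *)
Lemma inner_int s a B X xi (f : R -> \bar R) : -1 < a -> a <= 0 -> 1 < s ->
  0 < B -> -1 <= xi <= 1 -> 0 < X <= 1 -> measurable_fun setT f ->
  (forall x, (0 <= f x)%E) ->
  (forall x, `|x| < X -> (f x <= (line_kernel s B xi x * (X - `|x|) `^ a)%:E)%E) ->
  (forall x, X <= `|x| -> (f x <= 0)%E) ->
  (\int[mu]_x f x <= ((2 / (s - 1) + 2 / (a + 1)) * B `^ (a + 1 - s))%:E)%E.
Proof.
move=> a1 a0 s1 B0 hxi /andP[X0 X1] mf f0 fin fout.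
pose g1 := (EFin \o line_kernel s B xi) \_ `[(-1), 1].
pose g2 := (fun x => ((X + -1 * x) `^ a)%:E) \_ `](X - B), X[.
pose g3 := (fun x => ((X + 1 * x) `^ a)%:E) \_ `](- X), (B - X)[.
have g10 x : (0 <= g1 x)%E by rewrite /g1 patchE; case: ifP => // _; rewrite lee_fin powR_ge0.
have g20 x : (0 <= g2 x)%E by rewrite /g2 patchE; case: ifP => // _; rewrite lee_fin powR_ge0.
have g30 x : (0 <= g3 x)%E by rewrite /g3 patchE; case: ifP => // _; rewrite lee_fin powR_ge0.
have m1 : measurable_fun [set: R] g1.
  apply: (measurable_restrictT _ _).1 => //; apply/measurable_EFinP.
  by apply: measurable_funTS; exact: measurable_line_kernel.
have m2 : measurable_fun [set: R] g2.
  apply: (measurable_restrictT _ _).1 => //; apply/measurable_EFinP.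
  exact: measurable_affine_powR.
have m3 : measurable_fun [set: R] g3.
  apply: (measurable_restrictT _ _).1 => //; apply/measurable_EFinP.
  exact: measurable_affine_powR.
have Ba0 : 0 <= B `^ a by exact: powR_ge0.
have Bs0 : 0 <= B `^ (- s) by exact: powR_ge0.
pose G x := ((B `^ a)%:E * g1 x + (B `^ (- s))%:E * (g2 x + g3 x))%E.
have fG x : (f x <= G x)%E.
  have [xX|xX] := ltP `|x| X; last first.
    apply: le_trans (fout _ xX) _.
    by rewrite /G adde_ge0// mule_ge0// ?lee_fin// adde_ge0.
  apply: le_trans (fin _ xX) _; set t := X - `|x|.
  have t0 : 0 < t by rewrite subr_gt0.
  have k0 : 0 <= line_kernel s B xi x by exact: powR_ge0.
  have [Bt|tB] := leP B t.
    apply: (@le_trans _ _ ((B `^ a)%:E * g1 x)%E); last first.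
      by rewrite /G leeDl// mule_ge0// ?lee_fin// adde_ge0.
    have -> : g1 x = (line_kernel s B xi x)%:E.
      rewrite /g1 patchE mem_set//= in_itv /=.
      by move: xX; rewrite ltr_norml => /andP[? ?]; apply/andP; split; order_lra.
    by rewrite -EFinM lee_fin mulrC ler_wpM2r//; exact: powR_geN.
  have kB : line_kernel s B xi x <= B `^ (- s).
    by apply: powR_geN => //; [order_lra|rewrite lerDl].
  apply: (@le_trans _ _ ((B `^ (- s))%:E * (g2 x + g3 x))%E); last first.
    by rewrite /G leeDr// mule_ge0// lee_fin.
  apply: (@le_trans _ _ ((B `^ (- s))%:E * (t `^ a)%:E)%E).
    by rewrite -EFinM lee_fin ler_wpM2r ?powR_ge0.
  apply: lee_wpmul2l; first by rewrite lee_fin.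
  have [x0|x0] := leP 0 x.
    have tE : t = X - x by rewrite /t ger0_norm.
    apply: (@le_trans _ _ (g2 x)); last by rewrite leeDl.
    rewrite /g2 patchE mem_set; last by rewrite /= in_itv /=; apply/andP; split; order_lra.
    by rewrite lee_fin tE mulN1r.
  have tE : t = X + x by rewrite /t ltr0_norm ?opprK.
  apply: (@le_trans _ _ (g3 x)); last by rewrite leeDr.
  rewrite /g3 patchE mem_set; last by rewrite /= in_itv /=; apply/andP; split; order_lra.
  by rewrite lee_fin tE mul1r.
have mG : measurable_fun [set: R] G.
  apply: emeasurable_funD; apply: measurable_funeM => //; exact: emeasurable_funD.
have s10 : 0 < s - 1 by order_lra.
have a10 : 0 < a + 1 by order_lra.
apply: (@le_trans _ _ (\int[mu]_x G x)%E); first exact: ge0_le_integral.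
rewrite /G ge0_integralD//; first last.
- by apply: measurable_funeM; exact: emeasurable_funD.
- by move=> x _; rewrite mule_ge0 ?lee_fin// adde_ge0.
- exact: measurable_funeM.
- by move=> x _; rewrite mule_ge0 ?lee_fin.
rewrite ge0_integralZl_EFin//.
rewrite ge0_integralZl_EFin//; first last.
- exact: emeasurable_funD.
- by move=> x _; rewrite adde_ge0.
rewrite ge0_integralD//.
have I1 : (\int[mu]_x g1 x <= (2 * (B `^ (1 - s) / (s - 1)))%:E)%E.
  by rewrite /g1 -integral_mkcond; exact: kernel_int.
have aE : `|a + 1| = a + 1 by rewrite gtr0_norm.
have I2 : (\int[mu]_x g2 x <= (B `^ (a + 1) / (a + 1))%:E)%E.
  rewrite /g2 -integral_mkcond -{2}aE; apply: int_affine_powR.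
  - by rewrite sqrrN expr1n.
  - by rewrite gt_eqF.
  - order_lra.
  - by move=> x /andP[? ?]; order_lra.
  - by move=> x /andP[? ?]; apply: powR_le; order_lra.
have I3 : (\int[mu]_x g3 x <= (B `^ (a + 1) / (a + 1))%:E)%E.
  rewrite /g3 -integral_mkcond -{2}aE; apply: int_affine_powR.
  - by rewrite expr1n.
  - by rewrite gt_eqF.
  - order_lra.
  - by move=> x /andP[? ?]; order_lra.
  - by move=> x /andP[? ?]; apply: powR_le; order_lra.
apply: (@le_trans _ _ ((B `^ a)%:E * (2 * (B `^ (1 - s) / (s - 1)))%:E +
  (B `^ (- s))%:E * ((B `^ (a + 1) / (a + 1))%:E + (B `^ (a + 1) / (a + 1))%:E))%E).
  by apply: leeD; apply: lee_wpmul2l;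
    [rewrite lee_fin powR_ge0|exact: I1|rewrite lee_fin powR_ge0|exact: leeD I2 I3].
rewrite -[leLHS]/((B `^ a * (2 * (B `^ (1 - s) / (s - 1))) +
  B `^ (- s) * (B `^ (a + 1) / (a + 1) + B `^ (a + 1) / (a + 1)))%:E) lee_fin.
have E1 : B `^ (a + 1 - s) = B `^ a * B `^ (1 - s).
  by rewrite -powRD ?addrA// (gt_eqF B0) implybT.
have E2 : B `^ (a + 1 - s) = B `^ (- s) * B `^ (a + 1).
  by rewrite -powRD 1?addrC// (gt_eqF B0) implybT.
have -> : (2 / (s - 1) + 2 / (a + 1)) * B `^ (a + 1 - s) =
  2 / (s - 1) * (B `^ a * B `^ (1 - s)) + 2 / (a + 1) * (B `^ (- s) * B `^ (a + 1)).
  by rewrite -E1 -E2; ring.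
by rewrite le_eqVlt; apply/orP; left; apply/eqP; field; rewrite !gt_eqF.
Qed.

Definition plane_kernel s a d xi eta (x y : R) : R :=
  (d + `|x - xi| + `|y - eta|) `^ (- s) * (1 - (x ^+ 2 + y ^+ 2)) `^ a.

(** At height |y| <= 4/5 the half chord X is at least 3/5, so 1 - x^2 - y^2 = (X - |x|)(X + |x|) is
    at least 3/5 of X - |x|, and a <= 0 reverses this for the weights. [inner_int] with B = d + |y -
    eta| then yields a line kernel in y. *)
Lemma slice_int s a d xi eta y (f : R -> \bar R) : -1 < a -> a <= 0 -> 1 < s ->
  0 < d -> -1 <= xi <= 1 -> `|y| <= 4 / 5 -> measurable_fun setT f ->
  (forall x, (0 <= f x)%E) ->
  (forall x, x ^+ 2 + y ^+ 2 < 1 -> (f x <= (plane_kernel s a d xi eta x y)%:E)%E) ->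
  (forall x, 1 <= x ^+ 2 + y ^+ 2 -> (f x <= 0)%E) ->
  (\int[mu]_x f x <= ((3 / 5) `^ a * (2 / (s - 1) + 2 / (a + 1)) *
     line_kernel (s - a - 1) d eta y)%:E)%E.
Proof.
move=> a1 a0 s1 d0 hxi hy mf f0 fin fout.
have y2 : y ^+ 2 <= 16 / 25.
  move: hy; rewrite ler_norml => /andP[? ?].
  by have := @ler_pM2l R; order_nra.
pose X := Num.sqrt (1 - y ^+ 2).
have X2 : X ^+ 2 = 1 - y ^+ 2 by rewrite sqr_sqrtr//; order_lra.
have Xge0 : 0 <= X by exact: sqrtr_ge0.
have X35 : 3 / 5 <= X by rewrite -(@ler_pXn2r _ 2) ?nnegrE// X2; order_lra.
have X1 : X <= 1 by rewrite -(@ler_pXn2r _ 2) ?nnegrE// X2 expr1n; have := sqr_ge0 y; order_lra.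
have q0 : 0 < (3 / 5 : R) `^ a by rewrite powR_gt0.
have x2 x : `|x| ^+ 2 = x ^+ 2 by rewrite real_normK ?num_real.
have disk x : (x ^+ 2 + y ^+ 2 < 1) = (`|x| < X).
  have -> : (`|x| < X) = (`|x| ^+ 2 < X ^+ 2) by rewrite ltr_pXn2r ?nnegrE.
  by rewrite X2 x2; apply/idP/idP; order_lra.
have B0 : 0 < d + `|y - eta| by have := normr_ge0 (y - eta); order_lra.
have := @inner_int s a (d + `|y - eta|) X xi (fun x => ((3 / 5) `^ a)^-1%:E * f x)%E a1 a0 s1 B0 hxi.
have -> : 0 < X <= 1 by rewrite X1 andbT; order_lra.
move=> /(_ isT) H.
have {}H : (\int[mu]_x (((3 / 5) `^ a)^-1%:E * f x) <=
    ((2 / (s - 1) + 2 / (a + 1)) * (d + `|y - eta|) `^ (a + 1 - s))%:E)%E.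
  apply: H.
  - exact: measurable_funeM.
  - by move=> x; rewrite mule_ge0// lee_fin invr_ge0 ltW.
  - move=> x xX; have := fin x; rewrite disk xX => /(_ isT) fx.
    apply: (@le_trans _ _ (((3 / 5) `^ a)^-1%:E * (plane_kernel s a d xi eta x y)%:E)%E).
      by apply: lee_wpmul2l => //; rewrite lee_fin invr_ge0 ltW.
    rewrite -EFinM lee_fin ler_pdivrMl// /plane_kernel /line_kernel mulrCA.
    rewrite (addrAC d) ler_wpM2l ?powR_ge0//.
    have t0 : 0 < X - `|x| by rewrite subr_gt0.
    have h35 : 0 <= (3 / 5 : R) by order_lra.
    rewrite -powRM ?(ltW t0)//.
    have n0 := normr_ge0 x.
    apply: powR_geN => //; first by apply: mulr_gt0 => //; order_lra.
    rewrite (_ : 1 - _ = (X - `|x|) * (X + `|x|)); last first.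
      by rewrite -subr_sqr X2 x2; ring.
    order_nra.
  - move=> x xX; have : (f x <= 0)%E.
      by apply: fout; rewrite leNgt disk -leNgt.
    by move=> fx; rewrite mule_ge0_le0// lee_fin invr_ge0 ltW.
have E : (\int[mu]_x (((3 / 5) `^ a)^-1%:E * f x) = ((3 / 5) `^ a)^-1%:E * \int[mu]_x f x)%E.
  by apply: ge0_integralZl_EFin => //; rewrite invr_ge0 ltW.
move: H; rewrite E lee_pdivrMl// -EFinM.
rewrite /line_kernel (_ : - (s - a - 1) = a + 1 - s); last by ring.
by rewrite mulrA.
Qed.

End ForelliRudin.

(** * From chords to the disc *)

Section DiskIntegral.
Context {R : realType}.
Notation mu := (@lebesgue_measure R).
Notation leb2 := (@leb2 R).
Implicit Types (a c d s u x y xi eta U : R).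

Lemma diskR2E (x : R * R) : diskR2 x <-> x.1 ^+ 2 + x.2 ^+ 2 < 1.
Proof.
rewrite /diskR2 /= /inD -(@ltr_pXn2r _ 2) ?nnegrE ?cabs_ge0// expr1n cabs_sqr.
by case: x.
Qed.

Lemma measurable_plane_kernel s a d xi eta D :
  measurable_fun D (fun x : R * R => plane_kernel s a d xi eta x.1 x.2).
Proof.
apply: measurable_funTS; apply: measurable_funM.
  apply: (measurableT_comp (measurable_powR (- s))).
  apply: measurable_funD; first apply: measurable_funD => //.
    apply: measurableT_comp => //.
    by apply: measurable_funB => //; exact: measurable_fst.
  apply: measurableT_comp => //.
  by apply: measurable_funB => //; exact: measurable_snd.
apply: (measurableT_comp (measurable_powR a)); apply: measurable_funB => //.
apply: measurable_funD; apply: measurable_funX; [exact: measurable_fst|exact: measurable_snd].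
Qed.

(** Since 2 (4/5)^2 > 1, every point of the disc has a coordinate of modulus at most 4/5; using both
    horizontal and vertical slices avoids the short chords. The last line integral stays a
    hypothesis on [U], so that the power and the logarithmic estimates share this proof. *)
Lemma disk_int s a : -1 < a -> a <= 0 -> 1 < s -> exists2 C, 0 < C &
  forall xi eta d U, -1 <= xi <= 1 -> -1 <= eta <= 1 -> 0 < d ->
  (forall t, -1 <= t <= 1 ->
    (\int[mu]_(y in `[(-1)%R, 1%R]) (line_kernel (s - a - 1) d t y)%:E <= U%:E)%E) ->
  (\int[leb2]_(x in @diskR2 R) (plane_kernel s a d xi eta x.1 x.2)%:E <= (C * U)%:E)%E.
Proof.
move=> a1 a0 s1; pose K := (3 / 5) `^ a * (2 / (s - 1) + 2 / (a + 1)).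
have K0 : 0 < K.
  by rewrite mulr_gt0 ?powR_gt0// ?addr_gt0 ?divr_gt0//; order_lra.
exists (K + K) => [|xi eta d U hxi heta d0 hU]; first order_lra.
pose k (x : R * R) := (plane_kernel s a d xi eta x.1 x.2)%:E.
have k0 (x : R * R) : (0 <= k x)%E by rewrite lee_fin mulr_ge0 ?powR_ge0.
have mk D : measurable_fun D k by apply/measurable_EFinP; exact: measurable_plane_kernel.
pose D1 := @diskR2 R `&` snd @^-1` `[(- (4 / 5))%R, (4 / 5)%R].
pose D2 := @diskR2 R `&` fst @^-1` `[(- (4 / 5))%R, (4 / 5)%R].
have mD1 : measurable D1.
  apply: measurableI; first exact: measurable_diskR2.
  by rewrite -[X in measurable X]setTI; apply: measurable_snd.
have mD2 : measurable D2.
  apply: measurableI; first exact: measurable_diskR2.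
  by rewrite -[X in measurable X]setTI; apply: measurable_fst.
pose f1 := k \_ D1; pose f2 := k \_ D2.
have mf1 : measurable_fun [set: R * R] f1 by apply: (measurable_restrictT _ _).1.
have mf2 : measurable_fun [set: R * R] f2 by apply: (measurable_restrictT _ _).1.
have f10 (x : R * R) : (0 <= f1 x)%E by rewrite /f1 patchE; case: ifP.
have f20 (x : R * R) : (0 <= f2 x)%E by rewrite /f2 patchE; case: ifP.
have line (F : R -> \bar R) t : -1 <= t <= 1 -> measurable_fun setT F -> (forall y, (0 <= F y)%E) ->
    (forall y, `|y| <= 4 / 5 -> (F y <= (K * line_kernel (s - a - 1) d t y)%:E)%E) ->
    (forall y, 4 / 5 < `|y| -> (F y <= 0)%E) -> (\int[mu]_y F y <= (K * U)%:E)%E.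
  move=> ht mF F0 Fin Fout.
  have mkk : measurable_fun (`[(-1)%R, 1%R] : set R) (fun y => (line_kernel (s - a - 1) d t y)%:E).
    by apply/measurable_EFinP; apply: measurable_funTS; exact: measurable_line_kernel.
  have kk0 y : (0 <= (line_kernel (s - a - 1) d t y)%:E)%E by rewrite lee_fin powR_ge0.
  apply: (@le_trans _ _ (\int[mu]_(y in `[(-1)%R, 1%R])
      (K%:E * (line_kernel (s - a - 1) d t y)%:E))%E).
    rewrite [leRHS]integral_mkcond; apply: ge0_le_integral => //.
      apply: (measurable_restrictT _ _).1 => //; exact: measurable_funeM.
    move=> y _; rewrite patchE; case: ifPn => [|hy].
      rewrite inE /= in_itv /= => hy.
      have [y45|y45] := leP `|y| (4 / 5); first by rewrite -EFinM; exact: Fin.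
      by apply: le_trans (Fout _ y45) _; rewrite mule_ge0// lee_fin ltW.
    apply: Fout; rewrite ltNge; apply: contra hy; rewrite ler_norml => /andP[? ?].
    by rewrite inE /= in_itv /=; apply/andP; split; order_lra.
  rewrite ge0_integralZl_EFin//; last exact: ltW.
  by rewrite [leRHS]EFinM; apply: lee_wpmul2l; [rewrite lee_fin ltW|exact: hU].
have in1 (x : R * R) : `|x.2| <= 4 / 5 -> (x \in D1) = (x.1 ^+ 2 + x.2 ^+ 2 < 1).
  move=> hx; apply/idP/idP; rewrite inE; first by case=> /diskR2E.
  by move=> /diskR2E xD; split=> //=; rewrite in_itv /= -ler_norml.
have in2 (x : R * R) : `|x.1| <= 4 / 5 -> (x \in D2) = (x.1 ^+ 2 + x.2 ^+ 2 < 1).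
  move=> hx; apply/idP/idP; rewrite inE; first by case=> /diskR2E.
  by move=> /diskR2E xD; split=> //=; rewrite in_itv /= -ler_norml.
have I1 : (\int[leb2]_x f1 x <= (K * U)%:E)%E.
  rewrite /leb2 fubini_tonelli2//; apply: (line _ eta) => //.
  - exact: measurable_fun_fubini_tonelli_G.
  - by move=> y; exact: integral_ge0.
  - move=> y hy; rewrite /fubini_G /K; apply: (@slice_int R s a d xi eta y) => //.
    + by apply: measurableT_comp.
    + by move=> x h; rewrite /f1 patchE in1//= h.
    + by move=> x h; rewrite /f1 patchE in1//= ltNge h.
  - move=> y hy; rewrite /fubini_G integral0_eq// => x _.
    rewrite /f1 patchE memNset// => -[_] /=; rewrite in_itv /= -ler_norml.
    by rewrite leNgt hy.
have I2 : (\int[leb2]_x f2 x <= (K * U)%:E)%E.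
  rewrite /leb2 fubini_tonelli1//; apply: (line _ xi) => //.
  - exact: measurable_fun_fubini_tonelli_F.
  - by move=> y; exact: integral_ge0.
  - move=> y hy; rewrite /fubini_F /K; apply: (@slice_int R s a d eta xi y) => //.
    + by apply: measurableT_comp.
    + move=> x h; rewrite /f2 patchE in2//= addrC h /k /plane_kernel /=.
      by rewrite addrAC (addrC (y ^+ 2)).
    + by move=> x h; rewrite /f2 patchE in2//= addrC ltNge h.
  - move=> y hy; rewrite /fubini_F integral0_eq// => x _.
    rewrite /f2 patchE memNset// => -[_] /=; rewrite in_itv /= -ler_norml.
    by rewrite leNgt hy.
apply: (@le_trans _ _ (\int[leb2]_x (f1 x + f2 x))%E); last first.
  by rewrite ge0_integralD// mulrDl EFinD; exact: leeD.
rewrite integral_mkcond; apply: ge0_le_integral => //.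
- by move=> x _; rewrite patchE; case: ifP => // _; exact: k0.
- by apply: (measurable_restrictT _ measurable_diskR2).1.
- exact: emeasurable_funD.
move=> x _; rewrite patchE; case: ifPn => [|_]; last by rewrite adde_ge0.
rewrite inE => /diskR2E xD.
have [h|h] := leP `|x.2| (4 / 5).
  by apply: (@le_trans _ _ (f1 x)); [rewrite /f1 patchE in1// xD|rewrite leeDl].
have h1 : `|x.1| <= 4 / 5.
  have n2 := real_normK (num_real x.2); have n1 := real_normK (num_real x.1).
  have := normr_ge0 x.1; rewrite leNgt => p1; apply/negP => q1.
  by move: xD; rewrite -n1 -n2; order_nra.
by apply: (@le_trans _ _ (f2 x)); [rewrite /f2 patchE in2// xD|rewrite leeDr].
Qed.

End DiskIntegral.

(** * The kernel 1 - conj(w) z and the Forelli-Rudin estimates *)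

Section DiskKernel.
Context {R : realType}.
Notation mu := (@lebesgue_measure R).
Notation leb2 := (@leb2 R).
Implicit Types (a c p U : R) (w z : R[i]).

(** The pair (xi, eta) is the unit number zeta that [polar] attaches to w, and K = |zeta - |w| z|.
    Replacing |w| by 1 costs at most 1 - |w| <= K, so |z - zeta| <= 2 K. Then 1 + 2 + 2 gives the
    constant 5, and 1 - |z|^2 <= 2 |z - zeta| gives 4. *)
Lemma disk_kernel_bounds w : inD w -> exists xi eta : R,
  [/\ -1 <= xi <= 1, -1 <= eta <= 1 & forall x y : R, inD (x +i* y)%C ->
    let K := cabs (1 - (w^*)%C * (x +i* y)%C) in
    [/\ 1 - cabs w <= K, (1 - cabs w) + `|x - xi| + `|y - eta| <= 5 * K &
        1 - cabs (x +i* y)%C ^+ 2 <= 4 * K]].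
Proof.
move=> wD; have [[xi eta] z1 wE] := polar w.
set zeta := (xi +i* eta)%C in z1 wE.
have [h1 h2] : -1 <= xi <= 1 /\ -1 <= eta <= 1.
  by rewrite -!ler_norml -z1; split; [exact: (cabs_Re zeta)|exact: (cabs_Im zeta)].
exists xi, eta; split=> // x y zD K; set z := (x +i* y)%C in zD K *.
set r := cabs w in wE wD *.
have r0 : 0 <= r by exact: cabs_ge0.
have r1 : r < 1 by exact: wD.
have t0 := cabs_ge0 z; have t1 : cabs z < 1 by exact: zD.
have KE : K = cabs (zeta - (r%:C)%C * z).
  have zz : zeta * (zeta^*)%C = 1 by rewrite mulc_conj z1 expr1n.
  have -> : zeta - (r%:C)%C * z = zeta * (1 - (w^*)%C * z).
    have -> : (w^*)%C = (r%:C)%C * (zeta^*)%C.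
      rewrite {1}wE rmorphM; congr (_ * _).
      by apply/eqP; rewrite eq_complex /= oppr0 !eqxx.
    rewrite mulrBr mulr1; congr (_ - _).
    by rewrite !mulrA (mulrAC zeta) zz mul1r.
  by rewrite cabsM z1 mul1r.
have Kd : 1 - r <= K.
  rewrite KE; have := cabs_lerB zeta ((r%:C)%C * z).
  by rewrite z1 cabsM cabs_real ger0_norm//; order_nra.
have zz : cabs (z - zeta) <= 2 * K.
  have -> : z - zeta = - (zeta - (r%:C)%C * z) + ((1 - r)%:C)%C * z.
    by rewrite rmorphB rmorph1; ring.
  apply: le_trans (cabsD _ _) _; rewrite cabsN -KE cabsM cabs_real ger0_norm; last by order_lra.
  by order_nra.
split=> //.
  have := cabs_Re (z - zeta); have := cabs_Im (z - zeta); rewrite /= => ? ?; order_lra.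
have := cabs_lerB zeta z; rewrite cabsBC z1 => ?.
order_nra.
Qed.

Lemma measurable_kernel_powR w e :
  measurable_fun (@diskR2 R) (fun x => cabs (1 - (w^*)%C * toC x) `^ e).
Proof.
apply: (measurableT_comp (measurable_powR e)).
apply: (measurable_cabs (f := fun z => 1 - (w^*)%C * z)) => z _.
apply: ccontD; first exact: ccont_cst.
by apply: ccontN; apply: ccontM; [exact: ccont_cst|exact: ccont_id].
Qed.

(** [disk_int] takes a nonpositive weight exponent. For a >= 0 the bound 1 - |z|^2 <= 4 K trades the
    weight for a lower kernel exponent, s = c - a with a' = 0; for a < 0 the exponents are kept.
    Both times s - a' = c - a, the only combination that reaches the line kernel. *)
Lemma forelli_rudin a c : -1 < a -> a + 2 <= c -> exists2 C, 0 < C &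
  forall w U, inD w ->
  (forall t, -1 <= t <= 1 ->
    (\int[mu]_(y in `[(-1)%R, 1%R]) (line_kernel (c - a - 1) (1 - cabs w) t y)%:E <= U%:E)%E) ->
  (intAb a (fun z => (cabs (1 - (w^*)%C * z) `^ (- c))%R) <= (C * U)%:E)%E.
Proof.
move=> a1 ac; have pi0 : 0 < pi :> R by exact: pi_gt0.
have [s [a' [C0 [C00 [a'1 [a'0 [s1 [sE hpt]]]]]]]] : exists s a' C0 : R, 0 < C0 /\ -1 < a' /\ a' <= 0 /\
    1 < s /\ s - a' - 1 = c - a - 1 /\ forall K T t : R, 0 < K -> 0 < T -> 0 < t ->
    T <= 5 * K -> t <= 4 * K -> K `^ (- c) * t `^ a <= C0 * (T `^ (- s) * t `^ a').
  have flip e K T : 0 <= e -> 0 < K -> 0 < T -> T <= 5 * K -> K `^ (- e) <= 5 `^ e * T `^ (- e).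
    move=> e0 K0 T0 TK; apply: (@le_trans _ _ (5 `^ e * (5 * K) `^ (- e))).
      rewrite powRM ?(ltW K0)// mulrA -powRD; last by rewrite pnatr_eq0 implybT.
      by rewrite subrr powRr0 mul1r.
    by rewrite ler_wpM2l ?powR_ge0//; apply: powR_geN => //; rewrite oppr_le0.
  have [a0|a0] := leP 0 a.
    exists (c - a), 0, (4 `^ a * 5 `^ (c - a)); split; first by rewrite mulr_gt0 ?powR_gt0.
    do 4 (split; first order_lra); move=> K T t K0 T0 t0 TK tK.
    rewrite powRr0 mulr1.
    apply: (@le_trans _ _ (K `^ (- c) * (4 `^ a * K `^ a))).
      rewrite ler_wpM2l ?powR_ge0// -powRM ?(ltW K0)//.
      by apply: powR_le => //; exact: ltW.
    rewrite mulrCA -powRD; last by rewrite (gt_eqF K0) implybT.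
    rewrite -mulrA ler_wpM2l ?powR_ge0// (_ : - c + a = - (c - a)); last by ring.
    by apply: flip => //; order_lra.
  exists c, a, (5 `^ c); split; first by rewrite powR_gt0.
  do 4 (split; first order_lra); move=> K T t K0 T0 t0 TK tK.
  by rewrite mulrA ler_wpM2r ?powR_ge0//; apply: flip => //; order_lra.
have [C C1 hC] := disk_int a'1 a'0 s1.
exists (C0 / pi * C) => [|w U wD hU]; first by rewrite !mulr_gt0 ?invr_gt0.
have [xi [eta [hxi heta hK]]] := disk_kernel_bounds wD.
have d0 : 0 < 1 - cabs w by exact: inD_ball_gt0.
have := hC xi eta (1 - cabs w) U hxi heta d0; rewrite sE => /(_ hU) H.
rewrite /intAb.
apply: (@le_trans _ _ (\int[leb2]_(x in @diskR2 R)
    ((C0 / pi)%:E * (plane_kernel s a' (1 - cabs w) xi eta x.1 x.2)%:E))%E); last first.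
  have mk : measurable_fun (@diskR2 R)
      (fun x => (plane_kernel s a' (1 - cabs w) xi eta x.1 x.2)%:E).
    by apply/measurable_EFinP; exact: measurable_plane_kernel.
  rewrite ge0_integralZl_EFin//; first last.
  - by rewrite divr_ge0// ltW.
  - by move=> x _; rewrite lee_fin mulr_ge0 ?powR_ge0.
  - exact: measurable_diskR2.
  by rewrite -[(_ * C * U)%R]mulrA [leRHS]EFinM; apply: lee_wpmul2l => //; rewrite lee_fin divr_ge0// ltW.
apply: ge0_le_integral => //.
- exact: measurable_diskR2.
- by move=> x _; rewrite lee_fin divr_ge0 ?mulr_ge0 ?powR_ge0// ltW.
- apply: measurable_weighted; exact: measurable_kernel_powR.
- by apply: measurable_funeM; apply/measurable_EFinP; exact: measurable_plane_kernel.
move=> [x y] xD; rewrite -EFinM lee_fin.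
have [k1 k2 k3] := hK x y xD; set K := cabs (1 - (w^*)%C * _) in k1 k2 k3.
rewrite [leLHS](_ : _ = K `^ (- c) * (1 - cabs (x +i* y)%C ^+ 2) `^ a * pi^-1)//.
rewrite [leRHS]mulrAC ler_pM2r ?invr_gt0//.
have c1 : cabs (x +i* y)%C < 1 by exact: xD.
have c0 := cabs_ge0 (x +i* y)%C.
rewrite /plane_kernel (_ : x ^+ 2 + y ^+ 2 = cabs (x +i* y)%C ^+ 2); last by rewrite cabs_sqr.
apply: hpt => //.
- exact: lt_le_trans d0 k1.
- by rewrite -addrA ltr_wpDr// addr_ge0.
- by rewrite subr_gt0 expr_lt1.
Qed.

Lemma forelli_rudin_gt a c : -1 < a -> a + 2 < c -> exists2 C, 0 < C &
  forall w, inD w ->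
  (intAb a (fun z => (cabs (1 - (w^*)%C * z) `^ (- c))%R) <=
    (C * (1 - cabs w) `^ (a + 2 - c))%:E)%E.
Proof.
move=> a1 ac; have [C C0 hC] := forelli_rudin a1 (ltW ac).
have u1 : 1 < c - a - 1 by order_lra.
exists (C * (2 / (c - a - 2))) => [|w wD].
  by rewrite mulr_gt0// divr_gt0//; order_lra.
have d0 := inD_ball_gt0 wD.
rewrite -mulrA; apply: hC => // t ht; apply: le_trans (kernel_int u1 d0 ht) _.
rewrite lee_fin (_ : 1 - (c - a - 1) = a + 2 - c); last by ring.
have -> : c - a - 1 - 1 = c - a - 2 by ring.
by rewrite mulrA mulrAC.
Qed.

(** The line kernel now has exponent 1 and integrates to twice the logarithm of (d + 3)/d. With Y =
    2/(1 - |w|^2) >= 2 this quotient is at most 4 Y <= Y^3; the cube and the factor 2 make the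
    constant 6. *)
Lemma forelli_rudin_eq a : -1 < a -> exists2 C, 0 < C &
  forall w, inD w ->
  (intAb a (fun z => (cabs (1 - (w^*)%C * z) `^ (- (a + 2)))%R) <=
    (C * ln (2 / (1 - cabs w ^+ 2)))%:E)%E.
Proof.
move=> a1; have [C C0 hC] := forelli_rudin a1 (lexx (a + 2)).
exists (C * 6) => [|w wD]; first by rewrite mulr_gt0.
have d0 := inD_ball_gt0 wD; have r0 := cabs_ge0 w.
rewrite -mulrA; apply: hC => // t ht; rewrite (_ : a + 2 - a - 1 = 1); last by ring.
apply: le_trans (kernel_int1 d0 ht) _; rewrite lee_fin.
set d := 1 - cabs w in d0 *.
have D0 : 0 < 1 - cabs w ^+ 2 by rewrite /d in d0; order_nra.
set Y := 2 / _; have Y2 : 2 <= Y by rewrite /Y ler_pdivlMr//; have := sqr_ge0 (cabs w); order_lra.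
have Y0 : 0 < Y by order_lra.
have dY : (d + 3) / d <= Y ^+ 3.
  have : (d + 3) / d <= 4 * Y.
    rewrite ler_pdivrMr// /Y mulrA mulrAC ler_pdivlMr//.
    rewrite /d in d0 *; order_nra.
  by move=> h; apply: le_trans h _; order_nra.
rewrite -ln_div ?posrE//; last by order_lra.
have : ln ((d + 3) / d) <= ln (Y ^+ 3).
  by rewrite ler_ln ?posrE ?exprn_gt0// divr_gt0//; order_lra.
rewrite lnXn// -mulr_natl; order_lra.
Qed.

End DiskKernel.

(** * Order boundedness and test functions *)

Section OrderBounded.
Context {R : realType}.
Notation leb2 := (@leb2 R).
Implicit Types (a p q beta g s C : R) (z w v : R[i]).

Local Instance leb2_ae_filter : Filter (nbhs (almost_everywhere leb2)).
Proof. exact: ae_filter_ringOfSetsType. Qed.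

Lemma intAb_integrand_ge0 beta (F : R[i] -> R) z : 0 <= F z ->
  (0%R <= (F z * (1 - cabs z ^+ 2) `^ beta / pi)%:E)%E.
Proof. by move=> F0; rewrite lee_fin divr_ge0 ?mulr_ge0 ?powR_ge0 ?pi_ge0. Qed.

Lemma eq_intAb beta (F G : R[i] -> R) : (forall z, inD z -> F z = G z) ->
  intAb beta F = intAb beta G.
Proof. by move=> FG; apply: eq_integral => x; rewrite inE => /FG ->. Qed.

Lemma le_intAb_ae beta (F G : R[i] -> R) :
  measurable_fun (@diskR2 R) (F \o @toC R) -> measurable_fun (@diskR2 R) (G \o @toC R) ->
  (forall z, 0 <= F z) -> (forall z, 0 <= G z) ->
  {ae leb2, forall x, diskR2 x -> F (toC x) <= G (toC x)} ->
  (intAb beta F <= intAb beta G)%E.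
Proof.
move=> mF mG F0 G0 FG; apply: ae_ge0_le_integral.
- exact: measurable_diskR2.
- by move=> x _; exact: intAb_integrand_ge0.
- exact: measurable_weighted.
- by move=> x _; exact: intAb_integrand_ge0.
- exact: measurable_weighted.
apply: filterS FG => x FG /FG h.
by rewrite lee_fin ler_wpM2r ?invr_ge0 ?pi_ge0// ler_wpM2r ?powR_ge0.
Qed.

Lemma intAbD beta (F G : R[i] -> R) :
  measurable_fun (@diskR2 R) (F \o @toC R) -> measurable_fun (@diskR2 R) (G \o @toC R) ->
  (forall z, 0 <= F z) -> (forall z, 0 <= G z) ->
  (intAb beta (fun z => F z + G z)%R = intAb beta F + intAb beta G)%E.
Proof.
move=> mF mG F0 G0; rewrite /intAb -ge0_integralD.
- by apply: eq_integral => x _; rewrite -EFinD !mulrDl.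
- exact: measurable_diskR2.
- by move=> x _; exact: intAb_integrand_ge0.
- exact: measurable_weighted.
- by move=> x _; exact: intAb_integrand_ge0.
- exact: measurable_weighted.
Qed.

Lemma intAbZ beta C (F : R[i] -> R) : 0 <= C ->
  measurable_fun (@diskR2 R) (F \o @toC R) -> (forall z, 0 <= F z) ->
  (intAb beta (fun z => C * F z)%R = C%:E * intAb beta F)%E.
Proof.
move=> C0 mF F0; rewrite /intAb -ge0_integralZl_EFin//.
- by apply: eq_integral => x _; rewrite -EFinM !mulrA.
- exact: measurable_diskR2.
- by move=> x _; exact: intAb_integrand_ge0.
- exact: measurable_weighted.
Qed.

Lemma intAb_powR_lty q beta C (F : R[i] -> R) (h : R * R -> R) : 0 < q -> 0 <= C ->
  measurable_fun (@diskR2 R) (F \o @toC R) -> (forall z, 0 <= F z) ->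
  inLqAb q beta h -> {ae leb2, forall x, diskR2 x -> F (toC x) <= C * h x} ->
  (intAb beta (fun z => (F z `^ q)%R) < +oo)%E.
Proof.
move=> q0 C0 mF F0 [mh hf] Fh.
pose H z := `|h (complex.Re z, complex.Im z)| `^ q.
have mH : measurable_fun (@diskR2 R) (H \o @toC R).
  rewrite (_ : _ \o _ = fun x => `|h x| `^ q); last by apply/funext => -[].
  apply: (measurableT_comp (measurable_powR q)).
  exact: (measurableT_comp (@normr_measurable R setT)).
have H0 z : 0 <= H z by exact: powR_ge0.
apply: (@le_lt_trans _ _ (intAb beta (fun z => C `^ q * H z)%R)).
  apply: le_intAb_ae => //.
  - exact: (measurableT_comp (measurable_powR q)).
  - by apply: measurable_funM.
  - by move=> z; exact: powR_ge0.
  - by move=> z; rewrite mulr_ge0 ?powR_ge0.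
  apply: filterS Fh => -[x y] Fh xD; have {}Fh := Fh xD.
  rewrite /H /= -powRM//; apply: powR_le => //; first exact: ltW.
  by apply: le_trans Fh _; rewrite ler_wpM2l// ler_norm.
rewrite intAbZ ?powR_ge0//; apply: lte_mul_pinfty => //.
by rewrite lee_fin powR_ge0.
Qed.

Lemma cderiv_Wop (phi vphi f : R[i] -> R[i]) z : analyticD phi -> selfmapD vphi ->
  analyticD f -> inD z ->
  is_cderiv (Wop phi vphi f) z
    (cderiv phi z * f (vphi z) + phi z * (cderiv f (vphi z) * cderiv vphi z)).
Proof.
move=> aphi [avphi sv] af zD; apply: is_cderivM; first exact: is_cderivD_cderiv.
by apply: is_cderiv_comp; apply: is_cderivD_cderiv => //; exact: sv.
Qed.

Lemma rational_dense : exists e : nat -> R[i], forall v (d : R), 0 < d ->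
  exists n, cabs (e n - v) < d.
Proof.
exists (fun n => if unpickle n is Some (s, t) then (ratr s +i* ratr t)%C else 0) => -[x y] d d0.
have d2 : 0 < d / 2 by rewrite divr_gt0.
have [|s hs] := @rat_in_itvoo R x (x + d / 2); first by rewrite ltrDl.
have [|t ht] := @rat_in_itvoo R y (y + d / 2); first by rewrite ltrDl.
move: hs ht; rewrite !in_itv /= => /andP[s1 s2] /andP[t1 t2].
exists (pickle (s, t)); rewrite pickleK; apply: le_lt_trans (cabs_le_ReIm _) _.
by rewrite /= !ger0_norm ?subr_ge0 ?(ltW s1) ?(ltW t1)//; order_lra.
Qed.

Lemma ccont_le_dense (e : nat -> R[i]) (F : R[i] -> R[i]) v C :
  (forall v (d : R), 0 < d -> exists n, cabs (e n - v) < d) ->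
  inD v -> ccont F v -> (forall n, inD (e n) -> cabs (F (e n)) <= C) -> cabs (F v) <= C.
Proof.
move=> he vD cF hF; rewrite leNgt; apply/negP => lt.
have [|d d0 hd] := cF (cabs (F v) - C); first by rewrite subr_gt0.
have [|n] := he v (Num.min d (1 - cabs v)).
  by rewrite lt_min d0 inD_ball_gt0.
rewrite lt_min => /andP[/hd h1 /(inD_ball vD)/hF h2].
by have := cabs_lerB (F v) (F (e n)); rewrite cabsBC; order_lra.
Qed.

(** The first argument of [F] is the parameter, the second the variable. Continuity is asked in the
    parameter, with the variable frozen at the diagonal value: this is what the passage from a dense
    set of parameters to w = vphi z consumes. *)
Definition test_family p a (F dF : R[i] -> R[i] -> R[i]) := forall w, inD w ->
  [/\ forall z, inD z -> is_cderiv (F w) z (dF w z), (normD p a (F w) <= 1)%E,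
      ccont (F ^~ w) w & ccont (dF ^~ w) w].

(* Order boundedness only gives a null set for each single test function; the
   exceptional sets are collected over a countable dense set of parameters, and
   continuity in the parameter reaches the value w = vphi z. *)
Lemma order_bounded_diag p a (phi vphi : R[i] -> R[i]) (h : R * R -> R) F dF :
  analyticD phi -> selfmapD vphi ->
  (forall f, inDpa p a f -> (normD p a f <= 1)%E ->
     {ae leb2, forall x, diskR2 x -> cabs (cderiv (Wop phi vphi f) (toC x)) <= h x}) ->
  test_family p a F dF ->
  {ae leb2, forall x, diskR2 x -> let z := toC x in let v := vphi z in
     cabs (cderiv phi z * F v v + phi z * (dF v v * cderiv vphi z)) <= h x}.
Proof.
move=> aphi sm hh tF; have [e he] := rational_dense.
have := @ae_foralln _ _ _ leb2 (fun n x => inD (e n) -> diskR2 x ->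
  cabs (cderiv (Wop phi vphi (F (e n))) (toC x)) <= h x).
have {}hh n : {ae leb2, forall x, inD (e n) -> diskR2 x ->
    cabs (cderiv (Wop phi vphi (F (e n))) (toC x)) <= h x}.
  have [en|en] := pselect (inD (e n)); last exact: aeW.
  have [dF1 nF _ _] := tF _ en.
  have aF : analyticD (F (e n)) by move=> z /dF1; exists (dF (e n) z).
  have {}hh : {ae leb2, forall x, diskR2 x ->
      cabs (cderiv (Wop phi vphi (F (e n))) (toC x)) <= h x}.
    by apply: hh => //; split=> //; exact: le_lt_trans nF (ltry 1).
  by apply: filterS hh => x hx _.
move=> /(_ hh) H; apply: filterS H => x H xD.
set z := toC x; set v := vphi z.
have vD : inD v by exact: sm.2.
have [_ _ c1 c2] := tF _ vD.
apply: (@ccont_le_dense e (fun w => cderiv phi z * F w v + phi z * (dF w v * cderiv vphi z)) v) => //.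
  apply: ccontD; first by apply: ccontM => //; exact: ccont_cst.
  by apply: ccontM; [exact: ccont_cst|apply: ccontM => //; exact: ccont_cst].
move=> n en; have [dF1 _ _ _] := tF _ en.
have aF : analyticD (F (e n)) by move=> u /dF1; exists (dF (e n) u).
have := H n en xD; rewrite (cderivE (cderiv_Wop aphi sm aF xD)).
by rewrite (cderivE (dF1 _ vD)).
Qed.

(** The scheme common to the three cases: [g] is the growth exponent of f' and [B] the growth of f.
    The first family isolates the term in f'. The second attains [B], and its diagonal derivative is
    dominated by the bound already controlled, so that term can be subtracted. The index n may
    depend on the point, since countably many null sets have a null union. *)
Lemma order_bounded_iff p a q beta g (B : R -> R) (phi vphi : R[i] -> R[i]) :
  0 < q -> analyticD phi -> selfmapD vphi ->
  measurable_fun [set: R] B -> (forall r, 0 <= B r) ->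
  (exists2 C, 0 < C & forall f z, analyticD f -> (normD p a f <= 1)%E -> inD z ->
     cabs (cderiv f z) <= C * (1 - cabs z ^+ 2) `^ (- g) /\ cabs (f z) <= C * B (cabs z)) ->
  (exists2 C, 0 <= C & exists F dF, test_family p a F dF /\ forall v, inD v ->
     F v v = 0 /\ (1 - cabs v ^+ 2) `^ (- g) <= C * cabs (dF v v)) ->
  (exists2 C, 0 <= C & exists F dF, (forall n : nat, test_family p a (F n) (dF n)) /\
     forall v, inD v -> exists n, B (cabs v) <= C * cabs (F n v v) /\
       cabs (dF n v v) <= C * (1 - cabs v ^+ 2) `^ (- g)) ->
  order_bounded p a q beta phi vphi <->
  (intAb beta (fun z => ((cabs (phi z * cderiv vphi z) *
      (1 - cabs (vphi z) ^+ 2) `^ (- g)) `^ q)%R) +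
   intAb beta (fun z => ((cabs (cderiv phi z) * B (cabs (vphi z))) `^ q)%R) < +oo)%E.
Proof.
move=> q0 aphi sm mB B0 [C C0 hC] [C1 C10 [F [dF [tF hF]]]] [C2 C20 [F' [dF' [tF' hF']]]].
set G1 := fun z => cabs (phi z * cderiv vphi z) * (1 - cabs (vphi z) ^+ 2) `^ (- g).
set G2 := fun z => cabs (cderiv phi z) * B (cabs (vphi z)).
have [av sv] := sm.
have G10 z : 0 <= G1 z by rewrite mulr_ge0 ?cabs_ge0 ?powR_ge0.
have G20 z : 0 <= G2 z by rewrite mulr_ge0 ?cabs_ge0.
have mv : measurable_fun (@diskR2 R) (fun x => cabs (vphi (toC x))).
  by apply: measurable_cabs => z; exact: analyticD_cont.
have mG1 : measurable_fun (@diskR2 R) (G1 \o @toC R).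
  apply: measurable_funM.
    apply: (measurable_cabs (f := fun z => phi z * cderiv vphi z)) => z zD.
    by apply: ccontM; [exact: analyticD_cont|exact: analyticD_cont (analyticD_cderiv av) zD].
  apply: (measurableT_comp (measurable_powR (- g))).
  by apply: measurable_funB => //; exact: measurable_funX.
have mG2 : measurable_fun (@diskR2 R) (G2 \o @toC R).
  apply: measurable_funM.
    by apply: measurable_cabs => z; apply: analyticD_cont; exact: analyticD_cderiv.
  exact: (measurableT_comp mB).
rewrite -/(G1 _) -/(G2 _).
split=> [[h [hL hh]]|fin].
  have H1 := order_bounded_diag aphi sm hh tF.
  have H2 := ae_foralln (fun n => order_bounded_diag aphi sm hh (tF' n)).
  have K1 : {ae leb2, forall x, diskR2 x -> G1 (toC x) <= C1 * h x}.
    apply: filterS H1 => x H xD; have := H xD => /=.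
    have vD := sv _ xD; have [-> ge] := hF _ vD; rewrite mulr0 add0r => le.
    apply: le_trans (ler_wpM2l C10 le); rewrite /G1 !cabsM.
    rewrite [leRHS](_ : _ = cabs (phi (toC x)) * cabs (cderiv vphi (toC x)) *
      (C1 * cabs (dF (vphi (toC x)) (vphi (toC x))))); last by ring.
    by rewrite ler_wpM2l// mulr_ge0 ?cabs_ge0.
  (* The summand 1 pays for the derivative of W f, [C2 * C1] for the subtracted term in f', and the
     outer [C2] for the lower bound on the test function. *)
  have K2 : {ae leb2, forall x, diskR2 x -> G2 (toC x) <= (C2 * (1 + C2 * C1)) * h x}.
    apply: (filterS2 _ _ K1 H2) => x k1 k2 xD; have {}k1 := k1 xD.
    have vD := sv _ xD; have [n [hn1 hn2]] := hF' _ vD; have {k2} := k2 n xD => /=.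
    set z := toC x in k1 vD hn1 hn2 *; set v := vphi z in vD hn1 hn2 *.
    move=> le; have := cabs_lerB (cderiv phi z * F' n v v) (- (phi z * (dF' n v v * cderiv vphi z))).
    rewrite opprK cabsN => /le_trans/(_ le); rewrite lerBlDr => le2.
    have le3 : cabs (phi z * (dF' n v v * cderiv vphi z)) <= C2 * (C1 * h x).
      apply: le_trans (ler_wpM2l C20 k1); rewrite /G1 !cabsM.
      rewrite [leRHS](_ : _ = cabs (phi z) * cabs (cderiv vphi z) *
        (C2 * (1 - cabs v ^+ 2) `^ (- g))); last by rewrite /v; ring.
      rewrite -[leRHS]mulrA ler_wpM2l ?cabs_ge0//.
      by rewrite mulrC ler_wpM2l ?cabs_ge0.
    rewrite /G2 -/v; apply: (@le_trans _ _ (C2 * cabs (cderiv phi z * F' n v v))).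
      by rewrite cabsM mulrCA ler_wpM2l ?cabs_ge0.
    rewrite -mulrA ler_wpM2l// mulrDl mul1r -mulrA.
    by apply: le_trans le2 _; rewrite lerD2l.
  apply: lte_add_pinfty.
    exact: intAb_powR_lty hL K1.
  by apply: intAb_powR_lty hL K2 => //; rewrite mulr_ge0// addr_ge0// mulr_ge0.
pose G z := C * (G1 z + G2 z).
have G0 z : 0 <= G z by rewrite mulr_ge0 ?addr_ge0// ltW.
exists (fun x => G (toC x)); split.
  split; first by apply: measurable_funM => //; exact: measurable_funD.
  (* Bounding a sum by twice its larger term gives (G1 + G2)^q <= 2^q (G1^q + G2^q) for every q > 0,
     also where the power is not convex. *)
  pose H z := (2 * C) `^ q * (G1 z `^ q + G2 z `^ q).
  have mq K : measurable_fun (@diskR2 R) (K \o @toC R) ->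
      measurable_fun (@diskR2 R) ((fun z : R[i] => K z `^ q) \o @toC R).
    by move=> mK; exact: (measurableT_comp (measurable_powR q)).
  have mS : measurable_fun (@diskR2 R) ((fun z => G1 z `^ q + G2 z `^ q) \o @toC R).
    by apply: measurable_funD; exact: mq.
  have S0 z : 0 <= G1 z `^ q + G2 z `^ q by rewrite addr_ge0 ?powR_ge0.
  apply: (@le_lt_trans _ _ (intAb beta H)); last first.
    rewrite /H intAbZ ?powR_ge0// intAbD//; first last.
    - by move=> z; exact: powR_ge0.
    - by move=> z; exact: powR_ge0.
    - exact: mq.
    - exact: mq.
    by apply: lte_mul_pinfty => //; rewrite lee_fin powR_ge0.
  rewrite (@eq_intAb beta _ (fun z => G z `^ q)); last first.
    by move=> [x y] _; rewrite ger0_norm.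
  apply: le_intAb_ae.
  - by apply: mq; apply: measurable_funM => //; exact: measurable_funD.
  - exact: measurable_funM.
  - by move=> z; exact: powR_ge0.
  - by move=> z; rewrite mulr_ge0 ?powR_ge0.
  apply: aeW => x _; set z := toC x; rewrite /H /G.
  rewrite (mulrC 2) !(powRM _ (ltW C0)) ?addr_ge0//.
  rewrite -mulrA ler_wpM2l ?powR_ge0// mulrDr -!powRM//.
  have [le|/ltW le] := leP (G1 z) (G2 z).
    apply: (@le_trans _ _ ((2 * G2 z) `^ q)); last by rewrite lerDr powR_ge0.
    by apply: powR_le; rewrite ?addr_ge0 ?(ltW q0)//; order_lra.
  apply: (@le_trans _ _ ((2 * G1 z) `^ q)); last by rewrite lerDl powR_ge0.
  by apply: powR_le; rewrite ?addr_ge0 ?(ltW q0)//; order_lra.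
move=> f [af _] nf; apply: aeW => x xD.
rewrite (cderivE (cderiv_Wop aphi sm af xD)).
have [h1 h2] := hC f _ af nf (sv _ xD).
apply: le_trans (cabsD _ _) _; rewrite /G mulrDr addrC /G1 /G2 !cabsM.
apply: lerD.
  rewrite -[in leRHS]mulrA [leRHS]mulrCA ler_wpM2l ?cabs_ge0//.
  by rewrite [leRHS]mulrCA [leLHS]mulrC ler_wpM2l ?cabs_ge0.
by rewrite mulrCA ler_wpM2l ?cabs_ge0.
Qed.

End OrderBounded.

(** * Weights, kernels and normalization of test functions *)

Section TestFunctions.
Context {R : realType}.
Implicit Types (a p s x C : R) (w z v : R[i]) (n : nat).

(** Reading |w|^2 as the real part of w conj(w) reduces the claim to continuity of products and of
    conjugation. *)
Lemma ccont_sqr (u : R -> R) v : {for (cabs v ^+ 2), continuous u} ->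
  ccont (fun w => ((u (cabs w ^+ 2))%:C)%C) v.
Proof.
move=> cu; pose re (z : R[i]) : R[i] := ((u (complex.Re z))%:C)%C.
have : ccont (fun w => re (w * (w^*)%C)) v.
  apply: (ccont_comp (f := fun w => w * (w^*)%C)).
    by apply: ccontM; [exact: ccont_id|exact: ccontJ].
  move=> e e0; move: cu => /cvgrPdist_lt/(_ _ e0)/nbhs_ballP[d /= d0 hd].
  exists d => // z hz; rewrite /re -rmorphB cabs_real distrC mulc_conj.
  apply: hd; rewrite /ball /= distrC; apply: le_lt_trans hz.
  by have := cabs_Re (z - v * (v^*)%C); rewrite raddfB /= mulc_conj.
by congr (ccont _ v); apply/funext => w; rewrite /re mulc_conj.
Qed.

(** It depends on the parameter only, hence is a constant factor in the variable and does not
    disturb analyticity. *)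
Definition dweight s w : R[i] := (((1 - cabs w ^+ 2) `^ s)%:C)%C.

Lemma inD_sqr_gt0 w : inD w -> 0 < 1 - cabs w ^+ 2.
Proof. by move=> wD; rewrite subr_gt0 expr_lt1// cabs_ge0. Qed.

Lemma ccont_dweight s v : inD v -> ccont (dweight s) v.
Proof.
move=> vD; have -> : dweight s = fun w => (((1 + -1 * cabs w ^+ 2) `^ s)%:C)%C.
  by apply/funext => w; rewrite /dweight mulN1r.
apply: (ccont_sqr (u := fun t => (1 + -1 * t) `^ s)).
by apply: continuous_affine_powR; rewrite mulN1r; exact: inD_sqr_gt0.
Qed.

Lemma cabs_dweight s w : cabs (dweight s w) = (1 - cabs w ^+ 2) `^ s.
Proof. by rewrite cabs_real ger0_norm ?powR_ge0. Qed.

Lemma kernel_neq0 w z : inD w -> inD z -> 1 - (w^*)%C * z != 0.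
Proof.
move=> wD zD; rewrite -cabs_gt0; have := cabs_lerB 1 ((w^*)%C * z).
rewrite cabs1 cabsM cabs_conj => /(lt_le_trans _); apply.
by rewrite subr_gt0 mulr_ilt1 ?cabs_ge0.
Qed.

Lemma cabs_kernel_diag w : inD w -> cabs (1 - (w^*)%C * w) = 1 - cabs w ^+ 2.
Proof.
move=> wD; rewrite mulrC mulc_conj -(rmorph1 (real_complex R)) -rmorphB cabs_real ger0_norm//.
exact: ltW (inD_sqr_gt0 wD).
Qed.

(* |1 - w^* z|^2 - |w - z|^2 = (1 - |w|^2) (1 - |z|^2) *)
Lemma pseudo_hyperbolic w z : inD w -> inD z -> cabs (w - z) <= cabs (1 - (w^*)%C * z).
Proof.
move=> wD zD; rewrite -(@ler_pXn2r _ 2)// ?nnegrE ?cabs_ge0// -subr_ge0.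
have := mulr_ge0 (ltW (inD_sqr_gt0 wD)) (ltW (inD_sqr_gt0 zD)).
congr (_ <= _); rewrite !cabs_sqr; case: w z {wD zD} => [w1 w2] [z1 z2] /=; ring.
Qed.

Definition ckernel w z : R[i] := (1 - (w^*)%C * z)^-1.

Lemma is_cderiv_ckernel w z : inD w -> inD z ->
  is_cderiv (ckernel w) z ((w^*)%C * ckernel w z ^+ 2).
Proof.
move=> wD zD; have k0 := kernel_neq0 wD zD.
have := is_cderivV (is_cderivB (is_cderiv_cst 1 z) (is_cderivZ (w^*)%C (is_cderiv_id z))) k0.
by rewrite mulr1 sub0r opprK -exprVn.
Qed.

Lemma ccont_ckernel v : inD v -> ccont (ckernel ^~ v) v.
Proof.
move=> vD; apply: (ccontV (f := fun w => 1 - (w^*)%C * v)); last exact: kernel_neq0.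
apply: ccontD; first exact: ccont_cst.
by apply: ccontN; apply: ccontM; [exact: ccontJ|exact: ccont_cst].
Qed.

Lemma cabs_ckernel_diag w : inD w -> cabs (ckernel w w) = (1 - cabs w ^+ 2)^-1.
Proof. by move=> wD; rewrite cabsV cabs_kernel_diag. Qed.

(** Choosing k^p = 1/(2 (1 + C)) brings both terms of the p-th power of the norm below 1/2. The
    factor depends on [p] and [C] alone, so it normalizes a whole family at once. *)
Lemma normD_scale p C : 0 < p -> 0 <= C -> exists2 k : R, 0 < k & forall a f, analyticD f ->
  cabs (f 0) `^ p <= C -> (intAb a (fun z => (cabs (cderiv f z) `^ p)%R) <= C%:E)%E ->
  (normD p a (fun z => ((k%:C)%C * f z)%R) <= 1)%E.
Proof.
move=> p0 C0; have C20 : 0 < 2 * (1 + C) by rewrite mulr_gt0// ltr_pwDl.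
pose k := (2 * (1 + C)) `^ (- p^-1); exists k => [|a f af f0 If]; first exact: powR_gt0.
have k0 : 0 < k by exact: powR_gt0.
have kp : k `^ p = (2 * (1 + C))^-1.
  by rewrite /k -powRrM mulNr mulVf ?gt_eqF// powR_inv1// ltW.
have kC : k `^ p * C <= 2^-1.
  rewrite kp invfM -mulrA ler_piMr ?invr_ge0// mulrC ler_pdivrMr ?mul1r ?lerDr//.
  by rewrite ltr_pwDl.
have i0 : inD (0 : R[i]) by rewrite /inD cabs0.
have dk z : inD z -> cderiv (fun z => (k%:C)%C * f z) z = (k%:C)%C * cderiv f z.
  by move=> zD; apply: cderivE; apply: is_cderivZ; exact: is_cderivD_cderiv.
have ck z : cabs ((k%:C)%C * z) = k * cabs z by rewrite cabsM cabs_real gtr0_norm.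
rewrite /normD (eq_intAb _ (G := fun z => (k `^ p * cabs (cderiv f z) `^ p)%R)); last first.
  by move=> z zD; rewrite dk// ck powRM ?cabs_ge0// ltW.
have mf : measurable_fun (@diskR2 R) ((fun z => cabs (cderiv f z) `^ p) \o @toC R).
  by apply: (@measurable_cabs_powR _ (cderiv f) p); exact: analyticD_cderiv.
rewrite intAbZ ?powR_ge0// => [|z]; last exact: powR_ge0.
set I := intAb _ _ in If *.
have I0 : (0 <= I)%E.
  apply: integral_ge0 => x _; apply: (@intAb_integrand_ge0 _ a (fun z => cabs (cderiv f z) `^ p)).
  exact: powR_ge0.
have : ((cabs ((k%:C)%C * f 0) `^ p)%:E + (k `^ p)%:E * I <= 1)%E.
  rewrite (_ : 1%E = (2^-1 + 2^-1)%:E); last by congr (_%:E); order_lra.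
  rewrite EFinD; apply: leeD.
    rewrite lee_fin ck powRM ?cabs_ge0 ?(ltW k0)//; apply: le_trans kC.
    by rewrite ler_wpM2l ?powR_ge0.
  apply: (@le_trans _ _ ((k `^ p)%:E * C%:E)%E).
    by apply: lee_wpmul2l => //; rewrite lee_fin powR_ge0.
  by rewrite -EFinM lee_fin.
set X := (_ + _)%E => X1.
have X0 : (0 <= X)%E by rewrite adde_ge0 ?mule_ge0// lee_fin powR_ge0.
rewrite -(poweR1r p^-1); apply: gt0_ler_poweR => //; first by rewrite invr_ge0 ltW.
by rewrite in_itv /= X0 leey.
by rewrite in_itv /= leey andbT.
Qed.

(** With c = (n + 2) p > a + 2, the Forelli-Rudin estimate gives (1 - |w|)^(a+2-c), which the p-th
    power of the weight cancels up to a power of 2, as 1 - |w|^2 <= 2 (1 - |w|). The factor n + 3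
    leaves room for the product rule on (w - z) times the kernel to the power n + 2. *)
Lemma ckernel_norm p a n : -1 < a -> 0 < p -> (a + 2) / p < n.+2%:R ->
  exists2 k : R, 0 < k & forall w f df, inD w ->
  (forall z, inD z -> is_cderiv f z (df z)) -> cabs (f 0) <= 1 ->
  (forall z, inD z -> cabs (df z) <= n.+3%:R *
     ((1 - cabs w ^+ 2) `^ (n.+2%:R - (a + 2) / p) * cabs (ckernel w z) ^+ n.+2)) ->
  (normD p a (fun z => ((k%:C)%C * f z)%R) <= 1)%E.
Proof.
move=> a1 p0 hn; set c := n.+2%:R * p.
have ac : a + 2 < c by rewrite /c -ltr_pdivrMr.
have [C C0 hC] := forelli_rudin_gt a1 ac.
set B := n.+3%:R `^ p * (2 `^ (c - (a + 2)) * C).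
have B0 : 0 <= B by rewrite /B !mulr_ge0 ?powR_ge0// ltW.
have [|k k0 hk] := @normD_scale p (1 + B) p0; first by rewrite addr_ge0.
exists k => // w f df wD hf f0 hdf; have D0 := inD_sqr_gt0 wD; have d0 := inD_ball_gt0 wD.
have af : analyticD f by move=> z /hf; exists (df z).
apply: hk => //.
  apply: (@le_trans _ _ 1); last by rewrite lerDl.
  by apply: le_trans (powR_le (ltW p0) (cabs_ge0 _) f0) _; rewrite powR1.
apply: (@le_trans _ _ (intAb a (fun z => n.+3%:R `^ p * (1 - cabs w ^+ 2) `^ (c - (a + 2)) *
    cabs (1 - (w^*)%C * z) `^ (- c))%R)).
  apply: le_intAb_ae.
  - by apply: (@measurable_cabs_powR _ (cderiv f) p); exact: analyticD_cderiv.
  - apply: measurable_funM => //; exact: measurable_kernel_powR.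
  - by move=> z; exact: powR_ge0.
  - by move=> z; rewrite !mulr_ge0 ?powR_ge0.
  apply: aeW => x xD /=; rewrite (cderivE (hf _ xD)).
  apply: (le_trans (powR_le (ltW p0) (cabs_ge0 _) (hdf _ xD))).
  rewrite -(@powR_mulrn _ (cabs (ckernel _ _)))// ?cabs_ge0//.
  rewrite !powRM ?mulr_ge0 ?powR_ge0//.
  rewrite -mulrA ler_wpM2l ?powR_ge0//.
  rewrite -powRrM mulrBl divfK ?gt_eqF// ler_wpM2l ?powR_ge0//.
  rewrite -powRrM -/c cabsV powRN.
  by rewrite -powR_inv1 ?cabs_ge0// -powRrM mulN1r powRN.
rewrite intAbZ; first last.
- by move=> z; exact: powR_ge0.
- exact: measurable_kernel_powR.
- by rewrite mulr_ge0 ?powR_ge0.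
apply: (le_trans (lee_wpmul2l _ (hC w wD))); first by rewrite lee_fin mulr_ge0 ?powR_ge0.
rewrite -EFinM lee_fin; apply: (@le_trans _ _ B); last by rewrite lerDr.
rewrite /B -mulrA ler_wpM2l ?powR_ge0// mulrCA [leRHS]mulrC ler_wpM2l ?(ltW C0)//.
have ed : 0 <= c - (a + 2) by order_lra.
apply: (@le_trans _ _ ((2 * (1 - cabs w)) `^ (c - (a + 2)) * (1 - cabs w) `^ (a + 2 - c))).
  rewrite ler_wpM2r ?powR_ge0//; apply: powR_le => //; first exact: ltW.
  by have := cabs_ge0 w; order_nra.
rewrite powRM ?(ltW d0)// -mulrA -powRD; last by rewrite (gt_eqF d0) implybT.
by rewrite (_ : c - (a + 2) + (a + 2 - c) = 0) ?powRr0 ?mulr1//; ring.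
Qed.

End TestFunctions.

(** * Test families from kernel powers, and partial sums of the logarithm *)

Section TestFamilies.
Context {R : realType}.
Implicit Types (a p s x t C : R) (w z v : R[i]) (m n : nat).

Lemma cabs_nat n : cabs (n%:R : R[i]) = n%:R.
Proof. by rewrite -(rmorph_nat (real_complex R)) cabs_real ger0_norm. Qed.

Lemma powR_subn x t m : 0 < x -> x `^ t * x^-1 ^+ m = x `^ (t - m%:R).
Proof.
move=> x0; rewrite powRD; last by rewrite (gt_eqF x0) implybT.
by rewrite powRN powR_mulrn ?(ltW x0)// exprVn.
Qed.

Lemma dweight_le1 s w : 0 <= s -> inD w -> cabs (dweight s w) <= 1.
Proof.
move=> s0 wD; rewrite cabs_dweight; have D0 := inD_sqr_gt0 wD.
rewrite -[leRHS](congr1 (fun f => f s) (@powR1 R)); apply: powR_le => //; first exact: ltW.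
by rewrite gerBl sqr_ge0.
Qed.

Lemma ckernel0 w : ckernel w 0 = 1.
Proof. by rewrite /ckernel mulr0 subr0 invr1. Qed.

Lemma pseudo_hyperbolicV w z : inD w -> inD z -> cabs (w - z) * cabs (ckernel w z) <= 1.
Proof.
move=> wD zD; rewrite cabsV ler_pdivrMr ?mul1r ?cabs_gt0 ?kernel_neq0//.
exact: pseudo_hyperbolic.
Qed.

(** Integer exponents n + 2 and n + 1 with n + 2 > g keep the kernels single-valued, and the weight
    exponent s = n + 2 - g corrects the size: on the diagonal the kernel is 1/D in modulus, so D^s
    turns its powers into D^(-g) and D^(1-g). The factor w - z makes [F] vanish at w while its
    derivative there keeps the full power. *)
Lemma ckernel_tests a p : -1 < a -> 0 < p -> exists2 C, 0 <= C & exists F dF G dG,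
  [/\ test_family p a F dF, test_family p a G dG & forall v, inD v ->
    let D := 1 - cabs v ^+ 2 in let g := (a + 2) / p in
    [/\ F v v = 0, D `^ (- g) <= C * cabs (dF v v), D `^ (1 - g) <= C * cabs (G v v) &
        cabs (dG v v) <= C * D `^ (- g)]].
Proof.
move=> a1 p0; set g := (a + 2) / p.
pose n := Num.trunc g; have hn : g < n.+2%:R.
  by apply: lt_trans (truncnS_gt g) _; rewrite ltr_nat.
have [k k0 hk] := ckernel_norm a1 p0 hn.
set s := n.+2%:R - g in hk; have s0 : 0 <= s by rewrite subr_ge0 ltW.
pose F w z := (k%:C)%C * (dweight s w * ((w - z) * ckernel w z ^+ n.+2)).
pose dF w z := (k%:C)%C * (dweight s w * ((0 - 1) * ckernel w z ^+ n.+2 +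
  (w - z) * (n.+2%:R * ckernel w z ^+ n.+1 * ((w^*)%C * ckernel w z ^+ 2)))).
pose G w z := (k%:C)%C * (dweight s w * ckernel w z ^+ n.+1).
pose dG w z := (k%:C)%C * (dweight s w *
  (n.+1%:R * ckernel w z ^+ n * ((w^*)%C * ckernel w z ^+ 2))).
have cE m v : inD v -> ccont (fun w => ckernel w v ^+ m) v.
  by move=> vD; apply: ccontX; exact: ccont_ckernel.
have cD v : inD v -> ccont (dweight s) v by exact: ccont_dweight.
(* The first summand undoes the normalization in the lower bounds, the second dominates the
   derivative of [G]. *)
exists (k^-1 + k * n.+1%:R); first by rewrite addr_ge0 ?invr_ge0 ?mulr_ge0// ltW.
exists F, dF, G, dG; split.
- move=> w wD; split.
  + move=> z zD; do 2 apply: is_cderivZ; apply: is_cderivM.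
      by apply: is_cderivB; [exact: is_cderiv_cst|exact: is_cderiv_id].
    exact: (is_cderivX n.+2 (is_cderiv_ckernel wD zD)).
  + apply: (hk w _ (fun z => dweight s w * ((0 - 1) * ckernel w z ^+ n.+2 +
      (w - z) * (n.+2%:R * ckernel w z ^+ n.+1 * ((w^*)%C * ckernel w z ^+ 2))))) => //.
    * move=> z zD; apply: is_cderivZ; apply: is_cderivM.
        by apply: is_cderivB; [exact: is_cderiv_cst|exact: is_cderiv_id].
      exact: (is_cderivX n.+2 (is_cderiv_ckernel wD zD)).
    * rewrite ckernel0 expr1n mulr1 subr0 cabsM mulr_ile1 ?cabs_ge0 ?dweight_le1//.
      exact: ltW.
    * move=> z zD; rewrite cabsM cabs_dweight [leRHS]mulrCA ler_wpM2l ?powR_ge0//.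
      apply: le_trans (cabsD _ _) _; rewrite !(cabsX, cabsM) cabs_nat sub0r cabsN cabs1 mul1r.
      rewrite cabs_conj; have := pseudo_hyperbolicV wD zD.
      set e := cabs (ckernel w z); have e0 : 0 <= e by exact: cabs_ge0.
      (* The pseudo-hyperbolic bound [we] absorbs w - z against one kernel, so both terms of the
         product rule end with the kernel power n + 2. *)
      move=> we; have -> : n.+3%:R * e ^+ n.+2 = n.+2%:R * e ^+ n.+2 + e ^+ n.+2.
        by rewrite -[n.+3%:R]natr1 mulrDl mul1r.
      rewrite [leLHS]addrC lerD2r.
      rewrite [leLHS](_ : _ = (cabs (w - z) * e) * (cabs w * (n.+2%:R * e ^+ n.+2))); last first.
        by rewrite !exprS; ring.
      have X0 : 0 <= n.+2%:R * e ^+ n.+2 by rewrite mulr_ge0// exprn_ge0.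
      have w0 := cabs_ge0 w; have wz0 := cabs_ge0 (w - z).
      apply: (@le_trans _ _ (1 * (1 * (n.+2%:R * e ^+ n.+2)))); last by rewrite !mul1r.
      apply: ler_pM => //; first by rewrite mulr_ge0.
        by rewrite mulr_ge0.
      by apply: ler_wpM2r => //; exact: ltW.
  + apply: ccontM; first exact: ccont_cst.
    apply: ccontM; first exact: cD.
    apply: ccontM; last exact: cE.
    by apply: ccontD; [exact: ccont_id|exact: ccont_cst].
  + apply: ccontM; first exact: ccont_cst.
    apply: ccontM; first exact: cD.
    apply: ccontD; first by apply: ccontM; [exact: ccont_cst|exact: cE].
    apply: ccontM; first by apply: ccontD; [exact: ccont_id|exact: ccont_cst].
    apply: ccontM; first by apply: ccontM; [exact: ccont_cst|exact: cE].
    by apply: ccontM; [exact: ccontJ|exact: cE].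
- move=> w wD; split.
  + move=> z zD; do 2 apply: is_cderivZ.
    exact: (is_cderivX n.+1 (is_cderiv_ckernel wD zD)).
  + apply: (hk w _ (fun z => dweight s w *
      (n.+1%:R * ckernel w z ^+ n * ((w^*)%C * ckernel w z ^+ 2)))) => //.
    * move=> z zD; apply: is_cderivZ.
      exact: (is_cderivX n.+1 (is_cderiv_ckernel wD zD)).
    * by rewrite ckernel0 expr1n mulr1 dweight_le1.
    * move=> z zD; rewrite cabsM cabs_dweight [leRHS]mulrCA ler_wpM2l ?powR_ge0//.
      rewrite !(cabsX, cabsM) cabs_nat cabs_conj.
      set e := cabs (ckernel w z); have e0 : 0 <= e by exact: cabs_ge0.
      rewrite [leLHS](_ : _ = cabs w * (n.+1%:R * e ^+ n.+2)); last by rewrite !exprS; ring.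
      have X0 : 0 <= e ^+ n.+2 by rewrite exprn_ge0.
      apply: (@le_trans _ _ (1 * (n.+1%:R * e ^+ n.+2))).
        by apply: ler_wpM2r; [exact: mulr_ge0|exact: ltW].
      by rewrite mul1r ler_wpM2r// ler_nat ltnS leqW.
  + apply: ccontM; first exact: ccont_cst.
    by apply: ccontM; [exact: cD|exact: cE].
  + apply: ccontM; first exact: ccont_cst.
    apply: ccontM; first exact: cD.
    apply: ccontM; first by apply: ccontM; [exact: ccont_cst|exact: cE].
    by apply: ccontM; [exact: ccontJ|exact: cE].
- move=> v vD D; have D0 : 0 < D := inD_sqr_gt0 vD.
  have kE z : cabs ((k%:C)%C * z) = k * cabs z by rewrite cabsM cabs_real gtr0_norm.
  have kC y : 0 <= y -> y <= (k^-1 + k * n.+1%:R) * (k * y).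
    move=> y0; rewrite mulrDl mulrA mulVf ?gt_eqF// mul1r lerDl.
    by rewrite !mulr_ge0// ltW.
  have sn j : D `^ s * D^-1 ^+ j = D `^ (n.+2%:R - j%:R - g).
    by rewrite powR_subn// /s addrAC.
  split.
  + by rewrite /F subrr mul0r !mulr0.
  + rewrite /dF subrr mul0r addr0 kE cabsM cabs_dweight sub0r mulN1r cabsN cabsX.
    rewrite cabs_ckernel_diag// -/D sn subrr sub0r; apply: kC; exact: powR_ge0.
  + rewrite /G kE cabsM cabs_dweight cabsX cabs_ckernel_diag// -/D sn.
    have -> : n.+2%:R - n.+1%:R = 1 :> R by rewrite -[n.+2%:R]natr1 addrC addrA addNr add0r.
    by apply: kC; exact: powR_ge0.
  + rewrite /dG kE !(cabsM, cabsX) cabs_dweight cabs_ckernel_diag// cabs_conj cabs_nat -/D.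
    rewrite [leLHS](_ : _ = k * n.+1%:R * (cabs v * (D `^ s * D^-1 ^+ n.+2))); last first.
      by rewrite !exprS; ring.
    rewrite sn subrr sub0r mulrDl; set y := D `^ (- g).
    have y0 : 0 <= y by exact: powR_ge0.
    apply: (@le_trans _ _ (k * n.+1%:R * y)); last by rewrite lerDr mulr_ge0 ?invr_ge0// ltW.
    rewrite ler_wpM2l ?mulr_ge0 ?(ltW k0)// -[leRHS]mul1r ler_wpM2r//; exact: ltW.
Qed.

(** The cut M is the integer part of 1/D with D = 1 - x. Bernoulli's inequality x^j >= 1 - j D makes
    the partial sum at least the harmonic sum minus M D, hence at least ln(1/D) - 1; the remaining
    constants fit since ln 2 <= 1. The length depends on x, which is why the tests are indexed by
    M. *)
Lemma log_partial_sum x : 0 <= x < 1 -> exists M,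
  ln (2 / (1 - x)) <= 2 * (1 + \sum_(j < M) j.+1%:R^-1 * x ^+ j.+1).
Proof.
move=> /andP[x0 x1]; set D := 1 - x; have D0 : 0 < D by rewrite subr_gt0.
have D1 : D <= 1 by rewrite /D; order_lra.
pose M := Num.trunc D^-1; exists M.
have /andP[M1 M2] : M%:R <= D^-1 < M.+1%:R by apply: truncn_itv; rewrite invr_ge0 ltW.
set S := \sum_(j < M) _; have S0 : 0 <= S.
  by apply: sumr_ge0 => j _; rewrite mulr_ge0 ?invr_ge0// exprn_ge0.
have bern j : 1 - j%:R * D <= x ^+ j.
  elim: j => [|j IH]; first by rewrite mul0r subr0 expr0.
  have j0 : 0 <= j%:R :> R by [].
  rewrite exprS -natr1; apply: le_trans (ler_wpM2l x0 IH).
  move: (j%:R) j0 => y y0; rewrite (_ : x = 1 - D); last by rewrite /D; ring.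
  have : 0 <= y * D ^+ 2 by rewrite mulr_ge0// sqr_ge0.
  clearbody D; order_nra.
have harm m : ln m.+1%:R <= \sum_(j < m) j.+1%:R^-1 :> R.
  elim: m => [|m IH]; first by rewrite big_ord0 ln1.
  rewrite big_ord_recr /=; have m0 : 0 < m.+1%:R :> R by [].
  have -> : m.+2%:R = m.+1%:R * (1 + m.+1%:R^-1) :> R.
    by rewrite mulrDr mulr1 divff ?gt_eqF// natr1.
  rewrite lnM ?posrE ?addr_gt0 ?invr_gt0//; apply: lerD => //.
  by apply: le_ln1Dx; apply: (@lt_trans _ _ 0); rewrite ?invr_gt0 ?ltrN10.
have SM : ln M.+1%:R - M%:R * D <= S.
  apply: (@le_trans _ _ (\sum_(j < M) (j.+1%:R^-1 - D))).
    rewrite sumrB sumr_const card_ord mulr_natl lerD2r; exact: harm.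
  apply: ler_sum => j _; have j0 : 0 < j.+1%:R :> R by [].
  apply: le_trans (ler_wpM2l _ (bern j.+1)); last by rewrite invr_ge0.
  by rewrite mulrBr mulr1 mulrA mulVf ?gt_eqF// mul1r.
have MD : M%:R * D <= 1 by rewrite -ler_pdivlMr// div1r.
have lnDM : ln D^-1 <= ln M.+1%:R by rewrite ler_ln ?posrE ?invr_gt0// ltW.
have ln2 : ln (2 : R) <= 1.
  by have := @le_ln1Dx R 1; rewrite (_ : 1 + 1 = 2)//; apply; order_lra.
rewrite lnM ?posrE ?invr_gt0//; order_lra.
Qed.

End TestFamilies.

(** * Test functions in the borderline case *)

Section LogFamilies.
Context {R : realType}.
Implicit Types (a p s x t C : R) (w z v : R[i]) (m n : nat).

Definition logD w : R := ln (2 / (1 - cabs w ^+ 2)).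

Lemma logD_ge w : inD w -> ln 2 <= logD w.
Proof.
move=> wD; have D0 := inD_sqr_gt0 wD; rewrite ler_ln ?posrE ?divr_gt0//.
by rewrite ler_pdivlMr// ler_piMr// gerBl sqr_ge0.
Qed.

Lemma logD_gt0 w : inD w -> 0 < logD w.
Proof. by move=> /logD_ge; apply: lt_le_trans; rewrite ln_gt0// ltr1n. Qed.

Lemma ccont_logD s v : inD v -> ccont (fun w => ((logD w `^ s)%:C)%C) v.
Proof.
move=> vD; have D0 := inD_sqr_gt0 vD.
pose u (t : R) := (ln 2 + -1 * ln (1 + -1 * t)) `^ s.
have uE w : inD w -> logD w `^ s = u (cabs w ^+ 2).
  by move=> /inD_sqr_gt0 d; rewrite /u !mulN1r /logD ln_div ?posrE.
apply: (@ccont_ext _ (fun w => ((u (cabs w ^+ 2))%:C)%C) _ _ (1 - cabs v)).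
- exact: inD_ball_gt0.
- by move=> w /(inD_ball vD)/uE ->.
apply: ccont_sqr; apply: differentiable_continuous; apply/derivable1_diffP.
have d1 := is_derive_affine_ln (R := R) (c := 1) (k := -1) (t := cabs v ^+ 2).
rewrite mulN1r in d1; have {}d1 := d1 D0.
have d2 : 0 < ln 2 + -1 * ln (1 - cabs v ^+ 2).
  by have := logD_gt0 vD; rewrite /logD ln_div ?posrE// mulN1r.
have d3 := is_derive_affine_powR s d2.
rewrite -(mulN1r (cabs v ^+ 2)) in d3.
have := is_derive1_comp (f := fun y => (ln 2 + -1 * y) `^ s) (g := fun y => ln (1 + -1 * y)) d3 d1.
by move=> d4; exact: ex_derive.
Qed.

Lemma cabs_logD s w : cabs (((logD w `^ s)%:C)%C) = logD w `^ s.
Proof. by rewrite cabs_real ger0_norm ?powR_ge0. Qed.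

(** A partial sum of the logarithm differentiates to a finite geometric sum, at most twice the
    kernel uniformly in M. As p = a + 2, its p-th power integrates to order [logD w] by
    [forelli_rudin_eq], and the factor logD^(-1/p) normalizes it. At z = w a suitable M makes the
    sum at least half of logD, leaving logD^(1 - 1/p). *)
Lemma log_tests a p : -1 < a -> p = a + 2 -> exists2 C, 0 <= C & exists F dF,
  (forall M : nat, test_family p a (F M) (dF M)) /\
  forall v, inD v -> exists M, logD v `^ ((p - 1) / p) <= C * cabs (F M v v) /\
    cabs (dF M v v) <= C * (1 - cabs v ^+ 2) `^ (- 1).
Proof.
move=> a1 pa; have p1 : 1 < p by order_lra.
have p0 : 0 < p by order_lra.
have ln20 : 0 < ln (2 : R) by rewrite ln_gt0// ltr1n.
have [K K0 hK] := forelli_rudin_eq a1.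
(* The first summand bounds the value at 0, through logD >= ln 2; the second bounds the integral of
   the derivative. *)
set B := (ln 2)^-1 + 2 `^ p * K.
have B0 : 0 <= B by rewrite addr_ge0 ?invr_ge0 ?mulr_ge0 ?powR_ge0// ltW.
have [k k0 hk] := normD_scale p0 B0.
pose l w : R[i] := ((logD w `^ (- p^-1))%:C)%C.
pose G M w z := l w * (1 + \sum_(j < M) j.+1%:R^-1 * ((w^*)%C * z) ^+ j.+1).
pose dG M w z := l w * (0 + \sum_(j < M) j.+1%:R^-1 * (j.+1%:R * ((w^*)%C * z) ^+ j * (w^*)%C)).
have lp w : inD w -> (logD w `^ (- p^-1)) `^ p = (logD w)^-1.
  move=> wD; rewrite -powRrM mulNr mulVf ?gt_eqF// powR_inv1//; exact: ltW (logD_gt0 wD).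
have cdG M w z : inD w -> inD z ->
    cabs (dG M w z) <= 2 * (logD w `^ (- p^-1) * cabs (ckernel w z)).
  move=> wD zD; rewrite cabsM cabs_logD mulrCA ler_wpM2l ?powR_ge0//.
  have k1 := kernel_neq0 wD zD; set x := (w^*)%C * z in k1 *.
  have -> : 0 + \sum_(j < M) j.+1%:R^-1 * (j.+1%:R * x ^+ j * (w^*)%C) =
      (w^*)%C * ((1 - x ^+ M) * ckernel w z).
    have -> : 1 - x ^+ M = (1 - x) * \sum_(j < M) x ^+ j by rewrite -opprB subrX1 -mulNr opprB.
    rewrite mulrAC divff// mul1r add0r mulr_sumr; apply: eq_bigr => j _.
    by rewrite !mulrA mulVf ?pnatr_eq0// mul1r mulrC.
  rewrite mulrA cabsM ler_wpM2r ?cabs_ge0// cabsM cabs_conj.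
  have xM : cabs (1 - x ^+ M) <= 2.
    apply: le_trans (cabsB _ _) _; rewrite cabs1 cabsX /x cabsM cabs_conj.
    rewrite (_ : 2 = 1 + 1)// lerD2l exprn_ile1 ?mulr_ge0 ?cabs_ge0//.
    by apply: mulr_ile1; rewrite ?cabs_ge0//; exact: ltW.
  rewrite -[leRHS]mul1r; apply: ler_pM; rewrite ?cabs_ge0//; exact: ltW.
have hG M w z : inD w -> inD z -> is_cderiv (G M w) z (dG M w z).
  move=> wD zD; apply: is_cderivZ; apply: is_cderivD; first exact: is_cderiv_cst.
  apply: (@is_cderiv_sum R M (fun j z => j.+1%:R^-1 * ((w^*)%C * z) ^+ j.+1)
    (fun j => j.+1%:R^-1 * (j.+1%:R * ((w^*)%C * z) ^+ j * (w^*)%C))) => j.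
  apply: is_cderivZ; have := is_cderivZ (w^*)%C (is_cderiv_id z); rewrite mulr1.
  exact: (is_cderivX j.+1).
have nG M w : inD w -> (normD p a (fun z => ((k%:C)%C * G M w z)%R) <= 1)%E.
  move=> wD; have l0 := logD_gt0 wD.
  have aG : analyticD (G M w) by move=> z zD; exists (dG M w z); exact: hG.
  apply: hk => //.
    rewrite /G big1 => [|j _]; last by rewrite mulr0 exprS mul0r mulr0.
    rewrite addr0 mulr1 cabs_logD lp//; apply: (@le_trans _ _ (ln 2)^-1).
      by rewrite lef_pV2 ?posrE// logD_ge.
    by rewrite lerDl mulr_ge0 ?powR_ge0// ltW.
  have mk : measurable_fun (@diskR2 R) ((fun z => cabs (1 - (w^*)%C * z) `^ (- (a + 2))) \o @toC R).
    exact: measurable_kernel_powR.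
  apply: (@le_trans _ _ (intAb a (fun z => 2 `^ p * (logD w)^-1 *
      cabs (1 - (w^*)%C * z) `^ (- (a + 2)))%R)).
    apply: le_intAb_ae.
    - by apply: (@measurable_cabs_powR _ (cderiv (G M w)) p); exact: analyticD_cderiv.
    - exact: measurable_funM.
    - by move=> z; exact: powR_ge0.
    - by move=> z; rewrite !mulr_ge0 ?powR_ge0 ?invr_ge0// ltW.
    apply: aeW => x xD /=; rewrite (cderivE (hG M _ _ wD xD)).
    apply: (le_trans (powR_le (ltW p0) (cabs_ge0 _) (cdG M _ _ wD xD))).
    rewrite !powRM ?mulr_ge0 ?powR_ge0 ?cabs_ge0// lp// mulrA -pa.
    by rewrite cabsV -(@powR_inv1 _ (cabs (1 - _))) ?cabs_ge0// -powRrM mulN1r.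
  rewrite intAbZ//; first last.
  - by move=> z; exact: powR_ge0.
  - by rewrite mulr_ge0 ?powR_ge0 ?invr_ge0// ltW.
  apply: (le_trans (lee_wpmul2l _ (hK w wD))).
    by rewrite lee_fin mulr_ge0 ?powR_ge0 ?invr_ge0// ltW.
  rewrite -EFinM lee_fin -/(logD w) -mulrA (mulrC K) mulKf ?gt_eqF//.
  by rewrite lerDr invr_ge0 ltW.
have cl v : inD v -> ccont l v by exact: ccont_logD.
have cx v : ccont (fun w => (w^*)%C * v) v.
  by apply: ccontM; [exact: ccontJ|exact: ccont_cst].
(* [2 / k] undoes the normalization and the factor 2 of [log_partial_sum]; the other summand bounds
   the derivative, where logD >= ln 2 replaces the negative power of logD by a constant. *)
pose C := 2 / k + 2 * k * ln 2 `^ (- p^-1).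
have C1 : 0 <= 2 / k by rewrite divr_ge0// ltW.
have C2 : 0 <= 2 * k * ln 2 `^ (- p^-1) by rewrite mulr_ge0 ?powR_ge0 ?mulr_ge0// ltW.
exists C; first exact: addr_ge0.
exists (fun M w z => (k%:C)%C * G M w z), (fun M w z => (k%:C)%C * dG M w z); split.
  move=> M w wD; split.
  - by move=> z zD; apply: is_cderivZ; exact: hG.
  - exact: nG.
  - apply: ccontM; first exact: ccont_cst.
    apply: ccontM; first exact: cl.
    apply: ccontD; first exact: ccont_cst.
    apply: (@ccont_sum R M (fun j (u : R[i]) => j.+1%:R^-1 * ((u^*)%C * w) ^+ j.+1)) => j.
    by apply: ccontM; [exact: ccont_cst|apply: ccontX; exact: cx].
  - apply: ccontM; first exact: ccont_cst.
    apply: ccontM; first exact: cl.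
    apply: ccontD; first exact: ccont_cst.
    apply: (@ccont_sum R M (fun j (u : R[i]) => j.+1%:R^-1 * (j.+1%:R * ((u^*)%C * w) ^+ j * (u^*)%C))) => j.
    apply: ccontM; first exact: ccont_cst.
    apply: ccontM; last exact: ccontJ.
    by apply: ccontM; [exact: ccont_cst|apply: ccontX; exact: cx].
move=> v vD; have l0 := logD_gt0 vD; have D0 := inD_sqr_gt0 vD.
have kE z : cabs ((k%:C)%C * z) = k * cabs z by rewrite cabsM cabs_real gtr0_norm.
have [|M hM] := @log_partial_sum R (cabs v ^+ 2).
  by rewrite sqr_ge0 -subr_gt0.
exists M; rewrite !kE; split.
  rewrite cabsM cabs_logD; set S := \sum_(j < M) _ in hM.
  have -> : 1 + \sum_(j < M) j.+1%:R^-1 * ((v^*)%C * v) ^+ j.+1 = ((1 + S)%:C)%C.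
    rewrite rmorphD rmorph1 rmorph_sum; congr (_ + _); apply: eq_bigr => j _.
    by rewrite (mulrC _ v) mulc_conj [RHS]rmorphM [in RHS]fmorphV rmorph_nat [in RHS]rmorphXn.
  rewrite cabs_real; set y := 1 + S in hM *.
  apply: (@le_trans _ _ (2 / k * (k * (logD v `^ (- p^-1) * `|y|)))); last first.
    by rewrite ler_wpM2r ?mulr_ge0 ?powR_ge0 ?(ltW k0)// lerDl.
  rewrite [leRHS](_ : _ = logD v `^ (- p^-1) * (2 * `|y|)); last first.
    by field; rewrite gt_eqF.
  rewrite (_ : (p - 1) / p = - p^-1 + 1); last by field; rewrite gt_eqF.
  rewrite powRD; last by rewrite (gt_eqF l0) implybT.
  rewrite powRr1 ?(ltW l0)// ler_wpM2l ?powR_ge0//.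
  by apply: le_trans hM _; rewrite ler_wpM2l// ler_norm.
rewrite powR_inv1 ?(ltW D0)//.
apply: (@le_trans _ _ (2 * k * ln 2 `^ (- p^-1) * (1 - cabs v ^+ 2)^-1)); last first.
  by rewrite ler_wpM2r ?invr_ge0 ?(ltW D0)// lerDr.
rewrite (mulrC 2 k) -!mulrA ler_wpM2l ?(ltW k0)//.
apply: le_trans (cdG M _ _ vD vD) _; rewrite cabs_ckernel_diag// ler_wpM2l//.
rewrite ler_wpM2r ?invr_ge0 ?(ltW D0)//; apply: powR_geN => //; last exact: logD_ge.
by rewrite oppr_le0 invr_ge0 ltW.
Qed.

End LogFamilies.

(** * The three cases of the characterization *)

Section Characterizations.
Context {R : realType}.
Implicit Types (a p q r s t x D C beta : R) (z : R[i]).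

(** Growth bounds arise in terms of 1 - |z| while the integrals use 1 - |z|^2; as 1 - |z|^2 <= 2 (1
    - |z|), a nonpositive exponent makes the change cost a power of 2. *)
Lemma powR_dist_boundary r z : r <= 0 -> inD z ->
  (1 - cabs z) `^ r <= 2 `^ (- r) * (1 - cabs z ^+ 2) `^ r.
Proof.
move=> r0 zD; have d0 := inD_ball_gt0 zD.
apply: (@le_trans _ _ (2 `^ (- r) * (2 * (1 - cabs z)) `^ r)).
  rewrite powRM ?(ltW d0)// mulrA -powRD; last by rewrite pnatr_eq0 implybT.
  by rewrite addNr powRr0 mul1r.
rewrite ler_wpM2l ?powR_ge0//; apply: powR_geN => //; first exact: inD_sqr_gt0.
by have := cabs_ge0 z; order_nra.
Qed.

Lemma growth_deriv_sqr p a : -1 < a -> 0 < p -> exists2 C, 0 < C &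
  forall f z, analyticD f -> (normD p a f <= 1)%E -> inD z ->
  cabs (cderiv f z) <= C * (1 - cabs z ^+ 2) `^ (- ((a + 2) / p)).
Proof.
move=> a1 p0; have [C C0 hC] := growth_deriv a p0.
exists (C * 2 `^ ((a + 2) / p)); first by rewrite mulr_gt0// powR_gt0.
move=> f z af nf zD; apply: le_trans (hC f z af nf zD) _.
rewrite -mulrA ler_wpM2l ?(ltW C0)//.
have := @powR_dist_boundary (- ((a + 2) / p)) z; rewrite opprK; apply => //.
by rewrite oppr_le0 divr_ge0 ?(ltW p0)//; order_lra.
Qed.

Lemma powR_quotient x D s t q : 0 <= x -> s * q = - t ->
  (x * D `^ s) `^ q = x `^ q / D `^ t.
Proof. by move=> x0 st; rewrite powRM ?powR_ge0// -powRrM st powRN. Qed.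

Lemma measurable_1B_sqr : measurable_fun [set: R] (fun r : R => 1 - r ^+ 2).
Proof. by apply: measurable_funB => //; exact: measurable_funX. Qed.

Lemma eq_lty (x y : \bar R) : x = y -> (x < +oo)%E <-> (y < +oo)%E.
Proof. by move->. Qed.

Lemma order_bounded_lt p a q beta (phi vphi : R[i] -> R[i]) :
  -1 < a -> 0 < p -> 0 < q -> analyticD phi -> selfmapD vphi -> p < a + 2 ->
  order_bounded p a q beta phi vphi <->
  (intAb beta (fun z => (powR (cabs (phi z * cderiv vphi z)) q
     / powR (1 - cabs (vphi z) ^+ 2) (q * (a + 2) / p))%R)
   + intAb beta (fun z => (powR (cabs (cderiv phi z)) q
     / powR (1 - cabs (vphi z) ^+ 2) (q * (a + 2 - p) / p))%R) < +oo)%E.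
Proof.
move=> a1 p0 q0 aphi sm pa; set g := (a + 2) / p.
have g1 : 1 < g by rewrite ltr_pdivlMr// mul1r.
pose B (r : R) := (1 - r ^+ 2) `^ (1 - g).
have [C [C0 [F [dF [G [dG [tF tG hFG]]]]]]] := ckernel_tests a1 p0.
rewrite (@order_bounded_iff _ p a q beta g B phi vphi)//.
- apply: eq_lty; apply: (congr2 adde); apply: eq_intAb => z _; apply: powR_quotient;
    by rewrite ?cabs_ge0// /g; field; rewrite gt_eqF.
- exact: (measurableT_comp (measurable_powR (1 - g)) measurable_1B_sqr).
- by move=> r; exact: powR_ge0.
- have [C1 C10 h1] := growth_deriv_sqr a1 p0.
  have [C2 C20 h2] := growth_gt1 p0 pa.
  exists (C1 + C2 * 2 `^ (- (1 - g))); first by rewrite addr_gt0 ?mulr_gt0 ?powR_gt0.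
  move=> f z af nf zD; split.
    apply: le_trans (h1 f z af nf zD) _; rewrite ler_wpM2r ?powR_ge0// lerDl.
    by rewrite mulr_ge0 ?powR_ge0// ltW.
  apply: le_trans (h2 f z af nf zD) _.
  apply: (@le_trans _ _ (C2 * 2 `^ (- (1 - g)) * B (cabs z))).
    rewrite -mulrA ler_wpM2l ?(ltW C20)//; apply: powR_dist_boundary => //.
    by rewrite subr_le0 ltW.
  by rewrite ler_wpM2r ?powR_ge0// lerDr ltW.
- by exists C => //; exists F, dF; split=> // v /hFG[].
- exists C => //; exists (fun=> G), (fun=> dG); split=> // v /hFG[_ _ h1 h2].
  by exists 0%N.
Qed.

(** Here g = 1, and the family isolating f' is still that of [ckernel_tests]; the family attaining
    [B] comes from [log_tests]. Since p > 1 the exponent (1 - p)/p is negative, so dividing by that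
    power of the logarithm multiplies by B^q. *)
Lemma order_bounded_eq p a q beta (phi vphi : R[i] -> R[i]) :
  -1 < a -> 0 < p -> 0 < q -> analyticD phi -> selfmapD vphi -> p = a + 2 ->
  order_bounded p a q beta phi vphi <->
  (intAb beta (fun z => (powR (cabs (phi z * cderiv vphi z)) q
     / powR (1 - cabs (vphi z) ^+ 2) q)%R)
   + intAb beta (fun z => (powR (cabs (cderiv phi z)) q
     / powR (ln (2 / (1 - cabs (vphi z) ^+ 2))) (q * (1 - p) / p))%R) < +oo)%E.
Proof.
move=> a1 p0 q0 aphi sm pa; have p1 : 1 < p by order_lra.
have gE : (a + 2) / p = 1 by rewrite -pa divff// gt_eqF.
pose B (r : R) := (ln 2 - ln (1 - r ^+ 2)) `^ ((p - 1) / p).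
have BE z : inD z -> B (cabs z) = logD z `^ ((p - 1) / p).
  by move=> /inD_sqr_gt0 D0; rewrite /B /logD ln_div ?posrE.
have [C [C0 [F [dF [G [dG [tF tG hFG]]]]]]] := ckernel_tests a1 p0.
rewrite (@order_bounded_iff _ p a q beta 1 B phi vphi)//.
- apply: eq_lty; apply: (congr2 adde); apply: eq_intAb => z zD.
    by apply: powR_quotient; rewrite ?cabs_ge0// mulN1r.
  rewrite BE; last exact: sm.2.
  by apply: powR_quotient; rewrite ?cabs_ge0//; field; rewrite gt_eqF.
- apply: (measurableT_comp (measurable_powR _)); apply: measurable_funB => //.
  exact: (measurableT_comp (@measurable_ln R) measurable_1B_sqr).
- by move=> r; exact: powR_ge0.
- have [C1 C10 h1] := growth_deriv_sqr a1 p0.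
  have [C2 C20 h2] := growth_log p1 pa.
  exists (C1 + C2); first exact: addr_gt0.
  move=> f z af nf zD; split.
    have := h1 f z af nf zD; rewrite gE => /le_trans; apply.
    by rewrite ler_wpM2r ?powR_ge0// lerDl ltW.
  rewrite BE//; apply: le_trans (h2 f z af nf zD) _.
  by rewrite ler_wpM2r ?powR_ge0// lerDr ltW.
- by exists C => //; exists F, dF; split=> // v /hFG[? ]; rewrite gE.
- have [K K0 [L [dL [tL hL]]]] := log_tests a1 pa.
  by exists K => //; exists L, dL; split=> // v vD; rewrite BE//; exact: hL.
Qed.

(** The unit ball is uniformly bounded, so [B] is the constant 1 and the second integral becomes
    that of |phi'|^q. Its finiteness amounts to membership of [phi] in the target space, the term
    |phi(0)|^q being finite. *)
Lemma order_bounded_gt p a q beta (phi vphi : R[i] -> R[i]) :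
  -1 < a -> 0 < p -> 0 < q -> analyticD phi -> selfmapD vphi -> a + 2 < p ->
  order_bounded p a q beta phi vphi <->
  inDpa q beta phi /\
  (intAb beta (fun z => (powR (cabs (phi z * cderiv vphi z)) q
     / powR (1 - cabs (vphi z) ^+ 2) (q * (a + 2) / p))%R) < +oo)%E.
Proof.
move=> a1 p0 q0 aphi sm pa; set g := (a + 2) / p.
have [C [C0 [F [dF [G [dG [tF tG hFG]]]]]]] := ckernel_tests a1 p0.
rewrite (@order_bounded_iff _ p a q beta g (fun=> 1) phi vphi)//.
- rewrite (eq_intAb _ (F := fun z => ((cabs (phi z * cderiv vphi z) *
      (1 - cabs (vphi z) ^+ 2) `^ (- g)) `^ q)%R)
    (G := fun z => (cabs (phi z * cderiv vphi z) `^ q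
     / (1 - cabs (vphi z) ^+ 2) `^ (q * (a + 2) / p))%R)); last first.
    by move=> z _; apply: powR_quotient; rewrite ?cabs_ge0// /g; field; rewrite gt_eqF.
  rewrite (eq_intAb _ (F := fun z => ((cabs (cderiv phi z) * 1) `^ q)%R)
    (G := fun z => (cabs (cderiv phi z) `^ q)%R)); last by move=> z _; rewrite mulr1.
  set I1 := intAb _ _; set I2 := intAb _ _.
  have I10 : (0 <= I1)%E.
    apply: integral_ge0 => x _; rewrite lee_fin divr_ge0 ?pi_ge0//.
    by rewrite mulr_ge0 ?divr_ge0 ?powR_ge0.
  have I20 : (0 <= I2)%E.
    by apply: integral_ge0 => x _; rewrite lee_fin divr_ge0 ?mulr_ge0 ?powR_ge0 ?pi_ge0.
  split=> [fin|[[_ h2] h1]].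
    have h1 : (I1 < +oo)%E by apply: le_lt_trans fin; rewrite leeDl.
    have h2 : (I2 < +oo)%E by apply: le_lt_trans fin; rewrite leeDr.
    split=> //; split=> //; apply: poweR_lty; apply: lte_add_pinfty => //; exact: ltry.
  apply: lte_add_pinfty => //.
  have q1 : q^-1 != 0 by rewrite invr_eq0 gt_eqF.
  have {}h2 := lty_poweRy q1 h2.
  by apply: le_lt_trans h2; rewrite leeDr// lee_fin powR_ge0.
- have [C1 C10 h1] := growth_deriv_sqr a1 p0.
  have [C2 C20 h2] := growth_lt1 p0 pa.
  exists (C1 + C2); first exact: addr_gt0.
  move=> f z af nf zD; split.
    apply: le_trans (h1 f z af nf zD) _; by rewrite ler_wpM2r ?powR_ge0// lerDl ltW.
  by apply: le_trans (h2 f z af nf zD) _; rewrite mulr1 lerDr ltW.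
- by exists C => //; exists F, dF; split=> // v /hFG[].
(* The constant function 1 has norm 1 and derivative 0, so it attains [B] at every point with
   constant 1. *)
exists 1 => //; exists (fun _ _ _ => 1), (fun _ _ _ => 0); split=> [n w wD|v vD].
  split; [by move=> z _; exact: is_cderiv_cst| |exact: ccont_cst|exact: ccont_cst].
  rewrite /normD (eq_intAb _ (G := fun=> 0)) => [|z _].
    rewrite /intAb integral0_eq => [|x _]; last by rewrite !mul0r.
    by rewrite adde0 cabs1 powR1 poweR1r.
  by rewrite (cderivE (is_cderiv_cst 1 z)) cabs0 powR0// gt_eqF.
by exists 0%N; rewrite cabs1 cabs0 mulr1 mul1r powR_ge0.
Qed.

End Characterizations.

Theorem theorem2p3 (R : realType) (alpha beta p q : R)
  (phi vphi : R[i] -> R[i]) :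
  -1 < alpha -> -1 < beta -> 0 < p -> 0 < q ->
  analyticD phi -> selfmapD vphi ->
  [/\ (p < alpha + 2 ->
        (order_bounded p alpha q beta phi vphi <->
         (intAb beta (fun z => (powR (cabs (phi z * cderiv vphi z)) q
                        / powR (1 - cabs (vphi z) ^+ 2) (q * (alpha + 2) / p))%R)
          + intAb beta (fun z => (powR (cabs (cderiv phi z)) q
                        / powR (1 - cabs (vphi z) ^+ 2) (q * (alpha + 2 - p) / p))%R)
          < +oo)%E)),
      (p = alpha + 2 ->
        (order_bounded p alpha q beta phi vphi <->
         (intAb beta (fun z => (powR (cabs (phi z * cderiv vphi z)) q
                        / powR (1 - cabs (vphi z) ^+ 2) q)%R)
          + intAb beta (fun z => (powR (cabs (cderiv phi z)) q
                        / powR (ln (2 / (1 - cabs (vphi z) ^+ 2))) (q * (1 - p) / p))%R)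
          < +oo)%E)) &
      (alpha + 2 < p ->
        (order_bounded p alpha q beta phi vphi <->
         inDpa q beta phi /\
         (intAb beta (fun z => (powR (cabs (phi z * cderiv vphi z)) q
                        / powR (1 - cabs (vphi z) ^+ 2) (q * (alpha + 2) / p))%R)
          < +oo)%E))].
Proof.
move=> a1 b1 p0 q0 aphi sm; split=> pa.
- exact: order_bounded_lt.
- exact: order_bounded_eq.
- exact: order_bounded_gt.
Qed.
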